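(* Assume there exists a collision-resistant hash function $(\mathsf{GenH},H)$ with output length $\ell(\lambda)$. Then there exist a constant $0<\tau'<1$ and negligible functions $\mu(\cdot),\gamma(\cdot)$ such that for every $\tau\le\tau'$ there is a constant $0<\rho(\tau)<1$ for which there exists a constant-rate $(\ell(\lambda)\cdot\mathrm{polylog}\, n,\ \tau,\ \rho(\tau),\ \gamma(\cdot),\ \mu(\cdot))$-Weak CRLCC of blocklength $n$ over the binary alphabet. In particular, if $\ell(\lambda)=\mathrm{polylog}\,\lambda$ and $\lambda\in\Theta(n)$, then the code is a $(\mathrm{polylog}\, n,\tau,\rho,\gamma,\mu(\cdot))$-Weak CRLCC.
   Context: A function $\nu$ is negligible if $\nu(\lambda)=\lambda^{-\omega(1)}$. PPT means probabilistic polynomial time. Collision-resistant hash function (CRHF): a pair $(\mathsf{GenH},H)$ of PPT algorithms where $\mathsf{GenH}(1^\lambda)$ outputs a public seed $s$ and $H(s,\cdot)$ is a deterministic map from arbitrary-length strings to $\{0,1\}^{\ell(\lambda)}$, such that for every PPT adversary $\mathcal A$, the probability (over $s\leftarrow\mathsf{GenH}(1^\lambda)$ and $\mathcal A$'s coins) that $\mathcal A(s)$ outputs $x\ne x'$ with $H(s,x)=H(s,x')$ is negligible in $\lambda$. Local code: a tuple $(\mathsf{Gen},\mathsf{Enc},\mathsf{Dec})$ of probabilistic algorithms: $\mathsf{Gen}(1^\lambda)$ outputs a public seed $s$ (fixed once and for all); $\mathsf{Enc}(s,x)$ maps a message $x\in\Sigma^k$ to a codeword $c\in\Sigma^n$;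 $\mathsf{Dec}$ takes $s$ and an index $i\in[n]$, has oracle (query) access to a word $w\in\Sigma^n$, and outputs a symbol of $\Sigma$ or $\bot$. The rate is $k/n$. Computational adversarial channel $\mathcal A$ with error rate $\tau$: in a round, $s\leftarrow\mathsf{Gen}(1^\lambda)$ is generated and given to everyone; $\mathcal A(s)$ picks a message $x$; $c=\mathsf{Enc}(s,x)$; $\mathcal A$ changes at most $\tau n$ entries of $c$ to get $w$ and picks $i\in[n]$; the receiver outputs $b\leftarrow\mathsf{Dec}^w(s,i)$. Let $p_{\mathcal A,s}=\Pr[b\notin\{\bot,c_i\}]$ over $\mathsf{Dec}$'s coins. $\mathsf{Fool}_{\mathcal A,s}(\gamma,\tau,\lambda)$ is the event $p_{\mathcal A,s}>\gamma$. $\mathsf{Limit}_{\mathcal A,s}(\rho,\tau,\lambda)$ is the event $|\mathsf{Good}_{\mathcal A,s}|<\rho n$, where $\mathsf{Good}_{\mathcal A,s}$ is the set of $j\in[n]$ with $\Pr[\mathsf{Dec}^w(s,j)=c_j]>2/3$. A local code is a $(q,\tau,\rho,\gamma(\cdot),\mu(\cdot))$-CRLCC against a class $\mathbb A$ of adversaries if $\mathsf{Dec}^w$ makes at most $q$ queries to $w$ and: (1) for all seeds $s$, if $w=\mathsf{Enc}(s,x)$ then $\mathsf{Dec}^w(s,i)=(\mathsf{Enc}(s,x))_i$; (2) for all $\mathcal A\in\mathbb A$, $\Pr[\mathsf{Fool}_{\mathcal A,s}(\gamma(\lambda),\tau,\lambda)]\le\mu(\lambda)$; (3) for all $\mathcal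 A\in\mathbb A$, $\Pr[\mathsf{Limit}_{\mathcal A,s}(\rho,\tau,\lambda)]\le\mu(\lambda)$ (probabilities over $s\leftarrow\mathsf{Gen}(1^\lambda)$ and $\mathcal A$'s coins). Here $\mathbb A$ is the class of all PPT channels and $\mu$ negligible. A code satisfying (1) and (2) is a Weak CRLCC; one satisfying (1), (2) and (3) is a Strong CRLCC. *)

(* Defs.v *)
From mathcomp Require Import all_boot all_order all_algebra.
From mathcomp Require Import reals.
Set Implicit Arguments.
Unset Strict Implicit.
Unset Printing Implicit Defensive.
Import Order.TTheory GRing.Theory Num.Theory.

Local Open Scope nat_scope.

Definition bits := seq bool.

Definition unary (m : nat) : bits := nseq m true.

(* Binary numerals are little-endian. *)
Fixpoint nat_of_bits (u : bits) : nat :=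
  if u is b :: v then b + (nat_of_bits v).*2 else 0.

Fixpoint bin_rec (fuel m : nat) : bits :=
  if fuel is f.+1 then
    if m == 0 then [::] else odd m :: bin_rec f m./2
  else [::].

Definition bin (m : nat) : bits := bin_rec m m.

(* Model of computation: programs over finitely many stacks of bits, named by
   natural numbers, with unit-cost instructions.  A Turing tape is a pair of
   stacks, so these are probabilistic multi-tape Turing machines in structured
   form, with the same polynomial-time computations.  Each test or loop
   iteration, and each pairing [Seq], also costs one step. *)
Inductive cmd : Type :=
| Skip
| Push of bool & nat
| Pop of nat
| Toss of nat                      (* push a fresh coin *)
| Query of nat & nat               (* [Query x y]: push on [y] the oracle bit
                                      at the position written in binary on [x] *)
| Seq of cmd & cmd
| Case of nat & cmd & cmd & cmd    (* stack empty / top is 0 / top is 1 *)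
| While of nat & cmd.              (* as long as the stack is nonempty *)

Record conf : Type := Conf {
  cont : seq cmd;
  store : nat -> bits;
  tape : bits;       (* coins still unused *)
  nquery : nat
}.

Definition upd (sg : nat -> bits) (x : nat) (u : bits) : nat -> bits :=
  fun y => if y == x then u else sg y.

(* [w] is the oracle word; positions past its end read as 0.  [Toss] on an
   exhausted coin tape never completes, so a program that halts on the empty
   tape is deterministic. *)
Definition step (w : bits) (cf : conf) : conf :=
  let: Conf ks sg r q := cf in
  match ks with
  | [::] => cf
  | Skip :: ks' => Conf ks' sg r q
  | Push b x :: ks' => Conf ks' (upd sg x (b :: sg x)) r q
  | Pop x :: ks' => Conf ks' (upd sg x (behead (sg x))) r q
  | Toss x :: ks' =>
      if r is b :: r' then Conf ks' (upd sg x (b :: sg x)) r' q else cf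
  | Query x y :: ks' =>
      Conf ks' (upd sg y (nth false w (nat_of_bits (sg x)) :: sg y)) r q.+1
  | Seq c1 c2 :: ks' => Conf [:: c1, c2 & ks'] sg r q
  | Case x c c0 c1 :: ks' =>
      Conf ((if sg x is b :: _ then if b then c1 else c0 else c) :: ks') sg r q
  | While x c :: ks' =>
      Conf (if sg x is [::] then ks' else [:: c, While x c & ks']) sg r q
  end.

(* A program together with a bound on its running time. *)
Record alg : Type := Alg { prog : cmd; clock : nat -> nat }.

(* A run of at most [clock a m] steps uses at most that many coins. *)
Definition coins (a : alg) (m : nat) := (clock a m).-tuple bool.

(* The configuration reached after [clock a m] steps on the coins [r], with
   oracle [w], from the inputs [ins] (the j-th one on stack j). *)
Definition final (a : alg) (m : nat) (w : bits) (ins : seq bits) (r : bits) :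
    conf :=
  iter (clock a m) (step w) (Conf [:: prog a] (nth [::] ins) r 0).

Definition halts (a : alg) (m : nat) (w : bits) (ins : seq bits) (r : bits) :
    Prop :=
  nilp (cont (final a m w ins r)).

Definition output (a : alg) (m : nat) (w : bits) (ins : seq bits) (r : bits)
    (j : nat) : bits :=
  store (final a m w ins r) j.

Definition poly_bounded (f : nat -> nat) : Prop :=
  exists c, forall m, f m <= m ^ c + c.

(* To be used together with [halts] on the relevant inputs and all coins. *)
Definition polytime (a : alg) : Prop := poly_bounded (clock a).

(* [n] is computable in polynomial time, arguments and values in unary. *)
Definition polytime_length (n : nat -> nat) : Prop :=
  exists a : alg, polytime a /\ forall l,
    halts a l [::] [:: unary l] [::] /\
    output a l [::] [:: unary l] [::] 0 = unary (n l).

Definition eventually (P : nat -> Prop) : Prop :=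
  exists N, forall l, N <= l -> P l.

Definition polylog (f n : nat -> nat) : Prop :=
  exists c, eventually (fun l => f l <= c * trunc_log 2 (n l) ^ c).

Definition times_polylog (q f n : nat -> nat) : Prop :=
  exists c, eventually (fun l => q l <= f l * (c * trunc_log 2 (n l) ^ c)).

Definition big_theta (f g : nat -> nat) : Prop :=
  exists c, eventually (fun l => f l <= c * g l /\ g l <= c * f l).

Definition negligible (R : realType) (nu : nat -> R) : Prop :=
  (forall c : nat, eventually (fun l => `|nu l| <= (l%:R : R) ^- c))%R.

(* Probability of [E] under the uniform distribution on [T]. *)
Definition prob (R : realType) (T : finType) (E : pred T) : R :=
  (#|E|%:R / #|T|%:R)%R.
Arguments prob : clear implicits.

(* The output of a seed generator run on 1^l. *)
Definition seed (G : alg) (l : nat) (r : coins G l) : bits :=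
  output G l [::] [:: unary l] r 0.

Definition seed_generator (G : alg) : Prop :=
  polytime G /\ forall l (r : coins G l), halts G l [::] [:: unary l] r.

(* Collision-resistant hash functions.  Every algorithm also receives the
   security parameter in unary; the running time of [H s x] is polynomial in
   the security parameter and the length of [x]. *)
Definition hash_computable (G : alg) (H : bits -> bits -> bits) : Prop :=
  exists h : alg, polytime h /\
    forall l (rG : coins G l) (x : bits),
      let s := seed rG in let m := l + size x in
      halts h m [::] [:: unary l; s; x] [::] /\
      output h m [::] [:: unary l; s; x] [::] 0 = H s x.

Definition collision_prob (R : realType) (G : alg) (H : bits -> bits -> bits)
    (A : alg) (l : nat) : R :=
  prob R (coins G l * coins A l)%type (fun rr =>
    let s := seed rr.1 in
    let out := output A l [::] [:: unary l; s] rr.2 in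
    (out 0 != out 1) && (H s (out 0) == H s (out 1))).

Definition CRHF (R : realType) (ell : nat -> nat) (G : alg)
    (H : bits -> bits -> bits) : Prop :=
  [/\ seed_generator G,
      hash_computable G H,
      forall l (rG : coins G l) (x : bits), size (H (seed rG) x) = ell l
    & forall A : alg, polytime A ->
        (forall l (rG : coins G l) (r : coins A l),
           halts A l [::] [:: unary l; seed rG] r) ->
        negligible (collision_prob R G H A)].

(* Local codes over the binary alphabet, one code for each value of the
   security parameter. *)
Record local_code : Type := LocalCode {
  Gen : alg;
  Enc : alg;
  Dec : alg;
  msg_len : nat -> nat;
  block_len : nat -> nat
}.

Definition encode (C : local_code) (l : nat) (s x : bits) : bits :=
  output (Enc C) l [::] [:: unary l; s; x] [::] 0.

Definition dec_final (C : local_code) (l : nat) (w s : bits) (i : nat)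
    (r : bits) : conf :=
  final (Dec C) l w [:: unary l; s; bin i] r.

(* [None] is the rejection symbol. *)
Definition decode (C : local_code) (l : nat) (w s : bits) (i : nat)
    (r : bits) : option bool :=
  ohead (store (dec_final C l w s i r) 0).

(* Without injectivity of the encoding map the rate would be meaningless: a
   constant map could be declared to have any message length.  The lengths are
   computable, for otherwise no efficient channel could form a message of the
   prescribed length. *)
Definition is_local_code (C : local_code) : Prop :=
  [/\ seed_generator (Gen C),
      [/\ polytime (Enc C), polytime (Dec C), polytime_length (msg_len C)
        & polytime_length (block_len C)],
      forall l (rG : coins (Gen C) l) (x : bits), size x = msg_len C l ->
        halts (Enc C) l [::] [:: unary l; seed rG; x] [::] /\
        size (encode C l (seed rG) x) = block_len C l,
      forall l (rG : coins (Gen C) l) (x y : bits),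
        size x = msg_len C l -> size y = msg_len C l ->
        encode C l (seed rG) x = encode C l (seed rG) y -> x = y
    & forall l (rG : coins (Gen C) l) (w : bits) (i : nat)
        (r : coins (Dec C) l),
        size w = block_len C l -> i < block_len C l ->
        halts (Dec C) l w [:: unary l; seed rG; bin i] r].

(* An adversarial channel: [choose] picks the message and passes a state to
   [corrupt], which then sees the codeword and picks the corrupted word and the
   index. *)
Record channel : Type := Channel { choose : alg; corrupt : alg }.

Definition hamming (u v : bits) : nat := count (fun p => p.1 != p.2) (zip u v).

Section Round.
Variables (C : local_code) (A : channel) (l : nat).
Variables (rG : coins (Gen C) l) (r1 : coins (choose A) l).
Variable (r2 : coins (corrupt A) l).

Definition choose_input : seq bits := [:: unary l; seed rG].
Definition message : bits := output (choose A) l [::] choose_input r1 0.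
Definition chan_state : bits := output (choose A) l [::] choose_input r1 1.
Definition codeword : bits := encode C l (seed rG) message.
Definition corrupt_input : seq bits := [:: unary l; seed rG; chan_state; codeword].
Definition received : bits := output (corrupt A) l [::] corrupt_input r2 0.
Definition chan_index : nat :=
  nat_of_bits (output (corrupt A) l [::] corrupt_input r2 1).

(* The probability, over the coins of the decoder only, that it outputs a wrong
   symbol other than the rejection symbol. *)
Definition wrong_prob (R : realType) : R :=
  prob R (coins (Dec C) l) (fun r =>
    decode C l received (seed rG) chan_index r
      \notin [:: None; Some (nth false codeword chan_index)]).
End Round.

(* [A] is a probabilistic polynomial-time channel of error rate [tau]. *)
Definition is_channel (R : realType) (C : local_code) (tau : R) (A : channel) :
    Prop :=
  [/\ polytime (choose A),
      polytime (corrupt A),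
      forall l (rG : coins (Gen C) l) (r1 : coins (choose A) l),
        halts (choose A) l [::] (choose_input rG) r1 /\
        size (message rG r1) = msg_len C l
    & forall l (rG : coins (Gen C) l) (r1 : coins (choose A) l)
        (r2 : coins (corrupt A) l),
        [/\ halts (corrupt A) l [::] (corrupt_input rG r1) r2,
            size (received rG r1 r2) = block_len C l,
            ((hamming (codeword rG r1) (received rG r1 r2))%:R
               <= tau * (block_len C l)%:R)%R
          & chan_index rG r1 r2 < block_len C l]].

Definition fool_prob (R : realType) (C : local_code) (A : channel) (g : R)
    (l : nat) : R :=
  prob R (coins (Gen C) l * (coins (choose A) l * coins (corrupt A) l))%type
    (fun rr => (g < wrong_prob rr.1 rr.2.1 rr.2.2 R)%R).

(* The parameter [rho] constrains only the strong variant of the notion.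
   Security is asymptotic: the threshold past which [mu] bounds the fooling
   probability may depend on the adversary, as a polynomial-time adversary can
   have solutions for any finite set of security parameters built in. *)
Definition weak_CRLCC (R : realType) (C : local_code) (q : nat -> nat)
    (tau rho : R) (gamma mu : nat -> R) : Prop :=
  [/\ is_local_code C,
      forall l (rG : coins (Gen C) l) (w : bits) (i : nat)
        (r : coins (Dec C) l),
        size w = block_len C l -> i < block_len C l ->
        nquery (dec_final C l w (seed rG) i r) <= q l,
      forall l (rG : coins (Gen C) l) (x : bits) (i : nat)
        (r : coins (Dec C) l),
        size x = msg_len C l -> i < block_len C l ->
        let c := encode C l (seed rG) x in
        decode C l c (seed rG) i r = Some (nth false c i)
    & forall A : channel, is_channel C tau A ->
        eventually (fun l => fool_prob C A (gamma l) l <= mu l)%R].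

Definition constant_rate (R : realType) (C : local_code) (kappa : R) : Prop :=
  eventually (fun l => kappa * (block_len C l)%:R <= (msg_len C l)%:R)%R.

(* Block lengths, as functions of the security parameter: computable in
   polynomial time and polynomially related to it.  Positivity lets the channel
   pick an index for every value of the security parameter. *)
Definition admissible_length (n : nat -> nat) : Prop :=
  [/\ forall l, 0 < n l,
      exists c, forall l, n l <= l ^ c + c /\ l <= n l ^ c + c
    & polytime_length n].

(* Main.v *)
Require Import Defs.
From mathcomp Require Import all_boot all_order all_algebra.
From mathcomp Require Import boolp reals.
From mathcomp Require Import zify lra.

(** The codeword is a Merkle tree of the message together with a fingerprint of
    the root of the tree, spread over a constant fraction of the positions.

    Cut the message into chunks of [L] bits, where [L] is the output length of
    the hash function, and hash them up a binary tree stored as a heap.  The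
    codeword consists of all chunks of the tree, preceded by [F = Theta(n)] bits
    that encode the root with a linear code whose generator matrix is uniformly
    random and part of the public seed; except with probability [2^-Omega(n)] it
    has relative distance at least 1/16.  To decode a position, read the claimed
    root, compare its encoding with the fingerprint at [log^3 n] random
    positions, check the hashes on the path from the position up to the root, and
    reject if a test fails.  The channel cannot alter enough of the fingerprint
    for a wrong root to survive the sampling test, and if the root is right, then a
    wrong symbol on a path with correct hashes exhibits a collision, which is found
    by comparing the codeword with the received word.  If the hash values are longer
    than [n / 32], then the tree is the single chunk holding the whole message, and
    security is unconditional.

    The bound [mu] must not depend on the channel.  There are countably many
    programs with polynomial clocks [m ^ c + c], and countably many negligible
    functions are eventually dominated by a single one.

    Coins and queries are factored out of all programs: the decoder tosses its
    coins, computes the mask of the positions to query, and then applies a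
    deterministic polynomial-time function to the masked word. *)

Set Implicit Arguments.
Unset Strict Implicit.
Unset Printing Implicit Defensive.

Local Open Scope nat_scope.

(** * Big-step semantics *)

(** The constants fit together as follows. The fingerprint length F exceeds n/4, so a channel that
    changes at most n/128 bits alters fewer than F/32 fingerprint bits, while the encodings of two
    distinct roots are at distance at least F/16. A wrong root therefore disagrees with the
    fingerprint on at least F/32 positions and passes log^3 n samples with probability at most
    (31/32)^(log^3 n), eventually below gamma = 2^-(log^2 lambda). Roots have at most n/32 bits, so
    a union bound over them leaves the matrix bad with probability at most 2^-(n/16). A random
    matrix spares the construction of an explicit good code, and since its distance is a property of
    the matrix alone, the channel may see it. The reduction runs a channel whose clock need not be
    computable. It supplies as many coins as a polynomial bound on that clock, and surplus coins do
    not change a halting run. The bounds gamma and mu are fixed before the block length, hence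
    depend on lambda only. *)

Definition stacks := nat -> bits.

(** After the command come stacks, coins and query counter before the run, then the exact number of
    machine steps, then the same three data after the run. No rule tosses on an empty tape, so stuck
    runs have no derivation. *)
Inductive ev (w : bits) :
    cmd -> stacks -> bits -> nat -> nat -> stacks -> bits -> nat -> Prop :=
| ev_skip sg r q : ev w Skip sg r q 1 sg r q
| ev_push b x sg r q : ev w (Push b x) sg r q 1 (upd sg x (b :: sg x)) r q
| ev_pop x sg r q : ev w (Pop x) sg r q 1 (upd sg x (behead (sg x))) r q
| ev_toss b x sg r q :
    ev w (Toss x) sg (b :: r) q 1 (upd sg x (b :: sg x)) r q
| ev_query x y sg r q :
    ev w (Query x y) sg r q 1
      (upd sg y (nth false w (nat_of_bits (sg x)) :: sg y)) r q.+1
| ev_seq c1 c2 sg r q t1 sg1 r1 q1 t2 sg2 r2 q2 :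
    ev w c1 sg r q t1 sg1 r1 q1 -> ev w c2 sg1 r1 q1 t2 sg2 r2 q2 ->
    ev w (Seq c1 c2) sg r q (t1 + t2).+1 sg2 r2 q2
| ev_case x c c0 c1 sg r q t sg1 r1 q1 :
    ev w (if sg x is b :: _ then if b then c1 else c0 else c)
      sg r q t sg1 r1 q1 ->
    ev w (Case x c c0 c1) sg r q t.+1 sg1 r1 q1
| ev_while0 x c sg r q : sg x = [::] -> ev w (While x c) sg r q 1 sg r q
| ev_while1 x c sg r q t1 sg1 r1 q1 t2 sg2 r2 q2 :
    sg x <> [::] ->
    ev w c sg r q t1 sg1 r1 q1 -> ev w (While x c) sg1 r1 q1 t2 sg2 r2 q2 ->
    ev w (While x c) sg r q (t1 + t2).+1 sg2 r2 q2.

Lemma ev_iter w c sg r q t sg' r' q' : ev w c sg r q t sg' r' q' ->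
  forall ks, iter t (step w) (Conf (c :: ks) sg r q) = Conf ks sg' r' q'.
Proof.
elim=> {c sg r q t sg' r' q'} //.
- move=> c1 c2 sg r q t1 sg1 r1 q1 t2 sg2 r2 q2 _ IH1 _ IH2 ks.
  by rewrite iterSr addnC iterD /= IH1 IH2.
- move=> x c c0 c1 sg r q t sg1 r1 q1 _ IH ks.
  by rewrite iterSr /= IH.
- by move=> x c sg r q E ks /=; rewrite E.
- move=> x c sg r q t1 sg1 r1 q1 t2 sg2 r2 q2 E _ IH1 _ IH2 ks.
  rewrite iterSr addnC iterD /=; case: (sg x) E => // b u _.
  by rewrite IH1 IH2.
Qed.

Lemma iter_nil w t sg r q :
  iter t (step w) (Conf [::] sg r q) = Conf [::] sg r q.
Proof. by elim: t => //= t ->. Qed.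

Lemma iter_toss w t x ks sg q :
  iter t (step w) (Conf (Toss x :: ks) sg [::] q) = Conf (Toss x :: ks) sg [::] q.
Proof. by elim: t => //= t ->. Qed.

(** Converse of [ev_iter]. The induction is on the number of steps, because [While] puts itself back
    on the continuation. *)
Lemma halt_ev w t : forall c ks sg r q,
  nilp (cont (iter t (step w) (Conf (c :: ks) sg r q))) ->
  exists t1 sg1 r1 q1, [/\ t1 <= t, ev w c sg r q t1 sg1 r1 q1
    & iter t (step w) (Conf (c :: ks) sg r q)
      = iter (t - t1) (step w) (Conf ks sg1 r1 q1)].
Proof.
elim/ltn_ind: t => -[|t] // IH c ks sg r q.
rewrite iterSr.
case: c => [|b x|x|x|x y|c1 c2|x c c0 c1|x c] /= H;
  try by (do 4! eexists; split; [| constructor | rewrite subSS subn0]).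
- case: r H => [|b r] H; first by rewrite iter_toss in H.
  by do 4! eexists; split; [| constructor | rewrite subSS subn0].
- have [t1 [sg1 [r1 [q1 [le1 e1 E1]]]]] := IH t (ltnSn t) _ _ _ _ _ H.
  rewrite E1 in H.
  have lt1 : t - t1 < t.+1 by rewrite ltnS leq_subr.
  have [t2 [sg2 [r2 [q2 [le2 e2 E2]]]]] := IH _ lt1 _ _ _ _ _ H.
  exists (t1 + t2).+1, sg2, r2, q2; split; first lia.
    exact: ev_seq e1 e2.
  by rewrite E1 E2 subSS subnDA.
- have [t1 [sg1 [r1 [q1 [le1 e1 E1]]]]] := IH t (ltnSn t) _ _ _ _ _ H.
  exists t1.+1, sg1, r1, q1; split=> //; exact: ev_case.
- case Ex: (sg x) H => [|b u] H.
    exists 1, sg, r, q; split=> //; first exact: ev_while0.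
    by rewrite subSS subn0.
  have [t1 [sg1 [r1 [q1 [le1 e1 E1]]]]] := IH t (ltnSn t) _ _ _ _ _ H.
  rewrite E1 in H.
  have lt1 : t - t1 < t.+1 by rewrite ltnS leq_subr.
  have [t2 [sg2 [r2 [q2 [le2 e2 E2]]]]] := IH _ lt1 _ _ _ _ _ H.
  exists (t1 + t2).+1, sg2, r2, q2; split; first lia.
    by apply: ev_while1 e1 e2; rewrite Ex.
  by rewrite E1 E2 subSS subnDA.
Qed.

Lemma ev_final (a : alg) m w ins r t sg' r' q' :
  ev w (prog a) (nth [::] ins) r 0 t sg' r' q' -> t <= clock a m ->
  final a m w ins r = Conf [::] sg' r' q'.
Proof.
move=> /ev_iter H le_t.
by rewrite /final -(subnK le_t) iterD H iter_nil.
Qed.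

Lemma halts_ev (a : alg) m w ins r : halts a m w ins r ->
  exists t sg' r' q', [/\ t <= clock a m,
    ev w (prog a) (nth [::] ins) r 0 t sg' r' q'
  & final a m w ins r = Conf [::] sg' r' q'].
Proof.
move=> /halt_ev [t [sg [r' [q' [le e E]]]]].
exists t, sg, r', q'; split=> //.
by rewrite /final E iter_nil.
Qed.

Lemma ev_tape w c sg r q t sg' r' q' e : ev w c sg r q t sg' r' q' ->
  ev w c sg (r ++ e) q t sg' (r' ++ e) q'.
Proof.
elim=> {c sg r q t sg' r' q'}; try by move=> *; constructor.
- move=> c1 c2 sg r q t1 sg1 r1 q1 t2 sg2 r2 q2 _ IH1 _ IH2; exact: ev_seq IH1 IH2.
- move=> x c sg r q t1 sg1 r1 q1 t2 sg2 r2 q2 E _ IH1 _ IH2.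
  exact: ev_while1 IH1 IH2.
Qed.

(** Lets a program run with more coins than its clock allots, as happens when only a polynomial
    bound on the clock can be computed. *)
Lemma halts_output_cat (a : alg) m w ins r e : halts a m w ins r ->
  halts a m w ins (r ++ e) /\
  forall j, output a m w ins (r ++ e) j = output a m w ins r j.
Proof.
move=> /halts_ev [t [sg [r' [q' [le E F]]]]].
have G := ev_final (ev_tape e E) le.
by split=> [|j]; rewrite /halts /output G // F.
Qed.

Lemma ev_size w c sg r q t sg' r' q' y : ev w c sg r q t sg' r' q' ->
  size (sg' y) <= size (sg y) + t.
Proof.
have updS s x u : size u <= (size (s x)).+1 -> size (upd s x u y) <= size (s y) + 1.
  by rewrite /upd; case: eqP => [->|_]; rewrite addn1 //= => _.
elim=> {c sg r q t sg' r' q'}; try by move=> *; rewrite ?leq_addr //; apply: updS.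
- by move=> x sg r q; apply: updS; rewrite size_behead; lia.
- by move=> *; lia.
- by move=> *; lia.
- by move=> *; lia.
Qed.

(** Stacks with index at least [bound c] keep their contents ([ev_bound]) and can hold data hidden
    from [c]. *)
Fixpoint bound (c : cmd) : nat :=
  match c with
  | Skip => 0
  | Push _ x | Pop x | Toss x => x.+1
  | Query x y => maxn x.+1 y.+1
  | Seq c1 c2 => maxn (bound c1) (bound c2)
  | Case x c c0 c1 => maxn x.+1 (maxn (bound c) (maxn (bound c0) (bound c1)))
  | While x c => maxn x.+1 (bound c)
  end.

Lemma ev_bound w c sg r q t sg' r' q' y : ev w c sg r q t sg' r' q' ->
  bound c <= y -> sg' y = sg y.
Proof.
have updN s x u : x < y -> upd s x u y = s y by rewrite /upd; case: eqP => //; lia.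
elim=> {c sg r q t sg' r' q'} //=; try by move=> *; rewrite updN //; lia.
- by move=> c1 c2 sg r q t1 sg1 r1 q1 t2 sg2 r2 q2 _ IH1 _ IH2 H;
    rewrite IH2 ?IH1 //; lia.
- move=> x c c0 c1 sg r q t sg1 r1 q1 _ IH H; apply: IH.
  by case: (sg x) => [|[] _]; lia.
- by move=> x c sg r q t1 sg1 r1 q1 t2 sg2 r2 q2 E _ IH1 _ IH2 H;
    rewrite IH2 ?IH1 //; lia.
Qed.

(** Quantifying over oracle word, coins and counter expresses that the run neither tosses nor
    queries. *)
Definition run (c : cmd) (sg : stacks) (t : nat) (sg' : stacks) : Prop :=
  forall w r q, ev w c sg r q t sg' r q.

Lemma run_seq c1 c2 sg t1 sg1 t2 sg2 :
  run c1 sg t1 sg1 -> run c2 sg1 t2 sg2 -> run (Seq c1 c2) sg (t1 + t2).+1 sg2.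
Proof. by move=> H1 H2 w r q; apply: ev_seq (H1 w r q) (H2 w r q). Qed.

Lemma run_size c sg t sg' y : run c sg t sg' -> size (sg' y) <= size (sg y) + t.
Proof. by move=> /(_ [::] [::] 0) /ev_size. Qed.

Lemma updC sg x y u v : x <> y ->
  upd (upd sg x u) y v = upd (upd sg y v) x u.
Proof.
by move=> H; apply/funext=> z; rewrite /upd; case: eqP => [->|//]; case: eqP => // E; case: H.
Qed.

Lemma upd_same sg x u v : upd (upd sg x u) x v = upd sg x v.
Proof. by apply/funext=> z; rewrite /upd; case: eqP. Qed.

Lemma upd_eq sg x u : upd sg x u x = u.
Proof. by rewrite /upd eqxx. Qed.

Lemma upd_neq sg x y u : y <> x -> upd sg x u y = sg y.
Proof. by move=> H; rewrite /upd; case: eqP. Qed.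

(* Coins are read from stack [R]; the oracle word is taken to be empty. *)
Fixpoint derand (R : nat) (c : cmd) : cmd :=
  match c with
  | Toss x =>
      Case R Skip (Seq (Pop R) (Push false x)) (Seq (Pop R) (Push true x))
  | Query _ y => Push false y
  | Seq c1 c2 => Seq (derand R c1) (derand R c2)
  | Case x c c0 c1 => Case x (derand R c) (derand R c0) (derand R c1)
  | While x c => While x (derand R c)
  | _ => c
  end.

(** The factor 4 is the cost of a simulated [Toss]: a [Case], a [Seq], a [Pop] and a [Push]. *)
Lemma derand_run R c sg r q t sg' r' q' : ev [::] c sg r q t sg' r' q' ->
  bound c <= R ->
  exists2 t', t' <= 4 * t & run (derand R c) (upd sg R r) t' (upd sg' R r').
Proof.
elim=> {c sg r q t sg' r' q'} /=.
- by move=> sg r q _; exists 1 => // w r0 q0; constructor.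
- move=> b x sg r q H; exists 1 => // w r0 q0.
  rewrite updC; last lia.
  by rewrite -(@upd_neq sg R x r); [constructor | lia].
- move=> x sg r q H; exists 1 => // w r0 q0.
  rewrite updC; last lia.
  by rewrite -(@upd_neq sg R x r); [constructor | lia].
- move=> b x sg r q H; exists (1 + 1).+2 => // w r0 q0.
  apply: ev_case; rewrite upd_eq.
  have P : ev w (Seq (Pop R) (Push b x)) (upd sg R (b :: r)) r0 q0 (1 + 1).+1
      (upd (upd sg x (b :: sg x)) R r) r0 q0.
    apply: ev_seq; first exact: ev_pop.
    rewrite upd_eq upd_same /= updC; last lia.
    rewrite -(@upd_neq sg R x r); last lia.
    exact: ev_push.
  by case: b P.
- move=> x y sg r q H; exists 1 => // w r0 q0.
  rewrite nth_nil updC; last lia.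
  by rewrite -(@upd_neq sg R y r); [constructor | lia].
- move=> c1 c2 sg r q t1 sg1 r1 q1 t2 sg2 r2 q2 _ IH1 _ IH2 H.
  have [|t1' l1 H1] := IH1; first lia.
  have [|t2' l2 H2] := IH2; first lia.
  by exists (t1' + t2').+1; [lia | exact: run_seq H1 H2].
- move=> x c c0 c1 sg r q t sg1 r1 q1 _ IH H.
  have [|t' l H1] := IH; first by case: (sg x) => [|[] _]; lia.
  exists t'.+1; first lia.
  move=> w r0 q0; apply: ev_case; rewrite upd_neq; last lia.
  by move: (H1 w r0 q0); case: (sg x) => [|[] _].
- move=> x c sg r q E H; exists 1 => // w r0 q0; apply: ev_while0.
  by rewrite upd_neq //; lia.
- move=> x c sg r q t1 sg1 r1 q1 t2 sg2 r2 q2 E _ IH1 _ IH2 H.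
  have [|t1' l1 H1] := IH1; first lia.
  have [|t2' l2 H2] := IH2; first lia.
  exists (t1' + t2').+1; first lia.
  move=> w r0 q0; apply: ev_while1 (H1 w r0 q0) (H2 w r0 q0).
  by rewrite upd_neq //; lia.
Qed.

(** * Renaming of stacks and weakening *)

Fixpoint ren (f : nat -> nat) (c : cmd) : cmd :=
  match c with
  | Skip => Skip
  | Push b x => Push b (f x)
  | Pop x => Pop (f x)
  | Toss x => Toss (f x)
  | Query x y => Query (f x) (f y)
  | Seq c1 c2 => Seq (ren f c1) (ren f c2)
  | Case x c c0 c1 => Case (f x) (ren f c) (ren f c0) (ren f c1)
  | While x c => While (f x) (ren f c)
  end.

Lemma ev_ren f w c sg r q t sg' r' q' : injective f ->
  ev w c sg r q t sg' r' q' ->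
  forall tau, (forall y, tau (f y) = sg y) ->
  exists tau', [/\ ev w (ren f c) tau r q t tau' r' q',
    forall y, tau' (f y) = sg' y
  & forall z, (forall y, z <> f y) -> tau' z = tau z].
Proof.
move=> If.
have updP sg0 tau x u : (forall y, tau (f y) = sg0 y) ->
    (forall y, upd tau (f x) u (f y) = upd sg0 x u y) /\
    (forall z, (forall y, z <> f y) -> upd tau (f x) u z = tau z).
  move=> H; split=> [y|z /(_ x) Hz].
    by rewrite /upd (inj_eq If) H.
  by rewrite upd_neq.
elim=> {c sg r q t sg' r' q'} /=.
- by move=> sg r q tau H; exists tau; split=> //; constructor.
- move=> b x sg r q tau H.
  have [H1 H2] := updP _ _ x (b :: sg x) H.
  by eexists; split; [| exact: H1 | exact: H2]; rewrite -(H x); constructor.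
- move=> x sg r q tau H.
  have [H1 H2] := updP _ _ x (behead (sg x)) H.
  by eexists; split; [| exact: H1 | exact: H2]; rewrite -(H x); constructor.
- move=> b x sg r q tau H.
  have [H1 H2] := updP _ _ x (b :: sg x) H.
  by eexists; split; [| exact: H1 | exact: H2]; rewrite -(H x); constructor.
- move=> x y sg r q tau H.
  have [H1 H2] := updP _ _ y (nth false w (nat_of_bits (sg x)) :: sg y) H.
  by eexists; split; [| exact: H1 | exact: H2]; rewrite -(H y) -(H x); constructor.
- move=> c1 c2 sg r q t1 sg1 r1 q1 t2 sg2 r2 q2 _ IH1 _ IH2 tau H.
  have [tau1 [E1 F1 G1]] := IH1 _ H.
  have [tau2 [E2 F2 G2]] := IH2 _ F1.
  exists tau2; split=> //; first exact: ev_seq E1 E2.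
  by move=> z Hz; rewrite G2 ?G1.
- move=> x c c0 c1 sg r q t sg1 r1 q1 _ IH tau H.
  have [tau1 [E1 F1 G1]] := IH _ H.
  exists tau1; split=> //; apply: ev_case; rewrite H.
  by move: E1; case: (sg x) => [|[] _].
- by move=> x c sg r q E tau H; exists tau; split=> //; apply: ev_while0; rewrite H.
- move=> x c sg r q t1 sg1 r1 q1 t2 sg2 r2 q2 E _ IH1 _ IH2 tau H.
  have [tau1 [E1 F1 G1]] := IH1 _ H.
  have [tau2 [E2 F2 G2]] := IH2 _ F1.
  exists tau2; split=> //; first by apply: ev_while1 E1 E2; rewrite H.
  by move=> z Hz; rewrite G2 ?G1.
Qed.

Notation stk := (@nth bits [::]).

(** Opens a gap of [p] fresh stacks at index [k], as de Bruijn lifting does for variables. *)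
Definition lift_stack (k p y : nat) : nat := if y < k then y else y + p.

(** A frame rule: the block [M] in the gap survives. The hypothesis on sizes keeps the gap at the
    same place before and after the run. *)
Lemma run_weak c A B M t A' B' :
  size A' = size A ->
  run c (stk (A ++ B)) t (stk (A' ++ B')) ->
  run (ren (lift_stack (size A) (size M)) c) (stk (A ++ M ++ B)) t
      (stk (A' ++ M ++ B')).
Proof.
move=> sA H w r q.
set f := lift_stack _ _.
have If : injective f by move=> x y; rewrite /f /lift_stack; do 2! case: ifP => ?; lia.
have nthf X Y y : size X = size A ->
    stk (X ++ M ++ Y) (f y) = stk (X ++ Y) y.
  move=> sX; rewrite /f /lift_stack !nth_cat sX.
  case hy: (y < size A); first by rewrite hy.
  rewrite ifF; last lia.
  rewrite ifF; last lia.
  by congr nth; lia.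
have [tau [E F G]] := ev_ren If (H w r q) (fun y => nthf A B y erefl).
suff <- : tau = stk (A' ++ M ++ B') by [].
apply/funext=> z.
case: (ltnP z (size A)) => hz.
  have Ez : z = f z by rewrite /f /lift_stack hz.
  by rewrite Ez F nthf.
case: (ltnP z (size A + size M)) => hz2; last first.
  have Ez : z = f (z - size M) by rewrite /f /lift_stack ifF; lia.
  by rewrite Ez F nthf.
rewrite G; first by rewrite !nth_cat sA ltnNge hz /= ltn_subLR // hz2.
by move=> y; rewrite /f /lift_stack; case: ifP => ?; lia.
Qed.

(** * Polynomial-time functions *)

(** Monotonicity allows a time bound to be evaluated at an upper bound of the input size, as
    composition requires. *)
Definition pm (T : nat -> nat) : Prop :=
  poly_bounded T /\ {homo T : m n / m <= n}.

Lemma pm_id : pm id.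
Proof. by split=> //; exists 1 => m; rewrite expn1 leq_addr. Qed.

Lemma pm_const k : pm (fun _ => k).
Proof. by split=> //; exists k => m; rewrite leq_addl. Qed.

Lemma leq_exp_base m a b : 0 < m -> a <= b -> m ^ a <= m ^ b.
Proof. by move=> m0 ab; rewrite leq_pexp2l. Qed.

Lemma pm_add f g : pm f -> pm g -> pm (fun m => f m + g m).
Proof.
move=> [[a Ha] Mf] [[b Hb] Mg]; split; last by move=> m n H; rewrite leq_add ?Mf ?Mg.
exists (a + b).+2 => m; have {Ha} := Ha m; have {Hb} := Hb m.
(* For [m <= 1] powers do not grow, and the additive constant has to absorb the sum. *)
case: m => [|[|m]] Hb Ha.
- have : 0 ^ a <= 1 by case: a {Ha} => [|a]; rewrite ?expn0 ?exp0n.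
  have : 0 ^ b <= 1 by case: b {Hb} => [|b]; rewrite ?expn0 ?exp0n.
  lia.
- move: Ha Hb; rewrite !exp1n; lia.
- have A : m.+2 ^ a <= m.+2 ^ (a + b) by apply: leq_exp_base => //; lia.
  have B : m.+2 ^ b <= m.+2 ^ (a + b) by apply: leq_exp_base => //; lia.
  rewrite !expnS; nia.
Qed.

Lemma pm_mul f g : pm f -> pm g -> pm (fun m => f m * g m).
Proof.
move=> [[a Ha] Mf] [[b Hb] Mg]; split; last by move=> m n H; rewrite leq_mul ?Mf ?Mg.
(* For [m >= 2] the factors are at most [a.+1 * m ^ a] and [b.+1 * m ^ b], and the constant
   [a.+1 * b.+1] is absorbed as an exponent of 2. For [m <= 1] the additive copy of the witness
   suffices. *)
exists (a + b + a.+1 * b.+1) => m.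
apply: leq_trans (leq_mul (Ha m) (Hb m)) _.
case: m => [|[|m]].
- have : 0 ^ a <= 1 by case: (a) => [|c]; rewrite ?expn0 ?exp0n.
  have : 0 ^ b <= 1 by case: (b) => [|c]; rewrite ?expn0 ?exp0n.
  set x := 0 ^ a; set y := 0 ^ b => hy hx.
  apply: leq_trans (_ : a.+1 * b.+1 <= _); last by lia.
  by apply: leq_mul; lia.
- rewrite !exp1n; lia.
- have A : m.+2 ^ a + a <= a.+1 * m.+2 ^ a.
    rewrite mulSn leq_add2l leq_pmulr // expn_gt0; lia.
  have B : m.+2 ^ b + b <= b.+1 * m.+2 ^ b.
    rewrite mulSn leq_add2l leq_pmulr // expn_gt0; lia.
  apply: leq_trans (leq_mul A B) _.
  rewrite mulnACA -expnD mulnC !expnD -addnA.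
  apply: leq_trans (leq_addr _ _).
  rewrite leq_mul2l; apply/orP; right.
  apply: leq_trans (ltnW (ltn_expl _ (ltnSn 1))) _.
  by rewrite leq_exp2r //.
Qed.

Lemma pm_pow f a : pm f -> pm (fun m => f m ^ a).
Proof.
move=> Hf; elim: a => [|a IH]; first exact: pm_const.
have -> : (fun m => f m ^ a.+1) = (fun m => f m * f m ^ a).
  by apply/funext=> m; rewrite expnS.
exact: pm_mul.
Qed.

Lemma pm_comp f g : pm f -> pm g -> pm (fun m => f (g m)).
Proof.
move=> [[a Ha] Mf] Hg; split; last by move=> m n H; apply: Mf; apply: Hg.2.
have [[c Hc] _] := pm_add (pm_pow a Hg) (pm_const a).
by exists c => m; apply: leq_trans (Hc m); apply: Ha.
Qed.

Ltac pm_tac := repeat first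
  [ exact: pm_id | exact: pm_const | assumption | apply: pm_add | apply: pm_mul
  | match goal with H : pm ?f |- pm (fun m => ?f (@?g m)) => apply: (pm_comp H) end ].

(** An input [x] occupies the first [ar] stacks as [enc x]; [dom] is the promise under which
    programs must be correct. *)
Record ctx : Type := Ctx {
  cty :> Type;
  dom : cty -> Prop;
  ar : nat;
  enc : cty -> seq bits;
  encP : forall x, size (enc x) = ar
}.

Definition tsz (e : seq bits) : nat := sumn (map size e).

Lemma tsz_cat e1 e2 : tsz (e1 ++ e2) = tsz e1 + tsz e2.
Proof. by rewrite /tsz map_cat sumn_cat. Qed.

Lemma tsz_nth e j : size (stk e j) <= tsz e.
Proof.
elim: e j => [|u e IH] [|j] //=; first by rewrite leq_addr.
by apply: leq_trans (IH j) _; rewrite leq_addl.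
Qed.

(* The results are pushed on the first stacks above those of the context. *)
Definition ptimes (G : ctx) (p : nat) (fs : G -> seq bits) : Prop :=
  exists c T, pm T /\ forall x : G, dom x -> size (fs x) = p /\
    exists2 t, t <= T (tsz (enc x))
      & run c (stk (enc x)) t (stk (enc x ++ fs x)).

Definition ptime (G : ctx) (f : G -> bits) : Prop := ptimes 1 (fun x => [:: f x]).

Lemma ptime_ext (G : ctx) (f g : G -> bits) :
  (forall x, dom x -> g x = f x) -> ptime f -> ptime g.
Proof.
move=> E [c [T [HT H]]]; exists c, T; split=> // x Dx.
by rewrite E //; apply: H.
Qed.

Lemma run_out_size c e u t :
  run c (stk e) t (stk (e ++ [:: u])) -> size u <= t.
Proof.
by move=> /(@run_size _ _ _ _ (size e)); rewrite nth_cat ltnn subnn (nth_default _ (leqnn _)).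
Qed.

Lemma ptimes_out_size c e us t :
  run c (stk e) t (stk (e ++ us)) -> tsz us <= size us * t.
Proof.
move=> H.
have : forall j, j < size us -> size (stk us j) <= t.
  move=> j hj; move/(@run_size _ _ _ _ (size e + j)): H.
  by rewrite nth_cat ltnNge leq_addr /= addKn (nth_default _ (leq_addr _ _)).
elim: us {H} => [|u us IH] //= H.
by rewrite /tsz /= mulSn leq_add ?(H 0) //; apply: IH => j; apply: (H j.+1).
Qed.

Lemma ptime_size (G : ctx) (f : G -> bits) : ptime f ->
  exists2 T, pm T & forall x : G, dom x -> size (f x) <= T (tsz (enc x)).
Proof.
move=> [c [T [HT H]]]; exists T => // x Dx.
have [_ [t le R]] := H x Dx.
exact: leq_trans (run_out_size R) le.
Qed.

(** * Moving, copying and clearing stacks *)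

Definition clear (x : nat) : cmd := While x (Pop x).

Lemma run_clear x sg : run (clear x) sg (2 * size (sg x)).+1 (upd sg x [::]).
Proof.
move=> w r q; move E: (sg x) => u.
elim: u sg E => [|b u IH] sg E.
  have -> : upd sg x [::] = sg by apply/funext=> y; rewrite /upd; case: eqP => // ->.
  exact: ev_while0.
have -> : (2 * size (b :: u)).+1 = (1 + (2 * size u).+1).+1 by rewrite /=; lia.
apply: ev_while1; [by rewrite E | exact: ev_pop |].
have := IH (upd sg x u); rewrite upd_same upd_eq E; exact.
Qed.

Definition rmv (x y : nat) : cmd :=
  While x (Case x Skip (Seq (Pop x) (Push false y)) (Seq (Pop x) (Push true y))).

Lemma run_rmv x y sg : x <> y ->
  run (rmv x y) sg (5 * size (sg x)).+1
    (upd (upd sg x [::]) y (catrev (sg x) (sg y))).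
Proof.
move=> xy w r q; move E: (sg x) => u.
elim: u sg E => [|b u IH] sg E.
  have -> : upd (upd sg x [::]) y (catrev [::] (sg y)) = sg.
    apply/funext=> z; rewrite /upd /=; case: eqP => [->//|_].
    by case: eqP => // ->.
  exact: ev_while0.
have -> : (5 * size (b :: u)).+1 = ((1 + 1).+2 + (5 * size u).+1).+1 by rewrite /=; lia.
apply: (@ev_while1 _ _ _ _ _ _ _ (upd (upd sg x u) y (b :: sg y)) r q);
  first by rewrite E.
  apply: ev_case; rewrite E.
  have P : ev w (Seq (Pop x) (Push b y)) sg r q (1 + 1).+1
      (upd (upd sg x u) y (b :: sg y)) r q.
    apply: ev_seq; first exact: ev_pop.
    rewrite E /= -(@upd_neq sg x y u) //; first exact: ev_push.
    by move=> e; apply: xy.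
  by case: b {E} P.
have := IH (upd (upd sg x u) y (b :: sg y)).
rewrite upd_neq // upd_eq upd_eq => /(_ erefl).
by rewrite (@updC _ y x) ?upd_same // => e; apply: xy.
Qed.

(** Reading a stack destroys it. A copy is a move to scratch by [rmv] followed by this move back
    onto two stacks, which restores the order of the bits. *)
Definition rcp (z x y : nat) : cmd :=
  While z (Case z Skip
    (Seq (Pop z) (Seq (Push false x) (Push false y)))
    (Seq (Pop z) (Seq (Push true x) (Push true y)))).

Lemma run_rcp z x y sg : z <> x -> z <> y -> x <> y ->
  run (rcp z x y) sg (7 * size (sg z)).+1
    (upd (upd (upd sg z [::]) x (catrev (sg z) (sg x))) y (catrev (sg z) (sg y))).
Proof.
move=> zx zy xy w r q; move E: (sg z) => u.
elim: u sg E => [|b u IH] sg E.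
  have -> : upd (upd (upd sg z [::]) x (catrev [::] (sg x))) y
              (catrev [::] (sg y)) = sg.
    apply/funext=> v; rewrite /upd /=; case: eqP => [->//|_].
    by case: eqP => [->//|_]; case: eqP => // ->.
  exact: ev_while0.
have -> : (7 * size (b :: u)).+1 =
   ((1 + (1 + 1).+1).+2 + (7 * size u).+1).+1 by rewrite /=; lia.
pose sg1 := upd (upd (upd sg z u) x (b :: sg x)) y (b :: sg y).
apply: (@ev_while1 _ _ _ _ _ _ _ sg1 r q); first by rewrite E.
  apply: ev_case; rewrite E.
  have P : ev w (Seq (Pop z) (Seq (Push b x) (Push b y))) sg r q
      (1 + (1 + 1).+1).+1 sg1 r q.
    apply: ev_seq; first exact: ev_pop.
    rewrite E /=; apply: ev_seq; first exact: ev_push.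
    rewrite (@upd_neq sg z x u) /sg1; last by move=> e; apply: zx.
    have -> : sg y = upd (upd sg z u) x (b :: sg x) y.
      by rewrite !upd_neq // => e; [apply: zy | apply: xy].
    exact: ev_push.
  by case: (b) P.
have Ez : sg1 z = u by rewrite /sg1 upd_neq // upd_neq // upd_eq.
have Ex : sg1 x = b :: sg x by rewrite /sg1 upd_neq // upd_eq.
have Ey : sg1 y = b :: sg y by rewrite /sg1 upd_eq.
have := IH sg1 Ez; rewrite Ex Ey.
suff -> : upd (upd (upd sg1 z [::]) x (catrev u (b :: sg x))) y (catrev u (b :: sg y))
  = upd (upd (upd sg z [::]) x (catrev (b :: u) (sg x))) y (catrev (b :: u) (sg y)) by [].
by apply/funext=> v; rewrite /sg1 /upd /=; do ! case: eqP => // _.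
Qed.

Fixpoint clears (k p : nat) : cmd :=
  if p is p'.+1 then Seq (clear k) (clears k.+1 p') else Skip.

Lemma run_clears p k A B C : size A = k -> size B = p ->
  exists2 t, t <= 2 * tsz B + 2 * p + 1 &
  run (clears k p) (stk (A ++ B ++ C)) t (stk (A ++ nseq p [::] ++ C)).
Proof.
elim: p k A B => [|p IH] k A B sA sB /=.
  by exists 1; rewrite ?leq_addl //; rewrite (size0nil sB) => w r q; constructor.
case: B sB => [|u B] //= [sB].
have sA' : size (rcons A [::]) = k.+1 by rewrite size_rcons sA.
have [t le R] := IH _ _ _ sA' sB.
exists ((2 * size u).+1 + t).+1.
  by rewrite /tsz /= -/(tsz B); lia.
apply: run_seq.
  have -> : size u = size (stk (A ++ u :: B ++ C) k).
    by rewrite nth_cat -sA ltnn subnn.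
  exact: run_clear.
rewrite !cat_rcons in R.
suff -> : upd (stk (A ++ u :: B ++ C)) k [::] = stk (A ++ [::] :: B ++ C) by [].
apply/funext=> y; rewrite /upd !nth_cat -sA; case: eqP => [->|ne].
  by rewrite ltnn subnn.
case: ifP => // h; have -> : y - size A = (y - size A).-1.+1 by lia.
by [].
Qed.

(** Discards temporaries: the wanted result is parked above them while they are cleared, then moved
    down to [k]. The two reversals cancel. *)
Definition retain (k p o : nat) : cmd :=
  Seq (rmv (k + o) (k + p)) (Seq (clears k p) (rmv (k + p) k)).

Lemma run_retain k p o A B : size A = k -> size B = p -> o < p ->
  exists2 t, t <= 12 * tsz B + 2 * p + 5 &
  run (retain k p o) (stk (A ++ B)) t (stk (A ++ [:: stk B o])).
Proof.
move=> sA sB lto.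
pose v := stk B o.
pose B' := @set_nth bits [::] B o [::].
have sB' : size B' = p by rewrite size_set_nth sB; apply/maxn_idPr.
have tB' : tsz B' + size v <= tsz B.
  rewrite /B' /v; move: lto; rewrite -sB.
  elim: (B) (o) => [|u C IH] [|o'] //= h; rewrite /tsz /=; first by lia.
  by have := IH o' h; rewrite /tsz; lia.
have H1 : stk (A ++ B) (k + o) = v by rewrite nth_cat -sA ltnNge leq_addr /= addKn.
have R1 := @run_rmv (k + o) (k + p) (stk (A ++ B)) ltac:(lia).
rewrite H1 (nth_default _ (_ : size (A ++ B) <= k + p)) in R1; last first.
  by rewrite size_cat sA sB.
have E1 : upd (upd (stk (A ++ B)) (k + o) [::]) (k + p) (catrev v [::])
   = stk (A ++ B' ++ [:: rev v]).
  apply/funext=> y; rewrite /upd !nth_cat sB' sA nth_set_nth /=.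
  case: eqP => [->|ne].
    by rewrite ltnNge leq_addr addKn ltnn subnn.
  case: eqP => [->|ne2].
    by rewrite ltnNge leq_addr addKn /= lto eqxx.
  case: ltnP => // h; case: ltnP => h2; first by rewrite ifF //; lia.
  by rewrite !nth_default ?sB //=; lia.
rewrite {}E1 in R1.
pose sg1 := stk (A ++ nseq p [::] ++ [:: rev v]).
have [t2 le2 R2] := run_clears [:: rev v] sA sB'; rewrite -/sg1 in R2.
have R3 := @run_rmv (k + p) k sg1 ltac:(lia).
have H3 : sg1 (k + p) = rev v.
  by rewrite /sg1 !nth_cat sA size_nseq ltnNge leq_addr addKn ltnn subnn.
have p0 : 0 < p by lia.
have H4 : sg1 k = [::].
  by rewrite /sg1 !nth_cat sA size_nseq ltnn subnn p0 nth_nseq p0.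
have E3 : upd (upd sg1 (k + p) [::]) k (catrev (sg1 (k + p)) (sg1 k))
    = stk (A ++ [:: v]).
  rewrite H3 H4 -/(rev _) revK /sg1.
  apply/funext=> y; rewrite /upd !nth_cat sA size_nseq.
  case: eqP => [->|ne]; first by rewrite ltnn subnn.
  case: eqP => [->|ne2].
    by rewrite ltnNge leq_addr addKn /= nth_default.
  case: ltnP => // h; rewrite nth_nseq.
  have -> : stk [:: v] (y - k) = [::] by rewrite nth_default //=; lia.
  case: ltnP => // h2; rewrite nth_default //=; lia.
rewrite {}E3 in R3.
exists ((5 * size v).+1 + (t2 + (5 * size (sg1 (k + p))).+1).+1).+1.
  by rewrite H3 size_rev; lia.
exact: run_seq R1 (run_seq R2 R3).
Qed.

Lemma stk_pad A p : stk (A ++ nseq p [::]) = stk A.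
Proof.
apply/funext=> y; rewrite nth_cat nth_nseq if_same.
by case: ltnP => // h; rewrite nth_default.
Qed.

Lemma stk_pad1 A : stk (A ++ [:: [::]]) = stk A.
Proof. exact: (stk_pad A 1). Qed.

Lemma stk_upd A u B v : upd (stk (A ++ u :: B)) (size A) v = stk (A ++ v :: B).
Proof.
apply/funext=> y; rewrite /upd !nth_cat; case: (eqVneq y (size A)) => [->|ne].
  by rewrite ltnn subnn.
case: ltnP => // h; have -> : y - size A = (y - size A).-1.+1 by lia.
by [].
Qed.

Lemma stk_at A u B : stk (A ++ u :: B) (size A) = u.
Proof. by rewrite nth_cat ltnn subnn. Qed.

Lemma stk_over A j : size A <= j -> stk A j = [::].
Proof. exact: nth_default. Qed.

Lemma run_weak0 c A M t B : run c (stk A) t (stk (A ++ B)) ->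
  run (ren (lift_stack (size A) (size M)) c) (stk (A ++ M)) t (stk (A ++ M ++ B)).
Proof.
by rewrite -{1}(cats0 A) => /(@run_weak _ _ _ M _ _ _ erefl); rewrite cats0.
Qed.

Lemma tszE e : tsz e = \sum_(i < size e) size (stk e i).
Proof. by rewrite /tsz sumnE big_map (big_nth [::]) big_mkord. Qed.

Lemma tsz_run c B t B' : run c (stk B) t (stk B') -> size B' = size B ->
  tsz B' <= tsz B + size B * t.
Proof.
move=> H E; rewrite !tszE E.
have -> : size B * t = \sum_(i < size B) t by rewrite sum_nat_const card_ord.
rewrite -big_split leq_sum //= => i _; exact: run_size H.
Qed.

Lemma tsz_cons u e : tsz (u :: e) = size u + tsz e.
Proof. by []. Qed.

Lemma tsz_nil : tsz [::] = 0.
Proof. by []. Qed.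

(** * Closure under tupling, composition and branching *)

Lemma ptimes_ext (G : ctx) p (f g : G -> seq bits) :
  (forall x, dom x -> g x = f x) -> ptimes p f -> ptimes p g.
Proof.
move=> E [c [T [HT H]]]; exists c, T; split=> // x Dx.
by rewrite E //; apply: H.
Qed.

Lemma ptimes_nils (G : ctx) p : ptimes p (fun _ : G => nseq p [::]).
Proof.
exists Skip, (fun _ => 1); split; first exact: pm_const.
move=> x _; split; first by rewrite size_nseq.
by exists 1; rewrite // stk_pad => w r q; constructor.
Qed.

(** The second program is lifted over the results of the first, so that it starts from the same
    inputs. *)
Lemma ptimes_cat (G : ctx) p p' (fs gs : G -> seq bits) :
  ptimes p fs -> ptimes p' gs -> ptimes (p + p') (fun x => fs x ++ gs x).
Proof.
move=> [c [T [HT H]]] [c' [T' [HT' H']]].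
exists (Seq c (ren (lift_stack (ar G) p) c')), (fun m => T m + T' m + 1).
split; first by pm_tac.
move=> x Dx; have [s [t le R]] := H x Dx; have [s' [t' le' R']] := H' x Dx.
split; first by rewrite size_cat s s'.
exists (t + t').+1; first lia.
apply: run_seq R _.
by have := run_weak0 (fs x) R'; rewrite encP s.
Qed.

Lemma ptimes_cons (G : ctx) p (f : G -> bits) (gs : G -> seq bits) :
  ptime f -> ptimes p gs -> ptimes p.+1 (fun x => f x :: gs x).
Proof. exact: ptimes_cat. Qed.

Lemma ptimes_nil (G : ctx) : ptimes 0 (fun _ : G => [::]).
Proof. exact: (ptimes_nils G 0). Qed.

Lemma ptime_nil (G : ctx) : ptime (fun _ : G => [::]).
Proof. exact: (ptimes_nils G 1). Qed.

Lemma enc_upd (G : ctx) (x : G) u B v :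
  upd (stk (enc x ++ u :: B)) (ar G) v = stk (enc x ++ v :: B).
Proof. by rewrite -(encP x) stk_upd. Qed.

Lemma enc_at (G : ctx) (x : G) u B : stk (enc x ++ u :: B) (ar G) = u.
Proof. by rewrite -(encP x) stk_at. Qed.

Lemma ptime_push (G : ctx) b (f : G -> bits) : ptime f -> ptime (fun x => b :: f x).
Proof.
move=> [c [T [HT H]]].
exists (Seq c (Push b (ar G))), (fun m => T m + 2); split; first by pm_tac.
move=> x Dx; have [s [t le R]] := H x Dx; split=> //.
exists (t + 1).+1; first lia.
apply: run_seq R _ => w r q.
by have := ev_push w b (ar G) (stk (enc x ++ [:: f x])) r q; rewrite enc_at enc_upd.
Qed.

Lemma ptime_behead (G : ctx) (f : G -> bits) : ptime f -> ptime (fun x => behead (f x)).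
Proof.
move=> [c [T [HT H]]].
exists (Seq c (Pop (ar G))), (fun m => T m + 2); split; first by pm_tac.
move=> x Dx; have [s [t le R]] := H x Dx; split=> //.
exists (t + 1).+1; first lia.
apply: run_seq R _ => w r q.
by have := ev_pop w (ar G) (stk (enc x ++ [:: f x])) r q; rewrite enc_at enc_upd.
Qed.

Lemma ptime_var (G : ctx) j : j < ar G -> ptime (fun x : G => stk (enc x) j).
Proof.
move=> ltj; set k := ar G.
exists (Seq (rmv j k.+1) (rcp k.+1 j k)), (fun m => 12 * m + 3).
split; first by pm_tac.
move=> x Dx; split=> //.
set sg := stk (enc x); set u := sg j.
have R1 := @run_rmv j k.+1 sg ltac:(lia).
set sg1 := upd _ _ _ in R1.
have R2 := @run_rcp k.+1 j k sg1 ltac:(lia) ltac:(lia) ltac:(lia).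
have E1 : sg1 k.+1 = rev u.
  by rewrite /sg1 upd_eq {2}/sg stk_over // encP.
have Ej : sg1 j = [::] by rewrite /sg1 upd_neq ?upd_eq //; lia.
have Ek : sg1 k = [::].
  by rewrite /sg1 !upd_neq ?/sg ?stk_over ?encP //; lia.
have Esz : size u <= tsz (enc x) by apply: tsz_nth.
exists ((5 * size u).+1 + (7 * size u).+1).+1; first lia.
apply: run_seq R1 _.
rewrite E1 Ej Ek size_rev -/(rev _) revK in R2.
suff <- : upd (upd (upd sg1 k.+1 [::]) j u) k u = stk (enc x ++ [:: u]) by [].
apply/funext=> y; rewrite /sg1 /upd nth_cat encP -/k.
case: (eqVneq y k) => [->|nk]; first by rewrite ltnn subnn.
case: (eqVneq y j) => [->|nj]; first by rewrite ltj.
case: (eqVneq y k.+1) => [->|nk1].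
  by rewrite ifF ?nth_default //=; lia.
case: ltnP => // h; rewrite /sg stk_over ?encP // nth_default //=; lia.
Qed.

Lemma ptime_weak (G H : ctx) (pi : H -> G) (f : G -> bits) :
  (forall x, dom x -> dom (pi x)) ->
  (forall x, dom x -> exists rest, enc x = enc (pi x) ++ rest) ->
  ptime f -> ptime (fun x => f (pi x)).
Proof.
move=> Hd He [c [T [HT R]]].
exists (ren (lift_stack (ar G) (ar H - ar G)) c), T; split=> // x Dx; split=> //.
have [_ [t le {}R]] := R _ (Hd x Dx); have [rest E] := He x Dx.
have sr : size rest = ar H - ar G.
  by have := encP x; rewrite E size_cat encP => <-; rewrite addKn.
exists t; first by apply: leq_trans le _; apply: HT.2; rewrite E tsz_cat leq_addr.
by have := run_weak0 rest R; rewrite encP sr E catA.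
Qed.

(** The arguments are computed above the inputs, and lifting by [lift_stack 0 (ar G)] makes them the
    first stacks seen by the program for [f]. *)
Lemma ptime_subst (G H : ctx) (pi : G -> H) (f : H -> bits) :
  (forall x, dom x -> dom (pi x)) ->
  ptime f -> ptimes (ar H) (fun x => enc (pi x)) -> ptime (fun x => f (pi x)).
Proof.
move=> Hd [c [T [HT R]]] [c' [T' [HT' R']]].
set p := ar H.
exists (Seq c' (Seq (ren (lift_stack 0 (ar G)) c) (retain (ar G) p.+1 p))),
  (fun m => T' m + T (p * T' m) + (12 * (p * T' m + T (p * T' m)) + 2 * p.+1 + 5) + 2).
split; first by pm_tac.
move=> x Dx; split=> //.
have [s [t' le' {}R']] := R' x Dx; have [_ [t le {}R]] := R _ (Hd x Dx).
have sz := ptimes_out_size R'; rewrite encP -/p in sz.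
have sz1 : tsz (enc (pi x)) <= p * T' (tsz (enc x)).
  by apply: leq_trans sz _; rewrite leq_mul2l le' orbT.
have le2 : t <= T (p * T' (tsz (enc x))) by apply: leq_trans le _; apply: HT.2.
have szf := run_out_size R.
have R2 := @run_weak _ [::] _ (enc x) _ [::] _ erefl R.
rewrite encP !cat0s in R2.
have sB : size (enc (pi x) ++ [:: f (pi x)]) = p.+1 by rewrite size_cat encP addn1.
have [t3 le3 R3] := run_retain (encP x) sB (ltnSn p).
rewrite -[p in stk _ p](encP (pi x)) stk_at in R3.
exists (t' + (t + t3).+1).+1; last exact: run_seq R' (run_seq R2 R3).
have : tsz (enc (pi x) ++ [:: f (pi x)]) <= p * T' (tsz (enc x)) + T (p * T' (tsz (enc x))).
  by rewrite tsz_cat leq_add // tsz_cons tsz_nil addn0 (leq_trans szf).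
by lia.
Qed.

Lemma ptime_case (G : ctx) (e f f0 f1 : G -> bits) :
  ptime e -> ptime f -> ptime f0 -> ptime f1 ->
  ptime (fun x => if e x is b :: _ then if b then f1 x else f0 x else f x).
Proof.
move=> [ce [Te [He Re]]] [c [T [H R]]] [c0 [T0 [H0 R0]]] [c1 [T1 [H1 R1]]].
set k := ar G; pose up d := ren (lift_stack k 1) d.
exists (Seq ce (Seq (Case k (up c) (up c0) (up c1)) (retain k 2 1))),
  (fun m => Te m + (T m + T0 m + T1 m)
     + (12 * (Te m + (T m + T0 m + T1 m)) + 2 * 2 + 5) + 3).
split; first by pm_tac.
move=> x Dx; split=> //.
have {Re}[_ [te lee Re]] := Re x Dx.
have up_run d v t : run d (stk (enc x)) t (stk (enc x ++ [:: v])) ->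
    run (up d) (stk (enc x ++ [:: e x])) t (stk (enc x ++ [:: e x; v])).
  by move=> /(run_weak0 [:: e x]); rewrite encP.
set v := (if e x is b :: _ then _ else _).
have [t le Q] : exists2 t, t <= T (tsz (enc x)) + T0 (tsz (enc x)) + T1 (tsz (enc x)) &
    run (if e x is b :: _ then if b then up c1 else up c0 else up c)
      (stk (enc x ++ [:: e x])) t (stk (enc x ++ [:: e x; v])) /\ size v <= t.
  rewrite /v; case: (e x) up_run => [|[] u] up_run.
  - have [_ [t le Q]] := R x Dx; exists t; first lia.
    by split; [exact: up_run | exact: run_out_size Q].
  - have [_ [t le Q]] := R1 x Dx; exists t; first lia.
    by split; [exact: up_run | exact: run_out_size Q].
  - have [_ [t le Q]] := R0 x Dx; exists t; first lia.
    by split; [exact: up_run | exact: run_out_size Q].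
case: Q => Q sv.
have [t3 le3 R3] := @run_retain k 2 1 (enc x) [:: e x; v] (encP x) erefl erefl.
exists (te + (t.+1 + t3).+1).+1.
  have := run_out_size Re.
  by move: le3; rewrite !tsz_cons tsz_nil; lia.
apply: run_seq Re (run_seq _ R3).
move=> w r q; apply: ev_case.
by rewrite enc_at; move: (Q w r q); case: (e x) => [|[] u].
Qed.

(** Makes any machine that halts on the given coins available as a function: [derand] takes the
    coins from a stack outside the reach of the program. *)
Lemma ptime_alg (G : ctx) (a : alg) (o j : nat) (m : G -> nat)
    (ins : G -> seq bits) (er : G -> bits) Tm :
  polytime a -> ptimes j ins -> ptime er ->
  pm Tm -> (forall x, dom x -> m x <= Tm (tsz (enc x))) ->
  (forall x, dom x -> halts a (m x) [::] (ins x) (er x)) ->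
  ptime (fun x => output a (m x) [::] (ins x) (er x) o).
Proof.
move=> [c Hc] Ci Cr HTm Hm Hh.
(* The coin stack lies above the stacks of the program, the inputs and the output. *)
set R := maxn (bound (prog a)) (maxn j o.+1).
have [d [T [HT RT]]] := ptimes_cat Ci (ptimes_cat (ptimes_nils G (R - j)) Cr).
have Hpow : pm (fun m => Tm m ^ c + c) by apply: pm_add; [exact: pm_pow | exact: pm_const].
set k := ar G.
exists (Seq d (Seq (ren (lift_stack 0 k) (derand R (prog a))) (retain k R.+1 o))),
  (fun m => T m + 4 * (Tm m ^ c + c)
     + (12 * (R.+1 * T m + R.+1 * (4 * (Tm m ^ c + c))) + 2 * R.+1 + 5) + 2).
split.
  have H4 : pm (fun m => 4 * (Tm m ^ c + c)) by apply: pm_mul => //; exact: pm_const.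
  repeat first [exact: H4 | exact: pm_const | exact: HT | apply: pm_add | apply: pm_mul].
move=> x Dx; split=> //.
have {RT}[s [t1 le1 R1]] := RT x Dx.
have [t [sg [r' [q' [le E F]]]]] := halts_ev (Hh x Dx).
have sj : size (ins x) = j.
  by case: Ci => c0 [T0 [_ /(_ x Dx)[]]].
set B := ins x ++ _ in s R1.
have sB : size B = R.+1.
  by rewrite /B !size_cat size_nseq sj /=; rewrite /R; lia.
have [t' le' D] := derand_run E (leq_maxl _ _ : bound (prog a) <= R).
have EB : upd (stk (ins x)) R (er x) = stk B.
  have sI : size (ins x ++ nseq (R - j) [::]) = R by rewrite size_cat size_nseq sj /R; lia.
  by rewrite /B catA -{1}sI -(stk_upd _ [::]) stk_pad1 stk_pad.
(* The program may leave data anywhere below [R], and [R] holds the remaining coins; all higher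
   stacks are still empty. *)
pose B' := mkseq (upd sg R r') R.+1.
have EB' : upd sg R r' = stk B'.
  apply/funext=> y; case: (ltnP y R.+1) => hy; first by rewrite nth_mkseq.
  rewrite stk_over ?size_mkseq // upd_neq; last lia.
  rewrite (ev_bound E); last by rewrite /R in hy; lia.
  by rewrite nth_default // sj; rewrite /R in hy; lia.
rewrite {}EB EB' in D.
have sB' : size B' = R.+1 by rewrite size_mkseq.
have R2 := @run_weak _ [::] _ (enc x) _ [::] _ erefl D.
rewrite encP !cat0s -/k in R2.
have oR : o < R.+1 by rewrite /R; lia.
have [t3 le3 R3] := run_retain (encP x) sB' oR.
have Eo : stk B' o = output a (m x) [::] (ins x) (er x) o.
  by rewrite /output F -EB' upd_neq //=; rewrite /R; lia.
rewrite Eo in R3.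
exists (t1 + (t' + t3).+1).+1; last exact: run_seq R1 (run_seq R2 R3).
have tB := ptimes_out_size R1; rewrite sB in tB.
have tB' := tsz_run D (etrans sB' (esym sB)); rewrite sB in tB'.
have le4 : t' <= 4 * (Tm (tsz (enc x)) ^ c + c).
  apply: leq_trans le' _; rewrite leq_mul2l /=; apply: leq_trans le _.
  apply: leq_trans (Hc _) _; rewrite leq_add2r.
  by case: (c) => // c'; rewrite leq_exp2r // Hm.
have le5 : R.+1 * t1 <= R.+1 * T (tsz (enc x)) by rewrite leq_mul2l le1 orbT.
have le6 : R.+1 * t' <= R.+1 * (4 * (Tm (tsz (enc x)) ^ c + c)) by rewrite leq_mul2l le4 orbT.
lia.
Qed.

(** * Bounded iteration *)

Definition lctx (G : ctx) (P : G -> nat -> bits -> Prop) : ctx.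
Proof.
apply: (@Ctx (G * nat * bits)%type (fun p => dom p.1.1 /\ P p.1.1 p.1.2 p.2) (ar G + 2)
  (fun p => enc p.1.1 ++ [:: unary p.1.2; p.2])).
by move=> x; rewrite size_cat encP.
Defined.

(** Iterating a polynomial-time function can produce exponentially long strings, hence the
    polynomial bound [B] on the accumulator, as in Cobham's bounded recursion. The loop body may
    rely on the invariant [P] as a promise. *)
Lemma ptime_iteri_inv (G : ctx) (s : G -> bits) (g : G -> nat -> bits -> bits)
    (i0 : G -> bits) (P : G -> nat -> bits -> Prop) (B : nat -> nat) :
  let N x := size (s x) in
  ptime s -> ptime i0 ->
  (forall x, dom x -> P x 0 (i0 x)) ->
  (forall x j a, dom x -> j < N x -> P x j a -> P x j.+1 (g x j a)) ->
  pm B ->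
  (forall x j a, dom x -> j <= N x -> P x j a -> size a <= B (tsz (enc x))) ->
  @ptime (lctx (fun x j a => j < N x /\ P x j a)) (fun p => g p.1.1 p.1.2 p.2) ->
  ptime (fun x => iteri (N x) (g x) (i0 x)).
Proof.
move=> N [cN [TN [HN RN]]] [cI [TI [HI RI]]] P0 PS HB Bnd [cb [Tb [Hb Rb]]].
set k := ar G.
(* Stack [k] holds the rest of [s] as loop counter, [k.+1] the index in unary, [k.+2] the
   accumulator. The body was compiled without the counter, so it is lifted over it. *)
pose body := Seq (Pop k) (Seq (ren (lift_stack k 1) cb)
   (Seq (retain k.+2 2 1) (Push true k.+1))).
pose Tit m := Tb (m + TN m + B m) + (24 * B m + 2 * 2 + 5) + 6.
exists (Seq cN (Seq (ren (lift_stack k 2) cI) (Seq (While k body) (retain k 3 2)))),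
  (fun m => TN m + TI m + (TN m * Tit m + 1) + (12 * (2 * TN m + B m) + 2 * 3 + 5) + 3).
have HTit : pm Tit by rewrite /Tit; pm_tac.
split; first by pm_tac.
move=> x Dx; split=> //.
set S := tsz (enc x).
have {RN}[_ [tN leN RN]] := RN x Dx.
have {RI}[_ [tI leI RI]] := RI x Dx.
have NS : N x <= TN S by exact: leq_trans (run_out_size RN) leN.
have := run_weak0 [:: s x; [::]] RI.
rewrite encP /= => {}RI.
rewrite -[X in run _ _ _ (stk X)]/(enc x ++ [:: s x]) in RN.
have EN : stk (enc x ++ [:: s x]) = stk (enc x ++ [:: s x; [::]]).
  by rewrite -[RHS]/(stk (enc x ++ ([:: s x] ++ nseq 1 [::]))) catA stk_pad.
pose st j a := stk (enc x ++ [:: drop j (s x); unary j; a]).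
have pushat A0 u v : upd (stk (enc x ++ [:: u, v & A0])) k = fun z => stk (enc x ++ [:: z, v & A0]).
  by apply/funext=> z; rewrite enc_upd.
have pushat1 A0 u v : upd (stk (enc x ++ [:: u, v & A0])) k.+1 = fun z => stk (enc x ++ [:: u, z & A0]).
  apply/funext=> z; have e : size (rcons (enc x) u) = k.+1 by rewrite size_rcons encP.
  by rewrite -cat_rcons -{1}e stk_upd cat_rcons.
have at0 A0 u : stk (enc x ++ u :: A0) k = u by exact: enc_at.
have at1 A0 u v : stk (enc x ++ [:: u, v & A0]) k.+1 = v.
  have e : size (rcons (enc x) u) = k.+1 by rewrite size_rcons encP.
  by rewrite -cat_rcons -{1}e stk_at.
have step1 j a : j < N x -> P x j a ->
    exists2 t, t < Tit S & run body (st j a) t (st j.+1 (g x j a)).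
  move=> ltj Pj.
  have [_ [t le Q]] := Rb (x, j, a) (conj Dx (conj ltj Pj)).
  rewrite /= in le Q.
  have sa : size a <= B S by apply: (Bnd x j a) => //; lia.
  have sa' : size (g x j a) <= B S by apply: (Bnd x j.+1) => //; apply: PS.
  have leb : t <= Tb (S + TN S + B S).
    apply: leq_trans le _; apply: Hb.2; rewrite tsz_cat !tsz_cons tsz_nil size_nseq -/S; lia.
  rewrite -catA in Q.
  have Q2 := @run_weak _ _ _ [:: drop j.+1 (s x)] _ _ _ erefl Q.
  rewrite encP /= in Q2.
  have s2 : size (enc x ++ [:: drop j.+1 (s x); unary j]) = k.+2.
    by rewrite size_cat encP /=; lia.
  have [t3 le3 R3] := @run_retain k.+2 2 1 _ [:: a; g x j a] s2 erefl erefl.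
  rewrite -!catA /= in R3.
  exists (1 + (t + (t3 + 1).+1).+1).+1.
    by move: le3; rewrite !tsz_cons tsz_nil /Tit; lia.
  have R1 : run (Pop k) (st j a) 1 (stk (enc x ++ [:: drop j.+1 (s x); unary j; a])).
    move=> w r q.
    have := ev_pop w k (st j a) r q.
    rewrite /st at0 pushat.
    by rewrite -[behead _]drop1 drop_drop.
  have R4 : run (Push true k.+1)
     (stk (enc x ++ [:: drop j.+1 (s x); unary j; g x j a])) 1 (st j.+1 (g x j a)).
    move=> w r q.
    have := ev_push w true k.+1 (stk (enc x ++ [:: drop j.+1 (s x); unary j; g x j a])) r q.
    by rewrite at1 pushat1.
  exact: run_seq R1 (run_seq Q2 (run_seq R3 R4)).
have loop d j : d = N x - j -> j <= N x -> P x j (iteri j (g x) (i0 x)) ->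
    exists2 t, t <= d * Tit S + 1 &
      run (While k body) (st j (iteri j (g x) (i0 x))) t
        (st (N x) (iteri (N x) (g x) (i0 x))) /\ P x (N x) (iteri (N x) (g x) (i0 x)).
  elim: d j => [|d IH] j Ed lej Pj.
    have Ej : j = N x by lia.
    rewrite -Ej; exists 1 => //; split=> // w r q; apply: ev_while0.
    by rewrite /st at0 Ej drop_size.
  have ltj : j < N x by lia.
  have [t1 le1 R1] := step1 _ _ ltj Pj.
  have [|//||t2 le2 [R2 PN]] := IH j.+1; first lia.
    exact: PS.
  exists (t1 + t2).+1; first by rewrite mulSn; lia.
  split=> // w r q; apply: ev_while1 (R1 w r q) (R2 w r q).
  by rewrite /st at0 => /(congr1 size); rewrite size_drop -/(N x) -Ed.
have [t2 le2 [R2 PN]] := loop (N x) 0 (esym (subn0 _)) (leq0n _) (P0 x Dx).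
have [t3 le3 R3] := @run_retain k 3 2 (enc x)
   [:: drop (N x) (s x); unary (N x); iteri (N x) (g x) (i0 x)] (encP x) erefl erefl.
exists (tN + (tI + (t2 + t3).+1).+1).+1.
  have : size (iteri (N x) (g x) (i0 x)) <= B S by apply: (Bnd x (N x)).
  have : N x * Tit S <= TN S * Tit S by rewrite leq_mul2r NS orbT.
  move: le3; rewrite !tsz_cons tsz_nil !size_nseq drop_size /=.
  by rewrite /S in leN leI le2 NS *; lia.
apply: run_seq RN _; rewrite EN; apply: run_seq RI _.
apply: run_seq R3.
by move: R2; rewrite /st drop0.
Qed.

(** * Numbers in unary, booleans and strings *)

Definition ptn (G : ctx) (f : G -> nat) : Prop := ptime (fun x => unary (f x)).
(** False is the empty stack and true a single bit, so a test for emptiness decides a boolean. *)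
Definition ptb (G : ctx) (f : G -> bool) : Prop := ptn (fun x => nat_of_bool (f x)).

Lemma ptn_ext (G : ctx) (f g : G -> nat) :
  (forall x, dom x -> g x = f x) -> ptn f -> ptn g.
Proof. by move=> E; apply: ptime_ext => x /E ->. Qed.

Lemma ptb_ext (G : ctx) (f g : G -> bool) :
  (forall x, dom x -> g x = f x) -> ptb f -> ptb g.
Proof. by move=> E; apply: ptn_ext => x /E ->. Qed.

Lemma ptn_bound (G : ctx) (f : G -> nat) : ptn f ->
  exists2 T, pm T & forall x : G, dom x -> f x <= T (tsz (enc x)).
Proof.
move=> /ptime_size[T HT H]; exists T => // x Dx.
by have := H x Dx; rewrite size_nseq.
Qed.

Definition icx (G : ctx) (N : G -> nat) : ctx.
Proof.
apply: (@Ctx (G * nat)%type (fun p => dom p.1 /\ p.2 < N p.1) (ar G + 1)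
  (fun p => enc p.1 ++ [:: unary p.2])).
by move=> x; rewrite size_cat encP.
Defined.

Definition ncx (G : ctx) (P : G -> nat -> nat -> Prop) : ctx.
Proof.
apply: (@Ctx (G * nat * nat)%type (fun p => dom p.1.1 /\ P p.1.1 p.1.2 p.2) (ar G + 2)
  (fun p => enc p.1.1 ++ [:: unary p.1.2; unary p.2])).
by move=> x; rewrite size_cat encP.
Defined.

(** The promise pins the accumulator to the actual iterate, so that closed forms of the iterates can
    be used inside the body. *)
Definition itctx (G : ctx) (N : G -> nat) (g : G -> nat -> bits -> bits)
    (i0 : G -> bits) : ctx :=
  lctx (fun x j a => j < N x /\ a = iteri j (g x) (i0 x)).

Section Weakening.
Variable G : ctx.

Lemma enc_lctx1 (P : G -> nat -> bits -> Prop) (p : @lctx G P) : stk (enc p) (ar G).+1 = p.2.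
Proof. by rewrite /= nth_cat encP ltnNge leqnSn /= subSnn. Qed.

Lemma lctx_weak (P : G -> nat -> bits -> Prop) (f : G -> bits) : ptime f -> @ptime (lctx P) (fun p => f p.1.1).
Proof.
by apply: ptime_weak => [x []//|x _]; exists [:: unary x.1.2; x.2].
Qed.

Lemma lctx_idx (P : G -> nat -> bits -> Prop) : @ptn (lctx P) (fun p => p.1.2).
Proof.
apply: (ptime_ext _ (@ptime_var (lctx P) (ar G) _)) => /= [p _|].
  by rewrite enc_at.
by rewrite addn2.
Qed.

Lemma lctx_acc (P : G -> nat -> bits -> Prop) : @ptime (lctx P) (fun p => p.2).
Proof.
apply: (ptime_ext _ (@ptime_var (lctx P) (ar G).+1 _)) => [p _|/=].
  by rewrite enc_lctx1.
by rewrite addn2.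
Qed.

Lemma icx_weak (N : G -> nat) (f : G -> bits) : ptime f -> @ptime (icx N) (fun p => f p.1).
Proof.
by apply: ptime_weak => [x []//|x _]; exists [:: unary x.2].
Qed.

Lemma icx_idx (N : G -> nat) : @ptn (icx N) (fun p => p.2).
Proof.
apply: (ptime_ext _ (@ptime_var (icx N) (ar G) _)) => /= [p _|].
  by rewrite enc_at.
by rewrite addn1.
Qed.

Lemma ncx_icx (N : G -> nat) (P : G -> nat -> nat -> Prop) (f : icx N -> bits) :
  (forall x j a, P x j a -> j < N x) ->
  ptime f -> @ptime (ncx P) (fun p => f p.1).
Proof.
move=> H; apply: ptime_weak => [[[x j] a] /= [Dx /H]//|[[x j] a] _ /=].
by exists [:: unary a]; rewrite -catA.
Qed.

Lemma ncx_weak (P : G -> nat -> nat -> Prop) (f : G -> bits) : ptime f -> @ptime (ncx P) (fun p => f p.1.1).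
Proof.
by apply: ptime_weak => [x []//|x _]; exists [:: unary x.1.2; unary x.2].
Qed.

Lemma ncx_acc (P : G -> nat -> nat -> Prop) : @ptn (ncx P) (fun p => p.2).
Proof.
apply: (ptime_ext _ (@ptime_var (ncx P) (ar G).+1 _)) => /= [p _|].
  by rewrite nth_cat encP ltnNge leqnSn /= subSnn.
by rewrite addn2.
Qed.

End Weakening.

Section Loops.
Variable G : ctx.
Implicit Types (f g : G -> bits) (h k N : G -> nat) (b c : G -> bool).

Lemma ptime_iteri_str (s : G -> bits) (g : G -> nat -> bits -> bits) (i0 : G -> bits)
    (B : nat -> nat) :
  ptime s -> ptime i0 -> pm B ->
  (forall x j, dom x -> j <= size (s x) ->
     size (iteri j (g x) (i0 x)) <= B (tsz (enc x))) ->
  @ptime (itctx (fun x => size (s x)) g i0) (fun p => g p.1.1 p.1.2 p.2) ->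
  ptime (fun x => iteri (size (s x)) (g x) (i0 x)).
Proof.
move=> Hs Hi HB Hb Hg.
apply: (ptime_iteri_inv (P := fun x j a => a = iteri j (g x) (i0 x))) Hg => //.
- by move=> x j a Dx _ ->.
- exact: HB.
- by move=> x j a Dx le ->; apply: Hb.
Qed.

(** The loop is driven by the string itself, since its length is not yet available in unary. *)
Lemma ptn_size f : ptime f -> ptn (fun x => size (f x)).
Proof.
move=> Hf; have [T HT Hb] := ptime_size Hf.
pose g (x : G) (j : nat) (a : bits) := true :: a.
have E x j : iteri j (g x) [::] = unary j by elim: j => //= j ->.
apply: (ptime_ext (f := fun x => iteri (size (f x)) (g x) [::])).
  by move=> x _; rewrite E.
apply: (ptime_iteri_str (g := g) Hf (ptime_nil G) HT).
  by move=> x j Dx le; rewrite E size_nseq; apply: leq_trans le (Hb x Dx).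
by apply: ptime_push; apply: lctx_acc.
Qed.

Lemma ptime_iteri N (g : G -> nat -> bits -> bits) (i0 : G -> bits)
    (B : nat -> nat) :
  ptn N -> ptime i0 -> pm B ->
  (forall x j, dom x -> j <= N x -> size (iteri j (g x) (i0 x)) <= B (tsz (enc x))) ->
  @ptime (itctx N g i0) (fun p => g p.1.1 p.1.2 p.2) ->
  ptime (fun x => iteri (N x) (g x) (i0 x)).
Proof.
move=> HN Hi HB Hb Hg.
apply: (ptime_ext (f := fun x => iteri (size (unary (N x))) (g x) (i0 x))).
  by move=> x _; rewrite size_nseq.
apply: (ptime_iteri_str HN Hi HB) => [x j Dx|]; first by rewrite size_nseq; apply: Hb.
have -> // : (fun x : G => size (unary (N x))) = N by apply/funext=> x; rewrite size_nseq.
Qed.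

Lemma ptn_iteri N (g : G -> nat -> nat -> nat) (i0 : G -> nat) (B : nat -> nat) :
  ptn N -> ptn i0 -> pm B ->
  (forall x j, dom x -> j <= N x -> iteri j (g x) (i0 x) <= B (tsz (enc x))) ->
  @ptn (ncx (fun x j a => j < N x /\ a = iteri j (g x) (i0 x)))
    (fun p => g p.1.1 p.1.2 p.2) ->
  ptn (fun x => iteri (N x) (g x) (i0 x)).
Proof.
move=> HN Hi HB Hb Hg.
pose g' (x : G) (j : nat) (a : bits) := unary (g x j (size a)).
have E x j : iteri j (g' x) (unary (i0 x)) = unary (iteri j (g x) (i0 x)).
  by elim: j => //= j ->; rewrite /g' size_nseq.
apply: (ptime_ext (f := fun x => iteri (N x) (g' x) (unary (i0 x))));
  first by move=> x _; rewrite E.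
apply: (ptime_iteri (g := g') (i0 := fun x => unary (i0 x)) HN Hi HB) => [x j Dx le|].
  by rewrite E size_nseq Hb.
move: Hg; apply: (@ptime_weak (ncx _) (itctx _ _ _)
   (fun p => (p.1.1, p.1.2, size p.2))) => -[[x j] a] /= [Dx [lt ->]].
  by rewrite E size_nseq.
by exists [::]; rewrite cats0 E size_nseq.
Qed.

Lemma ptn_const m : ptn (fun _ : G => m).
Proof. by elim: m => [|m IH]; [exact: ptime_nil | exact: ptime_push]. Qed.

Lemma ptn_succ h : ptn h -> ptn (fun x => (h x).+1).
Proof. exact: ptime_push. Qed.

Lemma ptn_pred h : ptn h -> ptn (fun x => (h x).-1).
Proof. by move/ptime_behead; apply: ptime_ext => x _; case: (h x). Qed.

End Loops.

Section Addition.
Variable G : ctx.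
Implicit Types (f g : G -> bits) (h k N : G -> nat) (b c : G -> bool).

Lemma ptime_drop f h : ptime f -> ptn h -> ptime (fun x => drop (h x) (f x)).
Proof.
move=> Hf Hh; have [T HT Hb] := ptime_size Hf.
have E x j : iteri j (fun _ => behead) (f x) = drop j (f x).
  by elim: j => [|j IH] /=; rewrite ?drop0 // IH -drop1 drop_drop.
apply: (ptime_ext (f := fun x => iteri (h x) (fun _ => behead) (f x)));
  first by move=> x _; rewrite E.
apply: (ptime_iteri (g := fun _ _ => behead) Hh Hf HT) => [x j Dx le|].
  by rewrite E size_drop; apply: leq_trans (leq_subr _ _) (Hb x Dx).
by apply: ptime_behead; apply: lctx_acc.
Qed.

Lemma ptn_sub h k : ptn h -> ptn k -> ptn (fun x => h x - k x).
Proof.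
move=> Hh Hk; apply: ptime_ext (ptime_drop Hh Hk) => x _.
by rewrite drop_nseq.
Qed.

Lemma ptn_add h k : ptn h -> ptn k -> ptn (fun x => h x + k x).
Proof.
move=> Hh Hk; have [T HT Hb] := ptn_bound Hh; have [T' HT' Hb'] := ptn_bound Hk.
have E x j : iteri j (fun _ => succn) (k x) = j + k x by elim: j => //= j ->.
apply: (ptn_ext (f := fun x => iteri (h x) (fun _ => succn) (k x)));
  first by move=> x _; rewrite E.
apply: (ptn_iteri (g := fun _ _ => succn) (B := fun m => T m + T' m) Hh Hk).
- by pm_tac.
- by move=> x j Dx le; rewrite E leq_add ?Hb' // (leq_trans le) ?Hb.
- exact: ptn_succ (ncx_acc _).
Qed.

End Addition.

Lemma ptn_mul (G : ctx) (h k : G -> nat) : ptn h -> ptn k -> ptn (fun x => h x * k x).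
Proof.
move=> Hh Hk; have [T HT Hb] := ptn_bound Hh; have [T' HT' Hb'] := ptn_bound Hk.
have E x j : iteri j (fun _ a => k x + a) 0 = j * k x by elim: j => //= j ->.
apply: (ptn_ext (f := fun x => iteri (h x) (fun _ a => k x + a) 0));
  first by move=> x _; rewrite E.
apply: (ptn_iteri (B := fun m => T m * T' m) (g := fun x _ a => k x + a) Hh (ptn_const _ 0)).
- by pm_tac.
- by move=> x j Dx le; rewrite E leq_mul ?Hb' // (leq_trans le) ?Hb.
- by apply: ptn_add (ncx_acc _); apply: ncx_weak Hk.
Qed.

Section Booleans.
Variable G : ctx.
Implicit Types (f g : G -> bits) (h k N : G -> nat) (b c : G -> bool).

Lemma ptn_exp h e : ptn h -> ptn (fun x => h x ^ e).
Proof.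
move=> Hh; elim: e => [|e IH]; first exact: ptn_const.
by apply: ptn_ext (ptn_mul Hh IH) => x _; rewrite expnS.
Qed.

Lemma ptime_if b f g : ptb b -> ptime f -> ptime g ->
  ptime (fun x => if b x then f x else g x).
Proof.
move=> Hb Hf Hg; apply: ptime_ext (ptime_case Hb Hg Hg Hf) => x _.
by case: (b x).
Qed.

Lemma ptn_if b h k : ptb b -> ptn h -> ptn k ->
  ptn (fun x => if b x then h x else k x).
Proof.
by move=> Hb Hh Hk; apply: ptime_ext (ptime_if Hb Hh Hk) => x _; case: (b x).
Qed.

Lemma ptb_if b c (d : G -> bool) : ptb b -> ptb c -> ptb d ->
  ptb (fun x => if b x then c x else d x).
Proof.
by move=> Hb Hh Hk; apply: ptn_ext (ptn_if Hb Hh Hk) => x _; case: (b x).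
Qed.

Lemma ptb_const (v : bool) : ptb (fun _ : G => v).
Proof. exact: ptn_const. Qed.

Lemma ptb_and b c : ptb b -> ptb c -> ptb (fun x => b x && c x).
Proof. by move=> Hb Hc; apply: ptb_if => //; apply: ptb_const. Qed.

Lemma ptb_or b c : ptb b -> ptb c -> ptb (fun x => b x || c x).
Proof. by move=> Hb Hc; apply: ptb_if => //; apply: ptb_const. Qed.

Lemma ptb_not b : ptb b -> ptb (fun x => ~~ b x).
Proof.
by move=> Hb; apply: ptb_ext (ptb_if Hb (ptb_const false) (ptb_const true)) => x _; case: (b x).
Qed.

Lemma ptb_addb b c : ptb b -> ptb c -> ptb (fun x => b x (+) c x).
Proof.
move=> Hb Hc; apply: ptb_ext (ptb_if Hb (ptb_not Hc) Hc) => x _; by case: (b x).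
Qed.

Lemma ptb_eqb b c : ptb b -> ptb c -> ptb (fun x => b x == c x).
Proof.
move=> Hb Hc; apply: ptb_ext (ptb_not (ptb_addb Hb Hc)) => x _.
by case: (b x); case: (c x).
Qed.

Lemma ptb_leq h k : ptn h -> ptn k -> ptb (fun x => h x <= k x).
Proof.
move=> Hh Hk.
apply: ptime_ext (ptime_case (ptn_sub Hh Hk) (ptn_const _ 1) (ptime_nil _) (ptime_nil _)) => x _.
by rewrite -subn_eq0; case: (h x - k x).
Qed.

Lemma ptb_eqn h k : ptn h -> ptn k -> ptb (fun x => h x == k x).
Proof.
move=> Hh Hk; apply: ptb_ext (ptb_and (ptb_leq Hh Hk) (ptb_leq Hk Hh)) => x _.
by rewrite eqn_leq.
Qed.

Lemma ptb_ltn h k : ptn h -> ptn k -> ptb (fun x => h x < k x).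
Proof. by move=> Hh; apply: ptb_leq; apply: ptn_succ. Qed.

Lemma ptn_min h k : ptn h -> ptn k -> ptn (fun x => minn (h x) (k x)).
Proof. by move=> Hh Hk; apply: ptn_if => //; apply: ptb_ltn. Qed.

Lemma ptb_nth f h : ptime f -> ptn h -> ptb (fun x => nth false (f x) (h x)).
Proof.
move=> Hf Hh.
apply: ptime_ext (ptime_case (ptime_drop Hf Hh) (ptime_nil _) (ptime_nil _) (ptn_const _ 1)) => x _.
case: (ltnP (h x) (size (f x))) => le; first by rewrite (drop_nth false) //; case: (nth _ _ _).
by rewrite nth_default ?drop_oversize.
Qed.

End Booleans.

Section Sequences.
Variable G : ctx.
Implicit Types (f g : G -> bits) (h k N : G -> nat) (b c : G -> bool).

(** Only the top of a stack is accessible, so the string is built from its last bit to its first;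
    stage [j] prepends bit [N x - j.+1]. *)
Lemma ptime_mkseq N (b : G -> nat -> bool) : ptn N -> @ptb (icx N) (fun p => b p.1 p.2) ->
  ptime (fun x => mkseq (b x) (N x)).
Proof.
move=> HN Hb; have [T HT HTN] := ptn_bound HN.
pose g x j a := b x (N x - j.+1) :: a.
have E x j : j <= N x -> iteri j (g x) [::] = [seq b x i | i <- iota (N x - j) j].
  elim: j => [|j IH] // le /=; rewrite IH /g; last lia.
  by have -> : N x - j = (N x - j.+1).+1 by lia.
apply: (ptime_ext (f := fun x => iteri (N x) (g x) [::])).
  by move=> x _; rewrite E // subnn.
apply: (ptime_iteri (g := g) HN (ptime_nil G) HT) => [x j Dx le|].
  by rewrite E // size_map size_iota; apply: leq_trans le (HTN x Dx).
rewrite /g.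
suff Hc : @ptb (itctx N g (fun=> [::])) (fun p => b p.1.1 (N p.1.1 - p.1.2.+1)).
  have Ha := @lctx_acc G (fun x j a => j < N x /\ a = iteri j (g x) [::]).
  apply: ptime_ext (ptime_if Hc (ptime_push true Ha) (ptime_push false Ha)) => p _.
  by case: (b _ _).
have Hi : @ptn (itctx N g (fun=> [::])) (fun p => N p.1.1 - p.1.2.+1).
  by apply: ptn_sub; [exact: (lctx_weak _ HN) | exact: ptn_succ (lctx_idx _)].
apply: (@ptime_subst (itctx N g (fun=> [::])) (icx N)
    (fun p => (p.1.1, N p.1.1 - p.1.2.+1))) Hb _ => [[[x j] a] /= [Dx [lt _]]|].
  by split=> //; lia.
(* The inputs are copied one stack at a time, to serve as arguments of [b] beside the shifted
   index. *)
have Hl : @ptimes (itctx N g (fun=> [::])) (ar G) (fun p => enc p.1.1).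
  have : forall q, q <= ar G -> @ptimes (itctx N g (fun=> [::])) q (fun p => take q (enc p.1.1)).
    elim=> [_|q IH lt].
      by apply: ptimes_ext (ptimes_nil _) => x _; rewrite take0.
    have Hv : @ptime (itctx N g (fun=> [::])) (fun p => stk (enc p.1.1) q).
      exact: lctx_weak (ptime_var lt).
    have := ptimes_cat (IH (ltnW lt)) Hv; rewrite addn1; apply: ptimes_ext => x _.
    by rewrite (take_nth [::]) ?encP // cats1.
  by move/(_ _ (leqnn _)); apply: ptimes_ext => x _; rewrite take_oversize ?encP.
exact: ptimes_cat Hl Hi.
Qed.

Lemma ptn_sum N (h : G -> nat -> nat) : ptn N -> @ptn (icx N) (fun p => h p.1 p.2) ->
  ptn (fun x => \sum_(j < N x) h x j).
Proof.
move=> HN Hh; have [T HT HTN] := ptn_bound HN; have [T' HT' HTh] := ptn_bound Hh.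
pose g x j a := h x j + a.
have E x j : iteri j (g x) 0 = \sum_(i < j) h x i.
  by elim: j => [|j IH]; rewrite ?big_ord0 //= big_ord_recr /= /g IH addnC.
apply: (ptn_ext (f := fun x => iteri (N x) (g x) 0));
  first by move=> x _; rewrite E.
apply: (ptn_iteri (g := g) (B := fun m => T m * T' (m + T m)) HN (ptn_const _ 0)).
- by pm_tac.
- move=> x j Dx le; rewrite E.
  apply: (@leq_trans (\sum_(i < j) T' (tsz (enc x) + T (tsz (enc x))))).
    apply: leq_sum => i _.
    have lt : i < N x by apply: leq_trans (ltn_ord i) le.
    apply: leq_trans (HTh (x, val i) (conj Dx lt)) _.
    apply: HT'.2; rewrite tsz_cat tsz_cons tsz_nil size_nseq addn0 leq_add2l.
    by apply: leq_trans (ltnW lt) _; apply: HTN.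
  by rewrite sum_nat_const card_ord leq_mul2r (leq_trans le (HTN x Dx)) orbT.
- apply: ptn_add (ncx_acc _).
  by apply: (ncx_icx _ Hh) => x j a [].
Qed.

End Sequences.

Section Quantifiers.
Variable G : ctx.
Implicit Types (f g : G -> bits) (h k N : G -> nat) (b c : G -> bool).

Lemma ptb_has N (b : G -> nat -> bool) : ptn N -> @ptb (icx N) (fun p => b p.1 p.2) ->
  ptb (fun x => has (b x) (iota 0 (N x))).
Proof.
move=> HN Hb; apply: ptb_ext (ptb_ltn (ptn_const _ 0)
  (ptn_sum (h := fun x j => nat_of_bool (b x j)) HN Hb)) => x _.
apply/hasP/idP => [[j]|].
  rewrite mem_iota add0n => /= lt bj.
  by rewrite (bigD1 (Ordinal lt)) //= bj.
rewrite lt0n sum_nat_eq0 negb_forall => /existsP[j].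
by rewrite /= eqb0 negbK => bj; exists (val j); rewrite // mem_iota ltn_ord.
Qed.

Lemma ptb_all N (b : G -> nat -> bool) : ptn N -> @ptb (icx N) (fun p => b p.1 p.2) ->
  ptb (fun x => all (b x) (iota 0 (N x))).
Proof.
move=> HN Hb; apply: ptb_ext (ptb_not (ptb_has (b := fun x j => ~~ b x j) HN _)).
  by move=> x _; rewrite -all_predC; apply: eq_all => j; rewrite /= negbK.
exact: ptb_not Hb.
Qed.

Lemma ptb_xor N (b : G -> nat -> bool) : ptn N -> @ptb (icx N) (fun p => b p.1 p.2) ->
  ptb (fun x => \big[addb/false]_(j < N x) b x j).
Proof.
move=> HN Hb.
pose g x j a := nat_of_bool (b x j (+) odd a).
have E x j : iteri j (g x) 0 = \big[addb/false]_(i < j) b x i.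
  by elim: j => [|j IH]; rewrite ?big_ord0 //= big_ord_recr /= /g IH addbC; case: (b x j); case: (\big[_/_]_(i < j) _).
apply: (ptn_ext (f := fun x => iteri (N x) (g x) 0));
  first by move=> x _; rewrite E.
apply: (ptn_iteri (g := g) (B := fun m => 1) HN (ptn_const _ 0)).
- by pm_tac.
- by move=> x j Dx le; rewrite E; case: (\big[_/_]_(i < j) _).
- set H := ncx _.
  have Hb' : @ptb H (fun p => b p.1.1 p.1.2) by apply: (ncx_icx _ Hb) => x j a [].
  have Hc : @ptb H (fun p => odd p.2).
    apply: (ptime_ext (f := fun p : H => unary p.2)); last exact: ncx_acc.
    by move=> [[x j] a] /= [_ [_ ->]]; rewrite E; case: (\big[_/_]_(i < j) _).
  exact: ptb_addb Hb' Hc.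
Qed.

End Quantifiers.

Section Strings.
Variable G : ctx.
Implicit Types (f g : G -> bits) (h k N : G -> nat) (b c : G -> bool).

Lemma ptb_eqs f g : ptime f -> ptime g -> ptb (fun x => f x == g x).
Proof.
move=> Hf Hg.
have Hs := ptn_size Hf.
have Hc : @ptb (icx (fun x => size (f x)))
    (fun p => nth false (f p.1) p.2 == nth false (g p.1) p.2).
  by apply: ptb_eqb; apply: ptb_nth (icx_idx _); apply: icx_weak.
have := ptb_and (ptb_eqn Hs (ptn_size Hg))
  (ptb_all (b := fun x j => nth false (f x) j == nth false (g x) j) Hs Hc).
apply: ptb_ext => x _.
apply/eqP/andP => [->|[/eqP E /allP H]].
  by split=> //; apply/allP=> j _.
apply: (@eq_from_nth _ false) => // j lt.
by apply/eqP/H; rewrite mem_iota.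
Qed.

Lemma ptime_take f h : ptime f -> ptn h -> ptime (fun x => take (h x) (f x)).
Proof.
move=> Hf Hh; have Hm := ptn_min Hh (ptn_size Hf).
have Hc : @ptb (icx (fun x => minn (h x) (size (f x)))) (fun p => nth false (f p.1) p.2).
  by apply: ptb_nth (icx_idx _); apply: icx_weak.
apply: ptime_ext (ptime_mkseq (b := fun x j => nth false (f x) j) Hm Hc) => x _.
apply: (@eq_from_nth _ false); rewrite size_take ?size_mkseq // => j lt.
have lt2 : j < minn (h x) (size (f x)) by exact: lt.
by rewrite nth_mkseq ?nth_take //; lia.
Qed.

Lemma ptime_cat f g : ptime f -> ptime g -> ptime (fun x => f x ++ g x).
Proof.
move=> Hf Hg; have Hs := ptn_size Hf; have Hm := ptn_add Hs (ptn_size Hg).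
have Hc : @ptb (icx (fun x => size (f x) + size (g x)))
    (fun p => if p.2 < size (f p.1) then nth false (f p.1) p.2
              else nth false (g p.1) (p.2 - size (f p.1))).
  have Hi := @icx_idx G (fun x => size (f x) + size (g x)).
  have Hs' := @icx_weak G (fun x => size (f x) + size (g x)) _ Hs.
  apply: ptb_if; first exact: ptb_ltn.
    by apply: ptb_nth (icx_idx _); apply: icx_weak.
  by apply: ptb_nth; [apply: icx_weak | apply: ptn_sub].
apply: ptime_ext (ptime_mkseq (b := fun x j => if j < size (f x) then nth false (f x) j
   else nth false (g x) (j - size (f x))) Hm Hc) => x _.
apply: (@eq_from_nth _ false); rewrite size_cat ?size_mkseq // => j lt.
by rewrite nth_mkseq // nth_cat.
Qed.

Lemma ptime_rev f : ptime f -> ptime (fun x => rev (f x)).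
Proof.
move=> Hf; have Hs := ptn_size Hf.
have Hc : @ptb (icx (fun x => size (f x)))
    (fun p => nth false (f p.1) (size (f p.1) - p.2.+1)).
  apply: ptb_nth; first exact: icx_weak.
  by apply: ptn_sub; [exact: (icx_weak _ Hs) | exact: ptn_succ (icx_idx _)].
apply: ptime_ext (ptime_mkseq
  (b := fun x j => nth false (f x) (size (f x) - j.+1)) Hs Hc) => x _.
apply: (@eq_from_nth _ false); rewrite size_rev ?size_mkseq // => j lt.
by rewrite nth_mkseq // nth_rev.
Qed.

(** A power of two in unary may be exponentially long; truncation keeps it polynomial. This accounts
    for the [minn] in [smp] and [anc]. *)
Lemma ptn_exp2_min h k : ptn h -> ptn k -> ptn (fun x => minn (2 ^ h x) (k x)).
Proof.
move=> Hh Hk; have [T HT Hb] := ptn_bound Hk.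
have E x j : iteri j (fun _ a => minn (2 * a) (k x)) (minn 1 (k x)) = minn (2 ^ j) (k x).
  by elim: j => //= j ->; rewrite expnS; lia.
apply: (ptn_ext (f := fun x => iteri (h x) (fun _ a => minn (2 * a) (k x)) (minn 1 (k x))));
  first by move=> x _; rewrite E.
apply: (ptn_iteri (g := fun x _ a => minn (2 * a) (k x)) Hh (ptn_min (ptn_const _ 1) Hk) HT).
- by move=> x j Dx le; rewrite E; apply: leq_trans (geq_minr _ _) (Hb x Dx).
- apply: ptn_min; last exact: (ncx_weak _ Hk).
  by apply: ptn_mul; [exact: ptn_const | exact: ncx_acc].
Qed.

End Strings.

Lemma sum_ltn N T : \sum_(a < N) (a < T) = minn N T.
Proof.
elim: N => [|N IH]; first by rewrite big_ord0 min0n.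
by rewrite big_ord_recr /= IH; lia.
Qed.

(** The logarithm counts the positive exponents whose power of two is at most [N]; truncation at
    [N.+1] does not affect the comparison. *)
Lemma trunc_log_sum N : trunc_log 2 N = \sum_(a < N) (minn (2 ^ a.+1) N.+1 <= N).
Proof.
case: N => [|N]; first by rewrite big_ord0 trunc_log0.
rewrite -[LHS]/(trunc_log 2 N.+1).
have lt : trunc_log 2 N.+1 < N.+1.
  apply: leq_trans (_ : 2 ^ trunc_log 2 N.+1 <= _); first exact: ltn_expl.
  exact: trunc_logP.
rewrite -[LHS](minn_idPr (ltnW lt)) -sum_ltn; apply: eq_bigr => a _.
congr nat_of_bool; rewrite geq_min ltnn orbF.
apply/idP/idP => H; last exact: trunc_log_max.
apply: leq_trans (_ : 2 ^ trunc_log 2 N.+1 <= _); last exact: trunc_logP.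
by rewrite leq_exp2l.
Qed.

Section Logarithm.
Variable G : ctx.
Implicit Types (f g : G -> bits) (h k N : G -> nat) (b c : G -> bool).

Lemma ptn_log h : ptn h -> ptn (fun x => trunc_log 2 (h x)).
Proof.
move=> Hh.
have Hc : @ptb (icx h) (fun p => minn (2 ^ p.2.+1) (h p.1).+1 <= h p.1).
  have Hh' := @icx_weak G h _ Hh.
  by apply: ptb_leq (Hh'); apply: ptn_exp2_min; apply: ptn_succ; [exact: icx_idx | exact: Hh'].

apply: ptn_ext (ptn_sum (h := fun x j => nat_of_bool (minn (2 ^ j.+1) (h x).+1 <= h x)) Hh Hc) => x _.
exact: trunc_log_sum.
Qed.

Lemma ptn_div h k : ptn h -> ptn k -> ptn (fun x => h x %/ k x).
Proof.
move=> Hh Hk.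
have Hc : @ptb (icx h) (fun p => (0 < k p.1) && (p.2.+1 * k p.1 <= h p.1)).
  have Hk' := @icx_weak G h _ Hk.
  apply: ptb_and; first by apply: ptb_ltn Hk'; apply: ptn_const.
  apply: ptb_leq; last exact: (icx_weak _ Hh).
  by apply: ptn_mul Hk'; apply: ptn_succ; apply: icx_idx.
apply: ptn_ext (ptn_sum (h := fun x j => nat_of_bool ((0 < k x) && (j.+1 * k x <= h x))) Hh Hc) => x _.
case: (posnP (k x)) => [->|k0]; first by rewrite divn0 big1.
rewrite -[LHS](minn_idPr (leq_div _ _)) -sum_ltn.
by apply: eq_bigr => a _; rewrite leq_divRL.
Qed.

End Logarithm.

(** * Coins and queries *)

Lemma stk_set A y z : upd (stk A) y z = stk (set_nth [::] A y z).
Proof. by apply/funext=> v; rewrite nth_set_nth. Qed.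

Lemma enc_set (G : ctx) (x : G) B j z :
  upd (stk (enc x ++ B)) (ar G + j) z = stk (enc x ++ set_nth [::] B j z).
Proof.
rewrite -(encP x) stk_set; congr (nth [::]).
by elim: (enc x) => //= u e ->.
Qed.

Lemma enc_get (G : ctx) (x : G) B j : stk (enc x ++ B) (ar G + j) = stk B j.
Proof. by rewrite nth_cat encP ltnNge leq_addr /= addKn. Qed.

(** Tossing leaves an exhausted counter stack and the coins in reverse order. *)
Definition tcx (G : ctx) (N : G -> nat) : ctx.
Proof.
apply: (@Ctx (G * bits)%type (fun p => dom p.1 /\ size p.2 = N p.1) (ar G + 2)
  (fun p => enc p.1 ++ [:: [::]; rev p.2])).
by move=> x; rewrite size_cat encP.
Defined.

(** The five added stacks after the queries: mask consumed, address cleared, carry stack empty,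
    answers in reverse order, carry flag off. *)
Definition qcx (G : ctx) (mask : G -> bits) : ctx.
Proof.
apply: (@Ctx (G * bits)%type (fun p => dom p.1 /\ size p.2 = size (mask p.1))
  (ar G + 5) (fun p => enc p.1 ++ [:: [::]; [::]; [::]; rev p.2; [::]])).
by move=> x; rewrite size_cat encP.
Defined.

Lemma tcx_weak (G : ctx) N (f : G -> bits) : ptime f -> @ptime (@tcx G N) (fun p => f p.1).
Proof. by apply: ptime_weak => [x []//|x _]; exists [:: [::]; rev x.2]. Qed.

Lemma tcx_coins (G : ctx) N : @ptime (@tcx G N) (fun p => p.2).
Proof.
have lt : ar G + 1 < ar (tcx N) by rewrite ltn_add2l.
by apply: ptime_ext (ptime_rev (ptime_var lt)) => p _; rewrite enc_get /= revK.
Qed.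

Lemma qcx_weak (G : ctx) mask (f : G -> bits) :
  ptime f -> @ptime (@qcx G mask) (fun p => f p.1).
Proof.
by apply: ptime_weak => [x []//|x _]; exists [:: [::]; [::]; [::]; rev x.2; [::]].
Qed.

Lemma qcx_answers (G : ctx) mask : @ptime (@qcx G mask) (fun p => p.2).
Proof.
have lt : ar G + 3 < ar (qcx mask) by rewrite ltn_add2l.
by apply: ptime_ext (ptime_rev (ptime_var lt)) => p _; rewrite enc_get /= revK.
Qed.

Lemma toss_ev (G : ctx) (N : G -> nat) : ptn N ->
  exists c T, pm T /\ forall w (x : G) r q, dom x -> N x <= size r ->
  exists2 t, t <= T (tsz (enc x)) &
    ev w c (stk (enc x)) r q t (stk (enc x ++ [:: [::]; rev (take (N x) r)]))
      (drop (N x) r) q.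
Proof.
move=> [cN [T [HT R]]]; set k := ar G.
exists (Seq cN (While (k + 0) (Seq (Pop (k + 0)) (Toss (k + 1))))), (fun m => T m + (4 * T m + 1) + 1).
split; first by pm_tac.
move=> w x r q Dx le.
have [_ [t let_ {}R]] := R x Dx.
have NT : N x <= t by have := run_out_size R; rewrite size_nseq.
exists (t + (4 * N x).+1).+1; first lia.
apply: ev_seq (R w r q) _.
have -> : stk (enc x ++ [:: unary (N x)]) = stk (enc x ++ [:: unary (N x); [::]]).
  by rewrite -[in LHS](stk_pad _ 1) -catA.
suff gen d a : d <= size r -> ev w (While (k + 0) (Seq (Pop (k + 0)) (Toss (k + 1))))
    (stk (enc x ++ [:: unary d; a])) r q (4 * d).+1
    (stk (enc x ++ [:: [::]; catrev (take d r) a])) (drop d r) q by exact: gen.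
elim: d a r {le R let_ NT} => [|d IH] a r le.
  by rewrite take0 drop0; apply: ev_while0; rewrite enc_get.
case: r le => // b r le.
have -> : (4 * d.+1).+1 = ((1 + 1).+1 + (4 * d).+1).+1 by lia.
apply: (@ev_while1 _ _ _ _ _ _ _ (stk (enc x ++ [:: unary d; b :: a])) r q).
- by rewrite enc_get.
- apply: ev_seq.
    have := ev_pop w (k + 0) (stk (enc x ++ [:: unary d.+1; a])) (b :: r) q.
    rewrite enc_get enc_set; exact.
  have := ev_toss w b (k + 1) (stk (enc x ++ [:: unary d; a])) r q.
  by rewrite enc_get enc_set.
- exact: IH.
Qed.

Lemma nat_of_bits_nseq0 j v : nat_of_bits (nseq j false ++ v) = 2 ^ j * nat_of_bits v.
Proof.
elim: j => [|j IH] /=; first by rewrite mul1n.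
by rewrite IH add0n expnS -mul2n mulnA.
Qed.

Lemma nat_of_bits_nseq1 j v :
  (nat_of_bits (nseq j true ++ v)).+1 = 2 ^ j * (nat_of_bits v).+1.
Proof.
elim: j => [|j IH] /=; first by rewrite mul1n.
by rewrite expnS -mulnA -IH -mul2n; lia.
Qed.

Section Query.
Variable G : ctx.
Let k := ar G.

(** Increment of the little-endian address on stack [k + 1]: leading ones move to [k + 2] until a
    zero or the end is met, and [unwind_loop] brings them back as zeros. Stack [k + 4] holds the
    pending carry. *)
Definition carry_loop : cmd :=
  While (k + 4) (Case (k + 1)
    (Seq (Push true (k + 1)) (Pop (k + 4)))
    (Seq (Pop (k + 1)) (Seq (Push true (k + 1)) (Pop (k + 4))))
    (Seq (Pop (k + 1)) (Push true (k + 2)))).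

Definition unwind_loop : cmd :=
  While (k + 2) (Seq (Pop (k + 2)) (Push false (k + 1))).

Lemma run_carry (x : G) mk an u j :
  exists v j' t, [/\ run carry_loop
     (stk (enc x ++ [:: mk; u; nseq j true; an; [:: true]])) t
     (stk (enc x ++ [:: mk; v; nseq j' true; an; [::]])),
     t <= 8 * size u + 10, size v + j' <= size u + j + 1
   & nat_of_bits (nseq j' false ++ v) = (nat_of_bits (nseq j true ++ u)).+1].
Proof.
elim: u j => [|b u IH] j.
  exists [:: true], j, ((1 + 1).+2 + 1).+1; split=> //=; last first.
  - by rewrite nat_of_bits_nseq0 nat_of_bits_nseq1.
  - lia.
  move=> w r q.
  apply: ev_while1; first by rewrite enc_get.
    apply: ev_case; rewrite enc_get /=.
    apply: ev_seq; first exact: ev_push.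
    rewrite enc_get enc_set; exact: ev_pop.
  rewrite enc_get enc_set /=; apply: ev_while0; exact: enc_get.
case: b.
  have [v [j' [t [R le1 le2 E]]]] := IH j.+1.
  exists v, j', ((1 + 1).+2 + t).+1; split.
  - move=> w r q.
    apply: ev_while1; first by rewrite enc_get.
      apply: ev_case; rewrite enc_get /=.
      apply: ev_seq; first exact: ev_pop.
      rewrite enc_get enc_set; exact: ev_push.
    by rewrite enc_get enc_set /=; apply: R.
  - by rewrite /=; lia.
  - by rewrite /=; lia.
  - by rewrite E !nat_of_bits_nseq1 expnS /= -mul2n; nia.
exists (true :: u), j, ((1 + (1 + 1).+1).+2 + 1).+1; split=> //=; try lia.
  move=> w r q.
  apply: ev_while1; first by rewrite enc_get.
    apply: ev_case; rewrite enc_get /=.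
    apply: ev_seq; first exact: ev_pop.
    rewrite enc_get enc_set; apply: ev_seq; first exact: ev_push.
    rewrite enc_get enc_set; exact: ev_pop.
  rewrite enc_get enc_set /=; apply: ev_while0; exact: enc_get.
by rewrite nat_of_bits_nseq0 nat_of_bits_nseq1 /=.
Qed.

Lemma run_unwind (x : G) mk an u j fl :
  run unwind_loop (stk (enc x ++ [:: mk; u; nseq j true; an; fl])) (4 * j).+1
     (stk (enc x ++ [:: mk; nseq j false ++ u; [::]; an; fl])).
Proof.
elim: j u => [|j IH] u w r q.
  by apply: ev_while0; rewrite enc_get.
have -> : (4 * j.+1).+1 = ((1 + 1).+1 + (4 * j).+1).+1 by lia.
apply: ev_while1; first by rewrite enc_get.
  apply: ev_seq; first exact: ev_pop.
  rewrite enc_get enc_set; exact: ev_push.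
rewrite enc_get enc_set /=.
have := IH (false :: u) w r q.
suff -> : nseq j false ++ false :: u = false :: nseq j false ++ u by [].
by elim: (j) => //= j' ->.
Qed.

(** Only a mask bit 1 costs a query; elsewhere the answer 0 is pushed, so that answers keep their
    positions. *)
Definition query_loop : cmd :=
  While (k + 0) (Seq (Case (k + 0) Skip (Push false (k + 3)) (Query (k + 1) (k + 3)))
    (Seq (Pop (k + 0)) (Seq (Push true (k + 4)) (Seq carry_loop unwind_loop)))).

(** The bound [S] persists because each round consumes one mask bit and adds at most one address
    bit. *)
Lemma ev_query_loop w (x : G) mk i u an r q S :
  nat_of_bits u = i -> size u + size mk <= S ->
  exists t u', [/\ t <= size mk * (12 * S + 40) + 1, size u' <= S
  & ev w query_loop (stk (enc x ++ [:: mk; u; [::]; an; [::]])) r q t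
     (stk (enc x ++ [:: [::]; u'; [::];
        catrev (mkseq (fun p => nth false mk p && nth false w (i + p)) (size mk)) an; [::]]))
     r (q + count id mk)].
Proof.
elim: mk i u an q => [|b mk IH] i u an q Eu le.
  exists 1, u; split=> //; first by rewrite addn0 in le.
  by rewrite addn0; apply: ev_while0; rewrite enc_get.
have [v [j' [t1 [R1 le1 le2 E]]]] := run_carry x mk ((b && nth false w i) :: an) u 0.
rewrite /= Eu in E.
have R2 := run_unwind x mk ((b && nth false w i) :: an) v j' [::].
have sz : size (nseq j' false ++ v) + size mk <= S.
  by move: le; rewrite size_cat size_nseq /=; lia.
have [t3 [u' [le3 su R3]]] := IH _ _ ((b && nth false w i) :: an) (q + b) E sz.
exists ((1.+1 + (1 + (1 + (t1 + (4 * j').+1).+1).+1).+1).+1 + t3).+1, u'; split=> //.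
  by move: le; rewrite mulSn /=; lia.
apply: (@ev_while1 _ _ _ _ _ _ _
   (stk (enc x ++ [:: mk; nseq j' false ++ v; [::]; (b && nth false w i) :: an; [::]]))
   r (q + b)).
- by rewrite enc_get.
- apply: (@ev_seq _ _ _ _ _ _ _
     (stk (enc x ++ [:: b :: mk; u; [::]; (b && nth false w i) :: an; [::]])) r (q + b)).
    apply: ev_case; rewrite enc_get /=.
    case: (b).
      have := ev_query w (k + 1) (k + 3) (stk (enc x ++ [:: true :: mk; u; [::]; an; [::]])) r q.
      by rewrite !enc_get enc_set /= Eu (addn1 q).
    have := ev_push w false (k + 3) (stk (enc x ++ [:: false :: mk; u; [::]; an; [::]])) r q.
    by rewrite !enc_get enc_set /= (addn0 q).
  apply: ev_seq; first exact: ev_pop.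
  rewrite enc_get enc_set; apply: ev_seq; first exact: ev_push.
  rewrite enc_get enc_set; apply: ev_seq; first exact: R1.
  exact: R2.
have Ek : mkseq (fun p => nth false (b :: mk) p && nth false w (i + p)) (size (b :: mk))
   = (b && nth false w i) :: mkseq (fun p => nth false mk p && nth false w (i.+1 + p)) (size mk).
  rewrite /mkseq /= addn0; congr (_ :: _).
  rewrite -[1]addn0 iotaDl -map_comp; apply: eq_map => p /=.
  by rewrite addnS.
rewrite Ek [count _ _]/= addnA; exact: R3.
Qed.

Lemma query_ev (mask : G -> bits) : ptime mask ->
  exists c T, pm T /\ forall w (x : G) r q, dom x ->
  exists2 t, t <= T (tsz (enc x)) &
    ev w c (stk (enc x)) r q t
      (stk (enc x ++ [:: [::]; [::]; [::];
         rev (mkseq (fun p => nth false (mask x) p && nth false w p) (size (mask x))); [::]]))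
      r (q + count id (mask x)).
Proof.
move=> [c0 [T [HT R]]].
exists (Seq c0 (Seq query_loop (clear (k + 1)))),
  (fun m => T m + (T m * (12 * T m + 40) + 1) + (2 * T m + 1) + 2).
split; first by pm_tac.
move=> w x r q Dx; have [_ [t let_ {}R]] := R x Dx.
have sm : size (mask x) <= T (tsz (enc x)) by apply: leq_trans (run_out_size R) let_.
have [t2 [u' [le2 su R2]]] := @ev_query_loop w x (mask x) 0 [::] [::] r q (T (tsz (enc x))) erefl sm.
exists (t + (t2 + (2 * size u').+1).+1).+1.
  have : size (mask x) * (12 * T (tsz (enc x)) + 40) <= T (tsz (enc x)) * (12 * T (tsz (enc x)) + 40).
    by rewrite leq_mul2r sm orbT.
  lia.
apply: ev_seq (R w r q) _.
have -> : stk (enc x ++ [:: mask x]) = stk (enc x ++ [:: mask x; [::]; [::]; [::]; [::]]).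
  by rewrite -[in LHS](stk_pad _ 4) -catA.
apply: ev_seq R2 _.
set B := (X in stk (_ ++ X)).
have := run_clear (k + 1) (stk (enc x ++ B)) w r (q + count id (mask x)).
by rewrite enc_get enc_set.
Qed.

End Query.

Definition mvto (x y z : nat) : cmd := Seq (rmv x z) (Seq (clear y) (rmv z y)).

Lemma run_mvto x y z sg : x <> y -> y <> z -> x <> z -> sg z = [::] ->
  exists t sg', [/\ run (mvto x y z) sg t sg',
    t <= 10 * size (sg x) + 2 * size (sg y) + 5, sg' y = sg x, sg' z = [::] /\ sg' x = [::]
    & forall v, v <> x -> v <> y -> sg' v = sg v].
Proof.
move=> xy yz xz Ez.
have R1 := @run_rmv x z sg xz.
set sg1 := upd _ _ _ in R1.
have R2 := run_clear y sg1.
have E1 : sg1 y = sg y by rewrite /sg1 upd_neq // upd_neq // => e; apply: xy.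
set sg2 := upd _ _ _ in R2.
have R3 := @run_rmv z y sg2 (not_eq_sym yz).
have E2 : sg2 z = rev (sg x).
  by rewrite /sg2 upd_neq ?/sg1 ?upd_eq ?Ez //; apply: not_eq_sym.
set sg3 := upd _ _ _ in R3.
exists ((5 * size (sg x)).+1 + ((2 * size (sg1 y)).+1 + (5 * size (sg2 z)).+1).+1).+1, sg3.
split; first exact: run_seq R1 (run_seq R2 R3).
- by rewrite E1 E2 size_rev; lia.
- by rewrite /sg3 upd_eq E2 /sg2 upd_eq -/(rev _) revK.
- split; first by rewrite /sg3 upd_neq ?upd_eq //; apply: not_eq_sym.
  rewrite /sg3 (@upd_neq _ y x) // (@upd_neq _ z x) // /sg2 (@upd_neq _ y x) //.
  by rewrite /sg1 (@upd_neq _ z x) // upd_eq.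
- move=> v vx vy; rewrite /sg3 upd_neq // /upd /sg2 /sg1 /upd.
  case: (eqVneq v z) => [->//|_].
  by case: eqP => // _; case: eqP.
Qed.

Lemma run_out A o0 o1 : 0 < size A ->
  exists t sg', [/\ run (Seq (mvto (size A) 0 (size A).+2) (mvto (size A).+1 1 (size A).+2))
      (stk (A ++ [:: o0; o1])) t sg',
    t <= 12 * tsz (A ++ [:: o0; o1]) + 12 * tsz (A ++ [:: o0; o1]) + 12, sg' 0 = o0 & sg' 1 = o1].
Proof.
move=> sA; set k := size A; set B := A ++ _.
have Bk : stk B k = o0 by rewrite stk_at.
have Bk1 : stk B k.+1 = o1 by rewrite nth_cat ltnNge leqnSn subSnn.
have Bk2 : stk B k.+2 = [::] by rewrite nth_default // size_cat addn2.
have [t1 [sg1 [R1 le1 E0 [Ez1 Ek1] N1]]] := @run_mvto k 0 k.+2 (stk B) ltac:(lia) ltac:(lia) ltac:(lia) Bk2.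
have [t2 [sg2 [R2 le2 E1 [Ez2 _] N2]]] := @run_mvto k.+1 1 k.+2 sg1 ltac:(lia) ltac:(lia) ltac:(lia) Ez1.
exists (t1 + t2).+1, sg2; split; first exact: run_seq R1 R2.
- rewrite N1 in le2; [|lia|lia].
  have := tsz_nth B 0; have := tsz_nth B k; have := tsz_nth B k.+1; have := tsz_nth B 1.
  (* If [k = 1], the target of the second move is the source of the first and is already empty. *)
  case: (eqVneq k 1) => [k1|k1]; last by rewrite (N1 1) in le2; lia.
  by rewrite k1 in Ek1; rewrite Ek1 /= in le2; lia.
- by rewrite N2 ?E0 ?Bk //; lia.
- by rewrite E1 N1 ?Bk1 //; lia.
Qed.

(** Normal form of the programs built here: coins, one non-adaptive batch of queries, then a
    deterministic computation with two outputs. The clock sees only [l x], whence the bound [P] on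
    the input size; its form [m ^ c + c] puts the program into the countable family [poly_alg]. *)
Lemma build_alg (G : ctx) (N : G -> nat) (mask : tcx N -> bits)
    (f g : qcx mask -> bits) (l : G -> nat) (P : nat -> nat) :
  0 < ar G -> ptn N -> ptime mask -> ptime f -> ptime g -> pm P ->
  (forall x : G, dom x -> tsz (enc x) <= P (l x)) ->
  exists a : alg, [/\ polytime a, (exists c, a = Alg (prog a) (fun m => m ^ c + c)) &
    forall x : G, dom x -> N x <= clock a (l x) /\
    forall w r, N x <= size r ->
    let z := take (N x) r in
    let an := mkseq (fun p => nth false (mask (x, z)) p && nth false w p)
                (size (mask (x, z))) in
    exists sg, [/\ final a (l x) w (enc x) r
        = Conf [::] sg (drop (N x) r) (count id (mask (x, z))),
      sg 0 = f ((x, z), an) & sg 1 = g ((x, z), an)]].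
Proof.
move=> k0 HN Hm Hf Hg HP Hl.
have [c1 [T1 [HT1 R1]]] := toss_ev HN.
have [TN HTN BN] := ptn_bound HN.
have [c2 [T2 [HT2 R2]]] := query_ev Hm.
have [TM HTM BM] := ptime_size Hm.
have [c3 [T3 [HT3 R3]]] := ptimes_cons Hf (ptimes_cons Hg (ptimes_nil _)).
pose k := ar (qcx mask).
pose S2 m := m + TN m.
pose S3 m := S2 m + TM (S2 m).
pose S4 m := S3 m + 2 * T3 (S3 m).
pose T m := TN m + T1 m + T2 (S2 m) + T3 (S3 m) + (12 * S4 m + 12 * S4 m + 12) + 3.
have HS2 : pm S2 by rewrite /S2; pm_tac.
have HS3 : pm S3 by rewrite /S3; pm_tac.
have HS4 : pm S4 by rewrite /S4; pm_tac.
have HT : pm T by rewrite /T; pm_tac.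
have [[c Hc] _] : pm (fun m => T (P m)) by pm_tac.
exists (Alg (Seq c1 (Seq c2 (Seq c3 (Seq (mvto k 0 k.+2) (mvto k.+1 1 k.+2)))))
   (fun m => m ^ c + c)); split; [by exists c | by exists c |].
move=> x Dx.
have TS : T (tsz (enc x)) <= l x ^ c + c.
  by apply: leq_trans (Hc (l x)); apply: HT.2; apply: Hl.
split=> [|w r le z an].
  by apply: leq_trans TS; rewrite /T; have := BN x Dx; lia.
have [t1 le1 E1] := R1 w x r 0 Dx le.
have Dz : dom ((x, z) : tcx N) by split=> //=; rewrite size_takel.
have [t2 le2 E2] := R2 w (x, z) (drop (N x) r) 0 Dz.
have Da : dom ((x, z, an) : qcx mask) by split=> //=; rewrite size_mkseq.
have [s3 [t3 le3 E3]] := R3 (x, z, an) Da.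
have s2 : tsz (enc ((x, z) : tcx N)) <= S2 (tsz (enc x)).
  rewrite /= tsz_cat !tsz_cons tsz_nil /= size_rev size_takel // /S2.
  by have := BN x Dx; lia.
have s3' : tsz (enc ((x, z, an) : qcx mask)) <= S3 (tsz (enc x)).
  rewrite [enc _]/= tsz_cat !tsz_cons tsz_nil size_rev [size [::]]/= size_mkseq /S3.
  have := BM (x, z) Dz; have := HTM.2 _ _ s2; move: s2; rewrite [enc _]/=; lia.
have k1 : 0 < size (enc ((x, z, an) : qcx mask)) by rewrite encP /=; lia.
have [t4 [sg [R4 le4 E40 E41]]] :=
  @run_out (enc ((x, z, an) : qcx mask)) (f (x, z, an)) (g (x, z, an)) k1.
exists sg; split=> //.
rewrite encP -/k in R4.
apply: (@ev_final _ _ _ _ _ (t1 + (t2 + (t3 + t4).+1).+1).+1).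
  apply: ev_seq E1 _; apply: ev_seq E2 _.
  exact: ev_seq (E3 w _ _) (R4 w _ _).
rewrite /=; apply: leq_trans TS.
have le3' : t3 <= T3 (S3 (tsz (enc x))) by apply: leq_trans le3 _; apply: HT3.2.
have le2' : t2 <= T2 (S2 (tsz (enc x))) by apply: leq_trans le2 _; apply: HT2.2.
have s4 : tsz (enc ((x, z, an) : qcx mask) ++ [:: f (x, z, an); g (x, z, an)]) <= S4 (tsz (enc x)).
  have := ptimes_out_size E3; rewrite tsz_cat /S4 [size [:: _; _]]/=; lia.
rewrite /T; lia.
Qed.

(** * The code *)

Definition win (w : bits) (a len : nat) : bits := mkseq (fun i => nth false w (a + i)) len.

Lemma nth_win w a len i : i < len -> nth false (win w a len) i = nth false w (a + i).
Proof. by move=> lt; rewrite nth_mkseq. Qed.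

Lemma eq_win w w' a a' len :
  (forall i, i < len -> nth false w (a + i) = nth false w' (a' + i)) ->
  win w a len = win w' a' len.
Proof. by move=> E; apply/eq_in_map => i; rewrite mem_iota => /= lt; apply: E. Qed.

Lemma win_eqP w w' a a' len i : win w a len = win w' a' len -> i < len ->
  nth false w (a + i) = nth false w' (a' + i).
Proof. by move=> E lt; rewrite -!(@nth_win _ _ len) // E. Qed.

Lemma win_all w : win w 0 (size w) = w.
Proof.
apply: (@eq_from_nth _ false); rewrite size_mkseq // => i lt.
by rewrite nth_win.
Qed.

Section Code.
Variables (n e : nat) (h : bits -> bits) (M : bits).

Definition lg := trunc_log 2 n.
Definition addr_len := lg.-1.
(** A power of two, so that [addr_len] coins address an exactly uniform position. *)
Definition fp_len := 2 ^ addr_len.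
(** The cap [n %/ 32] keeps the number of possible roots small enough for the union bound in
    [bad_matrix_prob]. *)
Definition chunk_len := minn e (n %/ 32).
(** The factor 4 makes the [2 * leaves - 1] chunks fit into half of the word. *)
Definition leaves := if e <= n %/ 32 then n %/ (4 * e) else 1.
Definition tree_len := (2 * leaves - 1) * chunk_len.
Definition samples := lg ^ 3.

Local Notation L := chunk_len.
Local Notation m := leaves.
Local Notation F := fp_len.

(* Chunks of a heap-shaped hash tree: the root is chunk 1, the children of
   chunk [u] are chunks [2 u] and [2 u + 1], the leaves are chunks
   [m] to [2 m - 1].  They are prepended from chunk [m - 1] down to chunk 1, so
   at stage [j] the string starts with chunk [m - j]. *)
Definition tree (x : bits) : bits :=
  iteri m.-1 (fun j acc => h (win acc ((m - 2 - j) * L) (2 * L)) ++ acc) x.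

(** Row [j] of the F by L matrix [M], stored by rows, times the first L bits of [r] over GF(2). The
    root comes first in [tree x], so applying this to the whole tree encodes the root. *)
Definition fp (r : bits) (j : nat) : bool :=
  \big[addb/false]_(k < L) (nth false r k && nth false M (j * L + k)).

Definition encw (x : bits) : bits :=
  mkseq (fun p => if p < F then fp (tree x) p else nth false (tree x) (p - F)) n.

Definition chunk (w : bits) (u : nat) := win w (F + (u - 1) * L) L.
(** Siblings [2 u] and [2 u + 1] are adjacent, so a single window is the hash input of [u]. *)
Definition kids (w : bits) (u : nat) := win w (F + (2 * u - 1) * L) (2 * L).

Definition node (i : nat) := if F <= i then ((i - F) %/ L).+1 else 1.
(** Halving a heap index gives the parent. For positions inside the word [node i <= n], so the
    truncation does not change the quotient. *)
Definition anc (i d : nat) := node i %/ minn (2 ^ d) n.+1.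
Definition inner (u : nat) := (0 < u) && (u < m).

(** Block [j] of [addr_len] coins read as a little-endian number, so distinct samples use disjoint
    coins. *)
Definition smp (z : bits) (j : nat) :=
  \sum_(k < addr_len) nth false z (j * addr_len + k) * minn (2 ^ k) n.

Definition fp_test (w z : bits) :=
  all (fun j => nth false w (smp z j) == fp (chunk w 1) (smp z j)) (iota 0 samples).

Definition path_test (w : bits) (i : nat) :=
  all (fun d => ~~ inner (anc i d) || (h (kids w (anc i d)) == chunk w (anc i d)))
      (iota 0 lg.+1).

(** Fingerprint bits are recomputed from the root rather than read, so that a correct root makes
    them correct. *)
Definition out_bit (w : bits) (i : nat) :=
  if i < F then fp (chunk w 1) i
  else if i < F + tree_len then nth false w i else false.

Definition decw (w z : bits) (i : nat) : bits :=
  if fp_test w z && path_test w i then [:: out_bit w i] else [::].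

Definition in_range (a len p : nat) := (a <= p) && (p < a + len).

(** The positions to read depend on the coins and on [i], never on the word; this makes the decoder
    non-adaptive. *)
Definition maskp (z : bits) (i p : nat) :=
  [|| has (fun j => p == smp z j) (iota 0 samples), in_range F L p, p == i
    | has (fun d => inner (anc i d) &&
         (in_range (F + (anc i d - 1) * L) L p
          || in_range (F + (2 * anc i d - 1) * L) (2 * L) p)) (iota 0 lg.+1)].

Definition nqueries := samples + (L + (1 + lg.+1 * (L + 2 * L))).

Definition colliding (c w : bits) (u : nat) :=
  (kids c u != kids w u) && (h (kids c u) == h (kids w u)).

Definition find_col (c w : bits) :=
  iteri m (fun u a => if (0 < u) && colliding c w u then u else a) 0.

Lemma leaves_gt0 : 0 < L -> 0 < m.
Proof.
rewrite /L /m; case: ifP => // le; rewrite leq_min => /andP[e0 _].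
by rewrite divn_gt0; lia.
Qed.

Lemma leaves_big : 1 < m -> L = e.
Proof. by rewrite /m /L; case: ifP => // le _; apply/minn_idPl. Qed.

Lemma tree_lenP : tree_len <= n %/ 2.
Proof.
rewrite /tree_len /m /L; case: ifP => le.
  rewrite (minn_idPl le).
  have : n %/ (4 * e) * (4 * e) <= n by apply: leq_trunc_div.
  set a := n %/ (4 * e) => H.
  rewrite leq_divRL //; nia.
have : minn e (n %/ 32) <= n %/ 32 by rewrite geq_minr.
by lia.
Qed.

Lemma smp_lt z j : smp z j < F.
Proof.
suff gen a b : \sum_(k < a) nth false z (b + k) * minn (2 ^ k) n < 2 ^ a by exact: gen.
elim: a => [|a IH]; first by rewrite big_ord0.
rewrite big_ord_recr /= expnS.
have := IH; have : minn (2 ^ a) n <= 2 ^ a by apply: geq_minl.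
set S := \sum_(k < a) _; set c := minn _ _.
by case: (nth _ _ _) => /=; rewrite ?mul1n ?mul0n; lia.
Qed.

Hypothesis n_gt0 : 0 < n.

Lemma lt_lg : 2 ^ lg <= n < 2 ^ lg.+1.
Proof. exact: trunc_log_bounds. Qed.

Lemma fp_len_gt0 : 0 < F. Proof. by rewrite expn_gt0. Qed.

Lemma fp_lenP : [/\ F <= n, n < 4 * F & F + n %/ 2 <= n].
Proof.
have := lt_lg; rewrite /F /addr_len; case: lg => [|k] /=.
  by rewrite expn0 expn1; case: (n) n_gt0 => [|[|k]].
by rewrite !expnS; set a := 2 ^ k => /andP[? ?]; split; lia.
Qed.

Lemma layout : F + tree_len <= n.
Proof. by have [_ _] := fp_lenP; have := tree_lenP; lia. Qed.

Lemma eq_fp r r' j : (forall k, k < L -> nth false r k = nth false r' k) ->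
  fp r j = fp r' j.
Proof. by move=> E; apply: eq_bigr => k _; rewrite E. Qed.

Hypothesis h_size : forall y, size (h y) = e.

Section Message.
Variable x : bits.
Hypothesis sx : size x = m * L.

Lemma win_cons a b p len : size a = L -> win (a ++ b) (L + p) len = win b p len.
Proof.
move=> sa; apply: eq_win => i lt.
by rewrite nth_cat sa -addnA ltnNge leq_addr /= addKn.
Qed.

(** Stage [j] starts with chunk [m - j], so chunk [v] sits at offset [v - (m - j)], and prepending a
    chunk shifts every offset by one. *)
Lemma tree_stage j : j <= m.-1 ->
  let acc := iteri j (fun j acc => h (win acc ((m - 2 - j) * L) (2 * L)) ++ acc) x in
  size acc = (m + j) * L /\
  forall v, m - j <= v -> v < m ->
    win acc ((v - (m - j)) * L) L = h (win acc ((2 * v - (m - j)) * L) (2 * L)).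
Proof.
elim: j => [|j IH] le /=; first by rewrite addn0; split=> // v; lia.
have [|sA HA] := IH; first lia.
set acc := iteri j _ x in sA HA *; set y := h _.
(* A hash value is prepended only if [m > 1], and then it fills a chunk exactly. *)
have sy : size y = L by rewrite h_size leaves_big //; lia.
split; first by rewrite size_cat sy sA addnS mulSn.
move=> v lev ltv.
case: (eqVneq v (m - j.+1)) => [->|ne].
  rewrite subnn mul0n.
  have -> : (2 * (m - j.+1) - (m - j.+1)) * L = L + (m - 2 - j) * L.
    by rewrite -mulSn; congr (_ * _); lia.
  rewrite win_cons // -/y -{2}[y]win_all sy; apply: eq_win => i lt.
  by rewrite nth_cat sy lt.
have -> : (v - (m - j.+1)) * L = L + (v - (m - j)) * L.
  by rewrite -mulSn; congr (_ * _); lia.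
have -> : (2 * v - (m - j.+1)) * L = L + (2 * v - (m - j)) * L.
  by rewrite -mulSn; congr (_ * _); lia.
by rewrite !win_cons // HA //; lia.
Qed.

Lemma size_tree : size (tree x) = tree_len.
Proof.
have [-> _] := tree_stage (leqnn _); rewrite /tree_len.
by congr (_ * _); lia.
Qed.

Lemma tree_node v : inner v ->
  win (tree x) ((v - 1) * L) L = h (win (tree x) ((2 * v - 1) * L) (2 * L)).
Proof.
move=> /andP[v0 ltv]; have [_ H] := tree_stage (leqnn _).
have := H v; have -> : m - m.-1 = 1 by lia.
exact.
Qed.

(** Stages only prepend, so the message survives as the leaves. Injectivity of the encoding
    follows. *)
Lemma tree_msg k : nth false (tree x) (m.-1 * L + k) = nth false x k.
Proof.
rewrite /tree.
have : forall j, j <= m.-1 ->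
   nth false (iteri j (fun j acc => h (win acc ((m - 2 - j) * L) (2 * L)) ++ acc) x) (j * L + k)
   = nth false x k.
  elim=> [|j IH] le //=.
  have EL : L = e by apply: leaves_big; lia.
  by rewrite nth_cat h_size -EL mulSn -addnA ltnNge leq_addr /= addKn IH //; lia.
exact.
Qed.

Lemma size_encw : size (encw x) = n.
Proof. by rewrite size_mkseq. Qed.

Lemma nth_encw_fp p : p < F -> nth false (encw x) p = fp (tree x) p.
Proof.
by move=> lt; rewrite nth_mkseq ?lt //; have [le _ _] := fp_lenP; lia.
Qed.

Lemma nth_encw_tree p : nth false (encw x) (F + p) = nth false (tree x) p.
Proof.
case: (ltnP (F + p) n) => lt.
  by rewrite nth_mkseq // ltnNge leq_addr /= addKn.
by rewrite !nth_default ?size_encw ?size_tree //; have := layout; lia.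
Qed.

Lemma win_encw a len : win (encw x) (F + a) len = win (tree x) a len.
Proof. by apply: eq_win => i _; rewrite -addnA nth_encw_tree. Qed.

Lemma heap_encw u : inner u -> h (kids (encw x) u) = chunk (encw x) u.
Proof. by move=> Hu; rewrite /kids /chunk !win_encw tree_node. Qed.

Lemma fp_chunk1 j : fp (chunk (encw x) 1) j = fp (tree x) j.
Proof.
apply: eq_fp => k lt; rewrite nth_win // subnn mul0n addn0.
exact: nth_encw_tree.
Qed.

Lemma decw_encw z i : i < n -> decw (encw x) z i = [:: nth false (encw x) i].
Proof.
move=> lti; rewrite /decw /fp_test.
have -> /= : all (fun j => nth false (encw x) (smp z j) == fp (chunk (encw x) 1) (smp z j))
    (iota 0 samples).
  by apply/allP=> j _; rewrite fp_chunk1 nth_encw_fp ?smp_lt.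
have -> : path_test (encw x) i.
  apply/allP=> d _; case Hu: (inner _) => //=.
  by rewrite heap_encw.
congr [:: _]; rewrite /out_bit fp_chunk1.
case: ltnP => hi; first by rewrite nth_encw_fp.
case: ltnP => hi2 //.
rewrite -(subnKC hi) nth_encw_tree nth_default // size_tree; lia.
Qed.

End Message.

Lemma encw_inj x y : size x = m * L -> size y = m * L -> encw x = encw y -> x = y.
Proof.
move=> sx sy E; apply: (@eq_from_nth _ false); first by rewrite sx sy.
move=> i _; rewrite -(tree_msg sx) -(tree_msg sy).
by rewrite -(nth_encw_tree sx) -(nth_encw_tree sy) E.
Qed.

(** Links the abstract decoder, which is given the whole word, to the machine, which receives only
    the masked word. *)
Lemma decw_masked w z i : size w = n ->
  decw (mkseq (fun p => nth false (mkseq (maskp z i) n) p && nth false w p) n) z i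
  = decw w z i.
Proof.
move=> sw; set a := mkseq _ n.
have E p : maskp z i p -> nth false a p = nth false w p.
  move=> Hp; case: (ltnP p n) => lt; last by rewrite !nth_default ?size_mkseq ?sw.
  by rewrite nth_mkseq // nth_mkseq // Hp.
have Ec : chunk a 1 = chunk w 1.
  apply: eq_win => k lt; apply: E; rewrite /maskp /in_range subnn mul0n addn0.
  by rewrite leq_addr ltn_add2l lt /= orbT.
have Ei : nth false a i = nth false w i by apply: E; rewrite /maskp eqxx !orbT.
rewrite /decw /out_bit Ec Ei; congr (if _ && _ then _ else _).
  apply: eq_in_all => j Hj; rewrite Ec E // /maskp.
  by apply/or4P/Or41/hasP; exists j.
apply: eq_in_all => d Hd; case Hu: (inner _) => //=.
have Hm p : in_range (F + (anc i d - 1) * L) L p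
     || in_range (F + (2 * anc i d - 1) * L) (2 * L) p -> maskp z i p.
  by move=> H; apply/or4P/Or44/hasP; exists d; rewrite // Hu.
congr (h _ == _); apply: eq_win => k lt; apply/E/Hm; rewrite /in_range leq_addr ltn_add2l lt //.
by rewrite orbT.
Qed.

Lemma count_in_range a len N : count (in_range a len) (iota 0 N) <= len.
Proof.
rewrite -size_filter -[leqRHS](size_iota a); apply: uniq_leq_size.
  by rewrite filter_uniq // iota_uniq.
by move=> p; rewrite mem_filter => /andP[H _]; rewrite mem_iota.
Qed.

Lemma count_has (Q : nat -> pred nat) js s B : (forall j, count (Q j) s <= B) ->
  count (fun p => has (fun j => Q j p) js) s <= size js * B.
Proof.
move=> H; elim: js => [|j js IH] /=; first by rewrite count_pred0.
apply: leq_trans (_ : count (predU (Q j) (fun p => has (fun j => Q j p) js)) s <= _) => //.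
have := count_predUI (Q j) (fun p => has (fun j => Q j p) js) s.
by rewrite mulSn; have := H j; move: IH; lia.
Qed.

Lemma count_orb (P Q : pred nat) s : count (fun p => P p || Q p) s <= count P s + count Q s.
Proof. by rewrite -count_predUI leq_addr. Qed.

Lemma count_mask z i : count id (mkseq (maskp z i) n) <= nqueries.
Proof.
rewrite count_map /nqueries.
have one v : count (fun p => p == v) (iota 0 n) <= 1.
  by rewrite (count_uniq_mem _ (iota_uniq _ _)); case: (v \in _).
apply: leq_trans (count_orb _ _ _) _; apply: leq_add.
  by apply: leq_trans (count_has _ _ (B := 1)) _ => //; rewrite size_iota muln1.
apply: leq_trans (count_orb _ _ _) _; apply: leq_add; first exact: count_in_range.
apply: leq_trans (count_orb _ _ _) _; apply: leq_add; first exact: one.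
apply: leq_trans (count_has _ _ (B := L + 2 * L)) _; last by rewrite size_iota.
move=> d; case: (inner _) => /=; last by rewrite count_pred0.
by apply: leq_trans (count_orb _ _ _) _; apply: leq_add; apply: count_in_range.
Qed.

Lemma find_colP c w u : inner u -> colliding c w u -> colliding c w (find_col c w).
Proof.
move=> /andP[u0 ltu] Hu; rewrite /find_col.
elim: m ltu => // k IH lt /=; case: ifP => [/andP[]//|H].
apply: IH; case: (eqVneq u k) => [E|]; last by lia.
by rewrite -E u0 Hu in H.
Qed.

(** With the right root, fingerprint and padding positions are answered correctly, so a wrong answer
    lies in some chunk of the tree. That chunk differs from the original while the root does not,
    and the checked hashes force a collision in between. *)
Lemma decw_wrong_collides x w z i b :
  size x = m * L -> i < n -> chunk w 1 = chunk (encw x) 1 ->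
  decw w z i = [:: b] -> b != nth false (encw x) i ->
  exists2 u, inner u & colliding (encw x) w u.
Proof.
move=> sx lti E1; rewrite /decw; case: ifP => // /andP[_ /allP Hp] [<-] {b}.
rewrite /out_bit E1 fp_chunk1 //.
case: ltnP => hF; first by rewrite nth_encw_fp ?eqxx.
case: ltnP => hi ne; last first.
  move: ne; rewrite -(subnKC hF) nth_encw_tree // nth_default ?eqxx // size_tree //.
  by move: hi; lia.
set v := node i.
have L0 : 0 < L.
  by move: hi; rewrite /tree_len; case: L => //; lia.
have m0 := leaves_gt0 L0.
have Ev : v = ((i - F) %/ L).+1 by rewrite /v /node hF.
have ltv : v < 2 * m.
  have : i - F < (2 * m - 1) * L by move: hi; rewrite /tree_len; lia.
  by rewrite -ltn_divLR // -Ev; lia.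
have vn : v <= n.
  by rewrite Ev; have := leq_div (i - F) L; have := fp_len_gt0; lia.
have Nv : chunk w v <> chunk (encw x) v.
  move=> E; case/eqP: ne; have := win_eqP E (ltn_pmod (i - F) L0).
  have -> // : F + (v - 1) * L + (i - F) %% L = i.
  by rewrite Ev subSS subn0 -addnA -divn_eq; lia.
case: (pselect (exists2 u, inner u & colliding (encw x) w u)) => // NC; exfalso.
have ancE d : 0 < v %/ 2 ^ d -> anc i d = v %/ 2 ^ d /\ d < lg.+1.
  move=> H; have le : 2 ^ d <= v by rewrite divn_gt0 ?expn_gt0 in H.
  rewrite /anc -/v (minn_idPl _); last lia.
  split=> //; rewrite ltnS; apply: trunc_log_max => //; lia.
(* Without a collision a difference at a node propagates to its parent, since an unchanged parent
   would be the common hash of different children. A differing node is never the root, so the next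
   ancestor index is again positive. *)
have key d : 0 < v %/ 2 ^ d /\ chunk w (v %/ 2 ^ d) <> chunk (encw x) (v %/ 2 ^ d).
  elim: d => [|d [H0 H]]; first by rewrite expn0 divn1; split=> //; rewrite Ev.
  have E : v %/ 2 ^ d.+1 = v %/ 2 ^ d %/ 2 by rewrite -divnMA expnSr.
  set y := v %/ 2 ^ d in E H0 H; rewrite E.
  have y1 : y <> 1 by move=> y1; apply: H; rewrite y1.
  have u0 : 0 < y %/ 2 by rewrite divn_gt0 //; lia.
  have yv : y <= v by apply: leq_div.
  have Iu : inner (y %/ 2) by rewrite /inner u0 /=; lia.
  split=> // Eu; apply: NC; exists (y %/ 2) => //.
  have u1 : 0 < v %/ 2 ^ d.+1 by rewrite E; exact: u0.
  have [Ea lta] := ancE d.+1 u1.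
  have := Hp d.+1; rewrite mem_iota => /(_ lta); rewrite Ea E Iu /= => /eqP Hh.
  apply/andP; split; last by rewrite Hh heap_encw // Eu.
  apply/eqP=> Ek; apply: H; apply: eq_win => k ltk.
  have -> : F + (y - 1) * L + k = F + (2 * (y %/ 2) - 1) * L + ((y %% 2) * L + k).
    have -> : y - 1 = 2 * (y %/ 2) - 1 + y %% 2 by lia.
    by rewrite mulnDl !addnA.
  apply/esym/(win_eqP Ek); have : y %% 2 < 2 by rewrite ltn_mod.
  by case: (y %% 2) => [|[|]] //=; lia.
(* At [d = v] the ancestor index is 0, a contradiction. *)
have [] := key v; rewrite divn_small //; exact: ltn_expl.
Qed.

Definition fp_wt (r : bits) : nat := \sum_(p < F) fp r p.

(** By linearity this is minimum relative distance at least 1/16. *)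
Definition good_matrix : Prop :=
  forall r, size r = L -> r != nseq L false -> F <= 16 * fp_wt r.

Definition xors (u v : bits) : bits := mkseq (fun k => nth false u k (+) nth false v k) L.

Lemma fp_xors u v p : fp (xors u v) p = fp u p (+) fp v p.
Proof.
rewrite /fp -big_split /=; apply: eq_bigr => k _.
by rewrite nth_mkseq //; case: (nth _ u _); case: (nth _ v _); case: (nth _ M _).
Qed.

Lemma hammingE u v : size u = size v ->
  hamming u v = \sum_(p < size u) (nth false u p != nth false v p).
Proof.
rewrite /hamming; elim: u v => [|a u IH] [|b v] //= => [_|[E]].
  by rewrite big_ord0.
by rewrite big_ord_recl /= IH.
Qed.

(** The encodings of the two roots differ on at least F/16 positions, and the channel can repair at
    most n/128 < F/32 of them. *)
Lemma many_bad_positions x w : good_matrix -> size x = m * L -> size w = n ->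
  128 * hamming (encw x) w <= n -> chunk w 1 != chunk (encw x) 1 ->
  F <= 32 * \sum_(p < F) (nth false w p != fp (chunk w 1) p).
Proof.
move=> gM sx sw Hh ne.
set B := \sum_(p < F) _.
have [le lt4 _] := fp_lenP.
have sF : \sum_(p < F) (nth false (encw x) p != nth false w p) <= hamming (encw x) w.
  rewrite hammingE ?size_encw ?sw //.
  rewrite -!(big_mkord xpredT (fun p => nat_of_bool (nth false (encw x) p != nth false w p))).
  by rewrite (@big_cat_nat _ _ _ F 0 n) //= leq_addr.
have nz : xors (chunk w 1) (chunk (encw x) 1) != nseq L false.
  apply: contra ne => /eqP E; apply/eqP/eq_win => k ltk.
  have := congr1 (fun s => nth false s k) E; rewrite nth_mkseq // nth_nseq ltk.
  rewrite /chunk !nth_win //.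
  by case: (nth _ w _); case: (nth _ (encw x) _).
have sxo : size (xors (chunk w 1) (chunk (encw x) 1)) = L by rewrite size_mkseq.
have := gM _ sxo nz.
have : fp_wt (xors (chunk w 1) (chunk (encw x) 1)) <= B + hamming (encw x) w.
  apply: leq_trans (leq_add (leqnn B) sF); rewrite /fp_wt /B -big_split /=.
  apply: leq_sum => p _; rewrite fp_xors (fp_chunk1 sx) nth_encw_fp //.
  by case: (fp _ _); case: (fp _ _); case: (nth _ w _).
move: (fp_wt _) (hamming _ _) B (F) Hh lt4 {sF} => W Hm B F' Hh lt4 le1 le2.
lia.
Qed.

End Code.

(** * The code in polynomial time *)

Definition sub (G' G : ctx) (pi : G' -> G) : Prop :=
  (forall x : G', dom x -> dom (pi x)) /\
  (forall x : G', dom x -> exists rest, enc x = enc (pi x) ++ rest).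

Lemma sub_id (G : ctx) : @sub G G id.
Proof. by split=> // x _; exists [::]; rewrite cats0. Qed.

Lemma sub_trans (G2 G1 G : ctx) (p2 : G2 -> G1) (p1 : G1 -> G) :
  sub p2 -> sub p1 -> sub (fun x => p1 (p2 x)).
Proof.
move=> [d2 e2] [d1 e1]; split=> x Dx; first by apply: d1; apply: d2.
have [r2 E2] := e2 x Dx; have [r1 E1] := e1 _ (d2 x Dx).
by exists (r1 ++ r2); rewrite E2 E1 catA.
Qed.

Lemma sub_lctx (G : ctx) (P : G -> nat -> bits -> Prop) :
  @sub (lctx P) G (fun p => p.1.1).
Proof. by split=> [x []//|x _]; exists [:: unary x.1.2; x.2]. Qed.

Lemma sub_icx (G : ctx) (N : G -> nat) : @sub (icx N) G (fun p => p.1).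
Proof. by split=> [x []//|x _]; exists [:: unary x.2]. Qed.

Lemma sub_ncx (G : ctx) (P : G -> nat -> nat -> Prop) :
  @sub (ncx P) G (fun p => p.1.1).
Proof. by split=> [x []//|x _]; exists [:: unary x.1.2; unary x.2]. Qed.

(** Stated for all extensions of the context, because hashing happens inside loops, where index and
    accumulator are additional stacks. *)
Definition hashable (G : ctx) (hs : G -> bits -> bits) : Prop :=
  forall (G' : ctx) (pi : G' -> G), sub pi ->
  forall f : G' -> bits, ptime f -> ptime (fun x => hs (pi x) (f x)).

Lemma hashable_sub (G' G : ctx) (pi : G' -> G) hs :
  sub pi -> hashable hs -> @hashable G' (fun x => hs (pi x)).
Proof. by move=> Hs Hh G2 p2 Hs2 f Hf; apply: Hh (sub_trans Hs2 Hs) _ Hf. Qed.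

Lemma hashable_app (G : ctx) hs (f : G -> bits) :
  hashable hs -> ptime f -> ptime (fun x => hs x (f x)).
Proof. by move=> Hh Hf; apply: (Hh _ id (sub_id G)). Qed.

Lemma ptime_win (G : ctx) (w : G -> bits) (a len : G -> nat) :
  ptime w -> ptn a -> ptn len -> ptime (fun x => win (w x) (a x) (len x)).
Proof.
move=> Hw Ha Hl.
apply: (ptime_mkseq (b := fun x i => nth false (w x) (a x + i)) Hl).
apply: ptb_nth; first exact: icx_weak.
by apply: ptn_add (icx_idx _); apply: (icx_weak _ Ha).
Qed.

Section Params.
Variable G : ctx.
Variables n e : G -> nat.
Hypotheses (Hn : ptn n) (He : ptn e).

Lemma ptn_lg : ptn (fun x => lg (n x)).
Proof. exact: ptn_log. Qed.

Lemma ptn_addr_len : ptn (fun x => addr_len (n x)).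
Proof. exact: ptn_pred ptn_lg. Qed.

Lemma ptn_samples : ptn (fun x => samples (n x)).
Proof. exact: ptn_exp ptn_lg. Qed.

Lemma ptn_fp_len : ptn (fun x => fp_len (n x)).
Proof.
apply: ptn_ext (ptn_exp2_min ptn_addr_len (ptn_succ Hn)) => x _.
rewrite (minn_idPl _) //; case: (posnP (n x)) => [->|n0].
  by rewrite /addr_len /lg trunc_log0.
by have [le _ _] := fp_lenP n0; rewrite leqW.
Qed.

Lemma ptn_chunk_len : ptn (fun x => chunk_len (n x) (e x)).
Proof. by apply: ptn_min => //; apply: ptn_div => //; apply: ptn_const. Qed.

Lemma ptn_leaves : ptn (fun x => leaves (n x) (e x)).
Proof.
have Hd := ptn_div Hn (ptn_const G 32).
apply: ptn_if (ptn_const _ 1); first exact: ptb_leq.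
by apply: ptn_div => //; apply: ptn_mul He; apply: ptn_const.
Qed.

Lemma ptn_tree_len : ptn (fun x => tree_len (n x) (e x)).
Proof.
apply: ptn_mul ptn_chunk_len; apply: ptn_sub (ptn_const _ 1).
by apply: ptn_mul ptn_leaves; apply: ptn_const.
Qed.

Lemma ptime_chunk (w : G -> bits) (u : G -> nat) : ptime w -> ptn u ->
  ptime (fun x => chunk (n x) (e x) (w x) (u x)).
Proof.
move=> Hw Hu; apply: ptime_win ptn_chunk_len => //.
apply: ptn_add ptn_fp_len _; apply: ptn_mul ptn_chunk_len.
exact: ptn_sub (ptn_const _ 1).
Qed.

Lemma ptime_kids (w : G -> bits) (u : G -> nat) : ptime w -> ptn u ->
  ptime (fun x => kids (n x) (e x) (w x) (u x)).
Proof.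
move=> Hw Hu; have H2 := ptn_const G 2.
apply: ptime_win => //; last exact: ptn_mul ptn_chunk_len.
apply: ptn_add ptn_fp_len _; apply: ptn_mul ptn_chunk_len.
by apply: ptn_sub (ptn_const _ 1); apply: ptn_mul.
Qed.

Lemma ptn_node (i : G -> nat) : ptn i -> ptn (fun x => node (n x) (e x) (i x)).
Proof.
move=> Hi; apply: ptn_if (ptn_const _ 1); first exact: ptb_leq ptn_fp_len Hi.
by apply: ptn_succ; apply: ptn_div ptn_chunk_len; apply: ptn_sub ptn_fp_len.
Qed.

Lemma ptn_anc (i d : G -> nat) : ptn i -> ptn d ->
  ptn (fun x => anc (n x) (e x) (i x) (d x)).
Proof.
move=> Hi Hd; apply: ptn_div; first exact: ptn_node.
by apply: ptn_exp2_min => //; apply: ptn_succ.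
Qed.

Lemma ptb_inner (u : G -> nat) : ptn u -> ptb (fun x => inner (n x) (e x) (u x)).
Proof.
move=> Hu; apply: ptb_and; first exact: ptb_ltn (ptn_const _ 0) Hu.
exact: ptb_ltn ptn_leaves.
Qed.

Lemma ptb_in_range (a len p : G -> nat) : ptn a -> ptn len -> ptn p ->
  ptb (fun x => in_range (a x) (len x) (p x)).
Proof.
move=> Ha Hl Hp; apply: ptb_and; first exact: ptb_leq.
by apply: ptb_ltn => //; apply: ptn_add.
Qed.

Lemma ptn_smp (z : G -> bits) (j : G -> nat) : ptime z -> ptn j ->
  ptn (fun x => smp (n x) (z x) (j x)).
Proof.
move=> Hz Hj; apply: (ptn_sum (h := fun x k =>
  nth false (z x) (j x * addr_len (n x) + k) * minn (2 ^ k) (n x)) ptn_addr_len).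
have Hi := @icx_idx G (fun x => addr_len (n x)).
apply: ptn_mul; last by apply: ptn_exp2_min => //; apply: (icx_weak _ Hn).
apply: ptb_nth; first exact: icx_weak.
apply: ptn_add => //; apply: ptn_mul; first exact: (icx_weak _ Hj).
exact: (icx_weak _ ptn_addr_len).
Qed.

Lemma ptb_fp (M r : G -> bits) (j : G -> nat) : ptime M -> ptime r -> ptn j ->
  ptb (fun x => fp (n x) (e x) (M x) (r x) (j x)).
Proof.
move=> HM Hr Hj.
apply: (ptb_xor (b := fun x k => nth false (r x) k &&
  nth false (M x) (j x * chunk_len (n x) (e x) + k)) ptn_chunk_len).
have Hi := @icx_idx G (fun x => chunk_len (n x) (e x)).
apply: ptb_and; apply: ptb_nth => //; try exact: icx_weak.
apply: ptn_add => //; apply: ptn_mul; first exact: (icx_weak _ Hj).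
exact: (icx_weak _ ptn_chunk_len).
Qed.

End Params.

Section CodeFunctions.
Variable G : ctx.
Variables n e : G -> nat.
Hypotheses (Hn : ptn n) (He : ptn e).
Variables M w z : G -> bits.
Hypotheses (HM : ptime M) (Hw : ptime w) (Hz : ptime z).
Variable i : G -> nat.
Hypothesis Hi : ptn i.
Variable hs : G -> bits -> bits.
Hypotheses (Hh : hashable hs) (hs_size : forall x y, dom x -> size (hs x y) = e x).

Lemma ptb_fp_test : ptb (fun x => fp_test (n x) (e x) (M x) (w x) (z x)).
Proof.
apply: (ptb_all (b := fun x j => nth false (w x) (smp (n x) (z x) j) ==
  fp (n x) (e x) (M x) (chunk (n x) (e x) (w x) 1) (smp (n x) (z x) j)) (ptn_samples Hn)).
have up (f : G -> bits) := @icx_weak G (fun x => samples (n x)) f.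
have Hs := ptn_smp (up _ Hn) (up _ Hz) (icx_idx _).
apply: ptb_eqb; first by apply: ptb_nth => //; apply: up.
apply: (ptb_fp (up _ Hn) (up _ He) (up _ HM)) => //.
by apply: (up _ (ptime_chunk Hn He Hw (ptn_const _ 1))).
Qed.

Lemma ptb_path_test : ptb (fun x => path_test (n x) (e x) (hs x) (w x) (i x)).
Proof.
apply: (ptb_all (b := fun x d => ~~ inner (n x) (e x) (anc (n x) (e x) (i x) d) ||
   (hs x (kids (n x) (e x) (w x) (anc (n x) (e x) (i x) d))
    == chunk (n x) (e x) (w x) (anc (n x) (e x) (i x) d))) (ptn_succ (ptn_lg Hn))).
have up (f : G -> bits) := @icx_weak G (fun x => (lg (n x)).+1) f.
have Hu := ptn_anc (up _ Hn) (up _ He) (up _ Hi) (icx_idx _).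
apply: ptb_or.
  by apply: ptb_not; apply: (ptb_inner (up _ Hn) (up _ He)).
apply: ptb_eqs; last exact: (ptime_chunk (up _ Hn) (up _ He) (up _ Hw)).
apply: (Hh (sub_icx _)).
exact: (ptime_kids (up _ Hn) (up _ He) (up _ Hw)).
Qed.

Lemma ptb_out_bit : ptb (fun x => out_bit (n x) (e x) (M x) (w x) (i x)).
Proof.
apply: ptb_if; first exact: ptb_ltn (ptn_fp_len Hn).
  by apply: ptb_fp => //; apply: ptime_chunk => //; apply: ptn_const.
apply: ptb_if (ptb_const _ false); last exact: ptb_nth.
by apply: ptb_ltn => //; apply: ptn_add; [exact: ptn_fp_len | exact: ptn_tree_len].
Qed.

Lemma ptime_bit (b : G -> bool) : ptb b -> ptime (fun x => [:: b x]).
Proof.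
move=> Hb; have H0 := ptime_nil G.
apply: ptime_ext (ptime_if Hb (ptime_push true H0) (ptime_push false H0)) => x _.
by case: (b x).
Qed.

Lemma ptime_decw : ptime (fun x => decw (n x) (e x) (hs x) (M x) (w x) (z x) (i x)).
Proof.
apply: ptime_if (ptime_nil _); last exact: ptime_bit ptb_out_bit.
exact: ptb_and ptb_fp_test ptb_path_test.
Qed.

Lemma ptime_mask : ptime (fun x => mkseq (maskp (n x) (e x) (z x) (i x)) (n x)).
Proof.
apply: (ptime_mkseq (b := fun x p => maskp (n x) (e x) (z x) (i x) p) Hn).
set G1 := icx n.
have up (f : G -> bits) : ptime f -> @ptime G1 (fun p => f p.1) by apply: icx_weak.
have Hp : @ptn G1 (fun p => p.2) by apply: icx_idx.
have HL := ptn_chunk_len (up _ Hn) (up _ He).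
have HF := ptn_fp_len (up _ Hn).
apply: ptb_or.
  apply: (@ptb_has G1 (fun x => samples (n x.1)) (fun x j => x.2 == smp (n x.1) (z x.1) j)).
    exact: (up _ (ptn_samples Hn)).
  set N1 := fun _ : G1 => _.
  have up1 (f : G1 -> bits) : ptime f -> @ptime (icx N1) (fun p => f p.1) by apply: icx_weak.
  apply: ptb_eqn; first exact: (up1 _ Hp).
  have Hs := ptn_smp (up1 _ (up _ Hn)) (up1 _ (up _ Hz)) (@icx_idx G1 N1); exact: Hs.
apply: ptb_or; first exact: ptb_in_range.
apply: ptb_or; first exact: ptb_eqn Hp (up _ Hi).
apply: (@ptb_has G1 (fun x => (lg (n x.1)).+1) (fun x d =>
  let u := anc (n x.1) (e x.1) (i x.1) d in
  inner (n x.1) (e x.1) u &&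
  (in_range (fp_len (n x.1) + (u - 1) * chunk_len (n x.1) (e x.1)) (chunk_len (n x.1) (e x.1)) x.2
   || in_range (fp_len (n x.1) + (2 * u - 1) * chunk_len (n x.1) (e x.1))
        (2 * chunk_len (n x.1) (e x.1)) x.2))).
  exact: (up _ (ptn_succ (ptn_lg Hn))).
set N1 := fun _ : G1 => _.
have up1 (f : G1 -> bits) : ptime f -> @ptime (icx N1) (fun p => f p.1) by apply: icx_weak.
have Hu := ptn_anc (up1 _ (up _ Hn)) (up1 _ (up _ He)) (up1 _ (up _ Hi)) (icx_idx _).
have c1 := ptn_const (icx N1) 1; have c2 := ptn_const (icx N1) 2.
have Hin := ptb_inner (up1 _ (up _ Hn)) (up1 _ (up _ He)) Hu.
apply: ptb_and; first exact: Hin.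
apply: ptb_or; apply: ptb_in_range (up1 _ Hp).
- apply: ptn_add; first exact: (up1 _ HF).
  by apply: ptn_mul (up1 _ HL); apply: ptn_sub.
- exact: (up1 _ HL).
- apply: ptn_add; first exact: (up1 _ HF).
  by apply: ptn_mul (up1 _ HL); apply: ptn_sub => //; apply: ptn_mul.
- by apply: ptn_mul (up1 _ HL).
Qed.

Lemma ptime_tree : ptime (fun x => tree (n x) (e x) (hs x) (w x)).
Proof.
have [T HT Bw] := ptime_size Hw; have [T1 HT1 Bm] := ptn_bound (ptn_leaves Hn He).
have [T2 HT2 Be] := ptn_bound He.
pose g (x : G) j acc := hs x (win acc ((leaves (n x) (e x) - 2 - j) * chunk_len (n x) (e x))
   (2 * chunk_len (n x) (e x))) ++ acc.
apply: (ptime_iteri (g := g) (B := fun m => T m + T1 m * T2 m)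
   (ptn_pred (ptn_leaves Hn He)) Hw).
- by pm_tac.
- move=> x j Dx le.
  (* Each stage adds exactly [e x] bits, which bounds the accumulator polynomially. *)
  have -> : size (iteri j (g x) (w x)) = size (w x) + j * e x.
    elim: j {le} => [|j IH] /=; first by rewrite addn0.
    by rewrite size_cat IH hs_size // mulSn; lia.
  rewrite leq_add ?Bw // leq_mul ?Be //.
  by apply: leq_trans le _; apply: leq_trans (leq_pred _) (Bm x Dx).
set G1 := itctx _ _ _.
have up (f : G -> bits) : ptime f -> @ptime G1 (fun p => f p.1.1) by apply: lctx_weak.
have Ha : @ptime G1 (fun p => p.2) by apply: lctx_acc.
have HL := up _ (ptn_chunk_len Hn He).
have c2 := ptn_const G1 2.
apply: ptime_cat => //; apply: (Hh (sub_lctx _)); apply: ptime_win => //.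
  apply: ptn_mul HL; apply: ptn_sub (lctx_idx _); apply: ptn_sub => //.
  exact: (up _ (ptn_leaves Hn He)).
by apply: ptn_mul HL.
Qed.

Lemma ptime_encw : ptime (fun x => encw (n x) (e x) (hs x) (M x) (w x)).
Proof.
apply: (ptime_mkseq (b := fun x p => if p < fp_len (n x)
   then fp (n x) (e x) (M x) (tree (n x) (e x) (hs x) (w x)) p
   else nth false (tree (n x) (e x) (hs x) (w x)) (p - fp_len (n x))) Hn).
have up (f : G -> bits) := @icx_weak G n f.
have Hp := @icx_idx G n.
have HF := up _ (ptn_fp_len Hn).
apply: ptb_if; first exact: ptb_ltn.
  by have Hf := ptb_fp (up _ Hn) (up _ He) (up _ HM) (up _ ptime_tree) Hp; exact: Hf.
by apply: ptb_nth (up _ ptime_tree) _; apply: ptn_sub.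
Qed.

Lemma ptn_find_col : ptn (fun x => find_col (n x) (e x) (hs x) (w x) (z x)).
Proof.
have Hm := ptn_leaves Hn He.
have [T1 HT1 Bm] := ptn_bound Hm.
pose g (x : G) u a := if (0 < u) && colliding (n x) (e x) (hs x) (w x) (z x) u then u else a.
have Bg x j : iteri j (g x) 0 <= j.
  by elim: j => //= j IH; rewrite /g; case: ifP => // _; apply: leqW.
apply: (ptn_iteri (g := g) Hm (ptn_const _ 0) HT1).
  by move=> x j Dx le; apply: leq_trans (Bg x j) (leq_trans le (Bm x Dx)).
set G1 := ncx _.
have up (f : G -> bits) : ptime f -> @ptime G1 (fun p => f p.1.1) by apply: ncx_weak.
have Hu : @ptn G1 (fun p => p.1.2).
  apply: (@ncx_icx G (fun x => leaves (n x) (e x)) _ (fun p => unary p.2) _ (icx_idx _)).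
  by move=> x j a [].
have Hk := ptime_kids (up _ Hn) (up _ He) (up _ Hw) Hu.
have Hk' := ptime_kids (up _ Hn) (up _ He) (up _ Hz) Hu.
apply: (ptn_if _ Hu (ncx_acc _)).
apply: ptb_and; first exact: ptb_ltn (ptn_const _ 0) Hu.
apply: ptb_and; first by apply: ptb_not; apply: ptb_eqs.
by apply: ptb_eqs; apply: (Hh (sub_ncx _)).
Qed.

End CodeFunctions.

(** Padding with [false] makes this total, so any tape can be turned into coins of the required
    type. *)
Definition pre (k : nat) (r : bits) : k.-tuple bool := [tuple nth false r i | i < k].

Lemma preE k r : k <= size r -> pre k r = take k r :> bits.
Proof.
move=> le; apply: (@eq_from_nth _ false).
  by rewrite size_tuple size_takel.
move=> i; rewrite size_tuple => lt.
by rewrite -(tnth_nth _ _ (Ordinal lt)) tnth_mktuple nth_take.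
Qed.

Lemma pre_val k (t : k.-tuple bool) e : pre k (t ++ e) = t.
Proof.
apply: val_inj; rewrite /= preE ?size_cat ?size_tuple ?leq_addr //.
by rewrite take_size_cat ?size_tuple.
Qed.

Lemma nat_of_bits_bin_rec f m : m <= f -> nat_of_bits (bin_rec f m) = m.
Proof.
elim: f m => [|f IH] m /=; first by rewrite leqn0 => /eqP.
case: eqP => [->//|m0] le /=; rewrite IH ?odd_double_half //.
by rewrite -ltnS (leq_trans _ le) // ltn_half_double -addnn; lia.
Qed.

Lemma nat_of_bits_bin m : nat_of_bits (bin m) = m.
Proof. exact: nat_of_bits_bin_rec. Qed.

Lemma size_bin m : size (bin m) <= m.
Proof.
suff gen f k : size (bin_rec f k) <= f by exact: gen.
by elim: f k => [|f IH] k //=; case: eqP => //= _; apply: IH.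
Qed.

Lemma nat_of_bitsE u : nat_of_bits u = \sum_(k < size u) nth false u k * 2 ^ k.
Proof.
elim: u => [|b u IH]; first by rewrite big_ord0.
rewrite big_ord_recl /= muln1 IH; congr (_ + _).
rewrite -muln2 big_distrl; apply: eq_bigr => k _ /=.
by rewrite /bump /= ?add1n expnSr mulnA.
Qed.

(** Conversion from binary to unary is polynomial only under a bound on the value. *)
Lemma ptn_nat_of_bits (G : ctx) (f : G -> bits) (N : G -> nat) :
  ptime f -> ptn N -> (forall x, dom x -> nat_of_bits (f x) <= N x) ->
  ptn (fun x => nat_of_bits (f x)).
Proof.
move=> Hf HN le.
have Hs := ptn_size Hf.
have H : ptn (fun x => \sum_(k < size (f x)) nth false (f x) k * minn (2 ^ k) (N x)).
  apply: (ptn_sum (h := fun x k => nth false (f x) k * minn (2 ^ k) (N x)) Hs).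
  have Hi := @icx_idx G (fun x => size (f x)).
  apply: ptn_mul; first by apply: ptb_nth => //; apply: icx_weak.
  by apply: ptn_exp2_min => //; apply: (icx_weak _ HN).
apply: ptn_ext H => x Dx; rewrite nat_of_bitsE; apply: eq_bigr => k _.
case E: (nth _ _ _) => //; rewrite (minn_idPl _) //.
apply: leq_trans (le x Dx); rewrite nat_of_bitsE (bigD1 k) //= E mul1n.
exact: leq_addr.
Qed.

(** * Programs of the generator, the encoder and the decoder *)

Section Construction.
Variables (ell : nat -> nat) (GenH : alg) (H : bits -> bits -> bits) (n : nat -> nat).
Hypotheses (genP : seed_generator GenH) (hashP : hash_computable GenH H).
Hypothesis ellP : forall l (rG : coins GenH l) x, size (H (seed rG) x) = ell l.
Hypotheses (n_gt0 : forall l, 0 < n l) (n_len : polytime_length n).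
Variables cG cn : nat.
Hypotheses (clockG : forall l, clock GenH l <= l ^ cG + cG)
  (n_poly : forall l, n l <= l ^ cn + cn).

Definition mlen l := n l * n l.
(** A computable bound on the clock of [GenH], which need not be computable itself. *)
Definition glen l := l ^ cG + cG.
(** The hash program is specified only on seeds in the range of the generator. *)
Definition valid l s := exists rG : coins GenH l, s = seed rG.
Definition msg l := leaves (n l) (ell l) * chunk_len (n l) (ell l).
Definition ncoins l := samples (n l) * addr_len (n l).

Lemma gen_long l r : clock GenH l <= size r ->
  halts GenH l [::] [:: unary l] r /\
  output GenH l [::] [:: unary l] r 0 = seed (pre (clock GenH l) r).
Proof.
move=> le.
have := halts_output_cat (drop (clock GenH l) r) (genP.2 l (pre (clock GenH l) r)).
rewrite preE // cat_take_drop => -[Hh /(_ 0) ->]; split=> //.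
by rewrite /seed preE.
Qed.

Lemma valid_long l r : glen l <= size r ->
  valid l (output GenH l [::] [:: unary l] r 0).
Proof.
move=> le; have [|_ ->] := @gen_long l r; first exact: leq_trans (clockG l) le.
by exists (pre (clock GenH l) r).
Qed.

Lemma valid_size l s : valid l s -> size s <= l + glen l.
Proof.
move=> [rG ->]; have [t [sg [r' [q' [le E F]]]]] := halts_ev (genP.2 l rG).
rewrite /seed /output F /=; apply: leq_trans (ev_size 0 E) _.
by rewrite /= size_nseq leq_add2l; apply: leq_trans le (clockG l).
Qed.

Lemma valid_ell l s x : valid l s -> size (H s x) = ell l.
Proof. by move=> [rG ->]; apply: ellP. Qed.

Lemma hashable_seed (G : ctx) (l : G -> nat) (s : G -> bits) :
  ptn l -> ptime s -> (forall x, dom x -> valid (l x) (s x)) ->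
  hashable (fun x => H (s x)).
Proof.
move=> Hl Hs Hv G' pi [Hd He] f Hf.
have [h [ph hP]] := hashP.
have Hl' : ptn (fun x => l (pi x)) by apply: (ptime_weak Hd He Hl).
have Hs' : ptime (fun x => s (pi x)) by apply: (ptime_weak Hd He Hs).
have [T HT BT] := ptn_bound (ptn_add Hl' (ptn_size Hf)).
have Hi := ptimes_cons Hl' (ptimes_cons Hs' (ptimes_cons Hf (ptimes_nil G'))).
have key x : dom x ->
    halts h (l (pi x) + size (f x)) [::] [:: unary (l (pi x)); s (pi x); f x] [::] /\
    output h (l (pi x) + size (f x)) [::] [:: unary (l (pi x)); s (pi x); f x] [::] 0
      = H (s (pi x)) (f x).
  by move=> Dx; have [rG ->] := Hv _ (Hd x Dx); apply: hP.
apply: ptime_ext (ptime_alg 0 ph Hi (ptime_nil G') HT BT _) => x Dx.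
  by have [_ ->] := key x Dx.
by have [] := key x Dx.
Qed.

Lemma ptn_n (G : ctx) (l : G -> nat) : ptn l -> ptn (fun x => n (l x)).
Proof.
move=> Hl; have [a [pa aP]] := n_len.
have [T HT BT] := ptn_bound Hl.
have Hi := ptimes_cons Hl (ptimes_nil G).
apply: ptime_ext (ptime_alg 0 pa Hi (ptime_nil G) HT BT _) => x Dx.
  by have [_ ->] := aP (l x).
by have [] := aP (l x).
Qed.

Lemma ptn_poly (G : ctx) (l : G -> nat) c : ptn l -> ptn (fun x => l x ^ c + c).
Proof. by move=> Hl; apply: ptn_add (ptn_const _ _); apply: ptn_exp. Qed.

Lemma ptn_mlen (G : ctx) (l : G -> nat) : ptn l -> ptn (fun x => mlen (l x)).
Proof. by move=> Hl; apply: ptn_mul; apply: ptn_n. Qed.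

Lemma ptime_gen (G : ctx) (l : G -> nat) (r : G -> bits) : ptn l -> ptime r ->
  (forall x, dom x -> glen (l x) <= size (r x)) ->
  ptime (fun x => output GenH (l x) [::] [:: unary (l x)] (r x) 0).
Proof.
move=> Hl Hr le; have [T HT BT] := ptn_bound Hl.
have Hi := ptimes_cons Hl (ptimes_nil G).
apply: (ptime_alg 0 genP.1 Hi Hr HT BT) => x Dx.
have [|//] := @gen_long (l x) (r x).
exact: leq_trans (clockG _) (le x Dx).
Qed.

Lemma ptime_nseq0 (G : ctx) (N : G -> nat) : ptn N -> ptime (fun x => nseq (N x) false).
Proof.
move=> HN; have := ptime_mkseq (b := fun _ _ => false) HN (ptb_const _ false).
apply: ptime_ext => x _; apply: (@eq_from_nth _ false); rewrite size_nseq ?size_mkseq // => i lt.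
by rewrite nth_mkseq // nth_nseq if_same.
Qed.

(** Computability of [ell] is not assumed. It is computed as the length of a hash of the empty
    string, under the seed generated from all-zero coins. *)
Lemma ptn_ell (G : ctx) (l : G -> nat) : ptn l -> ptn (fun x => ell (l x)).
Proof.
move=> Hl.
pose s0 k := output GenH k [::] [:: unary k] (nseq (glen k) false) 0.
have Hs : ptime (fun x => s0 (l x)).
  apply: ptime_gen => // [|x _]; last by rewrite size_nseq.
  by apply: ptime_nseq0; apply: ptn_poly.
have Hv x : valid (l x) (s0 (l x)) by apply: valid_long; rewrite size_nseq.
have Hh := hashable_seed Hl Hs (fun x _ => Hv x).
apply: ptn_ext (ptn_size (hashable_app Hh (ptime_nil G))) => x _.
by rewrite (valid_ell _ (Hv x)).
Qed.

Lemma ptn_msg (G : ctx) (l : G -> nat) : ptn l -> ptn (fun x => msg (l x)).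
Proof.
move=> Hl; have Hn := ptn_n Hl; have He := ptn_ell Hl.
exact: ptn_mul (ptn_leaves Hn He) (ptn_chunk_len Hn He).
Qed.

Lemma msg_le l : msg l <= n l.
Proof.
have := tree_lenP (n l) (ell l); rewrite /tree_len /msg.
have := layout (ell l) (n_gt0 l); rewrite /tree_len.
case: (leaves _ _) => [|k]; first by lia.
have /leq_mul/(_ (leqnn (chunk_len (n l) (ell l)))) : k.+1 <= 2 * k.+1 - 1 by lia.
by lia.
Qed.

Definition gctx : ctx := @Ctx nat (fun _ => True) 1 (fun l => [:: unary l]) (fun _ => erefl).

Lemma gctx_l : @ptn gctx id.
Proof. exact: (@ptime_var gctx 0). Qed.

Lemma det_alg (G : ctx) (f : G -> bits) (l : G -> nat) (P : nat -> nat) :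
  0 < ar G -> ptime f -> pm P -> (forall x : G, dom x -> tsz (enc x) <= P (l x)) ->
  exists a : alg, polytime a /\ forall x : G, dom x ->
    halts a (l x) [::] (enc x) [::] /\ output a (l x) [::] (enc x) [::] 0 = f x.
Proof.
move=> k0 Hf HP Hl.
pose N (x : G) := 0; pose mask (p : tcx N) : bits := [::].
have Hf' : @ptime (qcx mask) (fun p => f p.1.1) by exact: (qcx_weak mask (tcx_weak N Hf)).
have [a [pa _ aP]] := build_alg k0 (ptn_const _ 0) (ptime_nil _) Hf' (ptime_nil _) HP Hl.
exists a; split=> // x Dx; have [_ /(_ [::] [::] isT)] := aP x Dx.
by case=> sg [E E0 _]; rewrite /halts /output E.
Qed.

Lemma msg_polytime : polytime_length msg.
Proof.
have [||a [pa aP]] := @det_alg gctx _ id _ _ (ptn_msg gctx_l) pm_id => //.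
  by move=> l _; rewrite /tsz /= size_nseq addn0.
by exists a; split=> // l; apply: (aP l).
Qed.

Lemma gen_alg : exists a : alg, [/\ polytime a, forall l, mlen l + glen l <= clock a l
  & forall l r, mlen l + glen l <= size r ->
    halts a l [::] [:: unary l] r /\
    output a l [::] [:: unary l] r 0
      = take (mlen l) r ++ seed (pre (clock GenH l) (drop (mlen l) r))].
Proof.
pose N (l : gctx) := mlen l + glen l; pose mask (p : tcx N) : bits := [::].
have HN : ptn N by apply: ptn_add; [apply: ptn_mlen gctx_l | apply: ptn_poly gctx_l].
have Hl : @ptn (tcx N) (fun p => p.1) by apply: (tcx_weak _ gctx_l).
have Hm := ptn_mlen Hl.
have Hz := @tcx_coins gctx N.
have Hs : @ptime (tcx N) (fun p => take (mlen p.1) p.2 ++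
    output GenH p.1 [::] [:: unary p.1] (drop (mlen p.1) p.2) 0).
  apply: ptime_cat; first exact: ptime_take.
  apply: (ptime_gen Hl); first exact: ptime_drop.
  by move=> [l z] /= [_ E]; rewrite size_drop E addKn.
have [|a [pa _ aP]] := @build_alg gctx N mask _ _ id id isT HN (ptime_nil _)
   (qcx_weak _ Hs) (ptime_nil _) pm_id.
  by move=> l _; rewrite /tsz /= size_nseq addn0.
exists a; split=> // [l|l r le]; first by have [] := aP l I.
have [_ /(_ [::] r le)[sg [E E0 _]]] := aP l I.
rewrite /halts /output E /= E0; split=> //=; congr (_ ++ _).
  by rewrite take_takel // leq_addr.
have s1 : size (drop (mlen l) (take (N l) r)) = glen l by rewrite size_drop size_takel ?addKn.
have [|_ ->] := @gen_long l (drop (mlen l) (take (N l) r)); first by rewrite s1.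
congr seed; apply: val_inj; rewrite /= !preE ?s1 ?size_drop //.
- by rewrite /N addnC -take_drop take_takel //; exact: clockG.
- by apply: leq_trans (clockG l) _; rewrite -/(glen l); lia.
Qed.

(** Summands: the unary parameter, the matrix, the hash seed, and the message or index. *)
Lemma bound_pm : pm (fun l => l + ((l ^ cn + cn) * (l ^ cn + cn) + (l + (l ^ cG + cG)))
   + (l ^ cn + cn)).
Proof.
have Hp c : pm (fun l => l ^ c + c) by apply: pm_add (pm_const _); apply: pm_pow pm_id.
by repeat first [exact: pm_id | exact: Hp | apply: pm_add | apply: pm_mul].
Qed.

Lemma size_seed l (M s : bits) : size M = mlen l -> valid l s ->
  size (M ++ s) <= (l ^ cn + cn) * (l ^ cn + cn) + (l + (l ^ cG + cG)).
Proof.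
move=> sM Hv; rewrite size_cat sM leq_add ?valid_size // leq_mul ?n_poly //.
Qed.

Lemma enc_alg : exists a : alg, polytime a /\ forall l M s x,
  valid l s -> size M = mlen l -> size x = msg l ->
  halts a l [::] [:: unary l; M ++ s; x] [::] /\
  output a l [::] [:: unary l; M ++ s; x] [::] 0 = encw (n l) (ell l) (H s) M x.
Proof.
pose G := @Ctx (nat * bits * bits * bits)%type
  (fun p => [/\ valid p.1.1.1 p.1.2, size p.1.1.2 = mlen p.1.1.1 & size p.2 = msg p.1.1.1]) 3
  (fun p => [:: unary p.1.1.1; p.1.1.2 ++ p.1.2; p.2]) (fun _ => erefl).
have Hl : @ptn G (fun p => p.1.1.1) by apply: (@ptime_var G 0).
have H1 : @ptime G (fun p => p.1.1.2 ++ p.1.2) by apply: (@ptime_var G 1).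
have Hx : @ptime G (fun p => p.2) by apply: (@ptime_var G 2).
have Hm := ptn_mlen Hl.
have HM : @ptime G (fun p => p.1.1.2).
  by apply: ptime_ext (ptime_take H1 Hm) => p [_ E _]; rewrite -E take_size_cat.
have Hs : @ptime G (fun p => p.1.2).
  by apply: ptime_ext (ptime_drop H1 Hm) => p [_ E _]; rewrite -E drop_size_cat.
have Hh : @hashable G (fun p => H p.1.2).
  by apply: (hashable_seed Hl Hs) => p [].
have Hsz (p : G) y : dom p -> size (H p.1.2 y) = ell p.1.1.1.
  by move=> [Hv _ _]; apply: valid_ell.
have He := ptime_encw (ptn_n Hl) (ptn_ell Hl) HM Hx Hh Hsz.
have [||a [pa aP]] := @det_alg G _ (fun p => p.1.1.1) _ _ He bound_pm => //.
  move=> [[[l M] s] x] [/= Hv sM sx]; rewrite !tsz_cons tsz_nil addn0 size_nseq addnA.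
  rewrite !leq_add ?size_seed // sx; exact: leq_trans (msg_le l) (n_poly l).
exists a; split=> // l M s x Hv sM sx.
exact: (aP (l, M, s, x)).
Qed.

Lemma dec_alg : exists a : alg, [/\ polytime a, forall l, ncoins l <= clock a l
  & forall l M s i w r, valid l s -> size M = mlen l -> i < n l -> size w = n l ->
    ncoins l <= size r ->
    exists sg q, [/\ final a l w [:: unary l; M ++ s; bin i] r
        = Conf [::] sg (drop (ncoins l) r) q,
      q <= nqueries (n l) (ell l)
    & sg 0 = decw (n l) (ell l) (H s) M w (take (ncoins l) r) i]].
Proof.
pose G := @Ctx (nat * bits * bits * nat)%type
  (fun p => [/\ valid p.1.1.1 p.1.2, size p.1.1.2 = mlen p.1.1.1 & p.2 < n p.1.1.1]) 3
  (fun p => [:: unary p.1.1.1; p.1.1.2 ++ p.1.2; bin p.2]) (fun _ => erefl).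
have Hl : @ptn G (fun p => p.1.1.1) by apply: (@ptime_var G 0).
have H1 : @ptime G (fun p => p.1.1.2 ++ p.1.2) by apply: (@ptime_var G 1).
have Hb : @ptime G (fun p => bin p.2) by apply: (@ptime_var G 2).
have Hm := ptn_mlen Hl; have Hn := ptn_n Hl; have He := ptn_ell Hl.
have Hi : @ptn G (fun p => p.2).
  apply: ptn_ext (ptn_nat_of_bits Hb Hn _) => p [_ _ lt]; rewrite nat_of_bits_bin //.
  exact: ltnW.
have HM : @ptime G (fun p => p.1.1.2).
  by apply: ptime_ext (ptime_take H1 Hm) => p [_ E _]; rewrite -E take_size_cat.
have Hs : @ptime G (fun p => p.1.2).
  by apply: ptime_ext (ptime_drop H1 Hm) => p [_ E _]; rewrite -E drop_size_cat.
have Hh : @hashable G (fun p => H p.1.2).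
  by apply: (hashable_seed Hl Hs) => p [].
pose N (p : G) := ncoins p.1.1.1.
have HN : ptn N by apply: ptn_mul; [apply: ptn_samples | apply: ptn_addr_len].
pose mask (p : tcx N) : bits :=
  mkseq (maskp (n p.1.1.1.1) (ell p.1.1.1.1) p.2 p.1.2) (n p.1.1.1.1).
have up (f : G -> bits) : ptime f -> @ptime (tcx N) (fun p => f p.1) by apply: tcx_weak.
have Hmask : ptime mask.
  by have Q := ptime_mask (up _ Hn) (up _ He) (tcx_coins N) (up _ Hi); exact: Q.
have up2 (f : G -> bits) : ptime f -> @ptime (qcx mask) (fun p => f p.1.1).
  by move=> Hf; exact: (qcx_weak mask (up _ Hf)).
have sub2 : @sub (qcx mask) G (fun p => p.1.1).
  split=> [p [[]]//|p _]; exists ([:: [::]; rev p.1.2] ++ [:: [::]; [::]; [::]; rev p.2; [::]]).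
  by [].
have Hd := ptime_decw (up2 _ Hn) (up2 _ He) (up2 _ HM) (qcx_answers mask)
  (qcx_weak mask (tcx_coins N)) (up2 _ Hi) (hashable_sub sub2 Hh).
have [|a [pa _ aP]] := @build_alg G N mask _ _ (fun p => p.1.1.1) _ isT HN Hmask Hd
   (ptime_nil _) bound_pm.
  move=> [[[l M] s] i] [/= Hv sM lti]; rewrite !tsz_cons tsz_nil addn0 size_nseq addnA.
  rewrite !leq_add ?size_seed //; apply: leq_trans (size_bin i) _.
  exact: leq_trans (ltnW lti) (n_poly l).
exists a; split=> // [l|l M s i w r Hv sM lti sw le].
  (* [build_alg] compares coins and clock only at inputs satisfying the promise, so one such input
     is exhibited. *)
  pose s0 := output GenH l [::] [:: unary l] (nseq (glen l) false) 0.
  have V0 : valid l s0 by apply: valid_long; rewrite size_nseq.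
  have D0 : @dom G (l, nseq (mlen l) false, s0, 0) by split=> //=; rewrite ?size_nseq.
  by have [] := aP _ D0.
have D0 : @dom G (l, M, s, i) by [].
have [_ /(_ w r le)[sg [E E0 _]]] := aP _ D0.
exists sg, (count id (mask (l, M, s, i, take (N (l, M, s, i)) r))); split=> //.
  exact: count_mask.
by rewrite E0 /= {1}/mask size_mkseq decw_masked.
Qed.

End Construction.

(** * The collision finder *)

Section Adversary.
Variables (ell : nat -> nat) (GenH : alg) (H : bits -> bits -> bits) (n : nat -> nat).
Hypotheses (genP : seed_generator GenH) (hashP : hash_computable GenH H).
Hypothesis ellP : forall l (rG : coins GenH l) x, size (H (seed rG) x) = ell l.
Hypothesis n_len : polytime_length n.
Variable cG : nat.
Hypothesis clockG : forall l, clock GenH l <= l ^ cG + cG.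
Variables (ch co : alg) (c1 c2 : nat).
Hypotheses (ch_poly : polytime ch) (co_poly : polytime co).

Definition adv_msg l (M s r1 : bits) j := output ch l [::] [:: unary l; M ++ s] r1 j.
Definition adv_cw l (M s r1 : bits) :=
  encw (n l) (ell l) (H s) M (adv_msg l M s r1 0).
Definition adv_ins l (M s r1 : bits) :=
  [:: unary l; M ++ s; adv_msg l M s r1 1; adv_cw l M s r1].
Definition adv_word l (M s r1 r2 : bits) := output co l [::] (adv_ins l M s r1) r2 0.

Hypothesis chP : forall l M s r1, valid GenH l s -> size M = mlen n l ->
  l ^ c1 + c1 <= size r1 -> halts ch l [::] [:: unary l; M ++ s] r1.
Hypothesis coP : forall l M s r1 r2, valid GenH l s -> size M = mlen n l ->
  l ^ c1 + c1 <= size r1 -> l ^ c2 + c2 <= size r2 ->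
  halts co l [::] (adv_ins l M s r1) r2.

Definition adv_coins l := mlen n l + ((l ^ c1 + c1) + (l ^ c2 + c2)).

(** The reduction draws the matrix itself, plays the round with the channel on consecutive blocks of
    its coins, and outputs the children of the node found by [find_col] in both words. Nothing is
    claimed here about success; that is the event [caught]. *)
Lemma adv_alg : exists a : alg, [/\ polytime a,
   exists c, a = Alg (prog a) (fun m => m ^ c + c) &
   forall l s, valid GenH l s -> adv_coins l <= clock a l /\
   forall r, adv_coins l <= size r ->
   let M := take (mlen n l) r in
   let r1 := take (l ^ c1 + c1) (drop (mlen n l) r) in
   let r2 := take (l ^ c2 + c2) (drop (mlen n l + (l ^ c1 + c1)) r) in
   let c := adv_cw l M s r1 in
   let w := adv_word l M s r1 r2 in
   let u := find_col (n l) (ell l) (H s) c w in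
   [/\ halts a l [::] [:: unary l; s] r,
       output a l [::] [:: unary l; s] r 0 = kids (n l) (ell l) c u
     & output a l [::] [:: unary l; s] r 1 = kids (n l) (ell l) w u]].
Proof.
pose G := @Ctx (nat * bits)%type (fun p => valid GenH p.1 p.2) 2
  (fun p => [:: unary p.1; p.2]) (fun _ => erefl).
have Hl0 : @ptn G (fun p => p.1) by apply: (@ptime_var G 0).
have Hs0 : @ptime G (fun p => p.2) by apply: (@ptime_var G 1).
have Hm0 := ptn_mlen n_len Hl0.
pose N (p : G) := adv_coins p.1.
have HN : ptn N.
  by apply: ptn_add Hm0 _; apply: ptn_add; apply: ptn_poly.
pose G1 := tcx N.
have up (f : G -> bits) : ptime f -> @ptime G1 (fun p => f p.1) by apply: tcx_weak.
have Hl : @ptn G1 (fun p => p.1.1) by apply: (up _ Hl0).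
have Hs : @ptime G1 (fun p => p.1.2) by apply: (up _ Hs0).
have Hm := ptn_mlen n_len Hl.
have Hp1 := ptn_poly c1 Hl; have Hp2 := ptn_poly c2 Hl.
have Hz := @tcx_coins G N.
pose M (p : G1) := take (mlen n p.1.1) p.2.
pose r1 (p : G1) := take (p.1.1 ^ c1 + c1) (drop (mlen n p.1.1) p.2).
pose r2 (p : G1) := drop (mlen n p.1.1 + (p.1.1 ^ c1 + c1)) p.2.
have HM : ptime M by apply: ptime_take.
have Hr1 : ptime r1 by apply: ptime_take Hp1; apply: ptime_drop.
have Hr2 : ptime r2 by apply: ptime_drop => //; apply: ptn_add.
have Hd (p : G1) : dom p -> [/\ valid GenH p.1.1 p.1.2, size (M p) = mlen n p.1.1,
    p.1.1 ^ c1 + c1 <= size (r1 p) & p.1.1 ^ c2 + c2 <= size (r2 p)].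
  case: p => [[l s] z] [/= Hv E]; rewrite /M /r1 /r2 /=; split=> //.
  - by rewrite size_takel // E leq_addr.
  - by rewrite size_takel // size_drop E addKn leq_addr.
  - by rewrite size_drop E /N /adv_coins /= addnA addKn.
have [T HT BT] := ptn_bound Hl.
have Hs' := ptime_cat HM Hs.
have Hi1 := ptimes_cons Hl (ptimes_cons Hs' (ptimes_nil G1)).
have Hch j : @ptime G1 (fun p => adv_msg p.1.1 (M p) p.1.2 (r1 p) j).
  apply: (ptime_alg j ch_poly Hi1 Hr1 HT BT) => p /Hd[Hv sM s1 _].
  exact: chP.
have Hh : @hashable G1 (fun p => H p.1.2).
  by apply: (hashable_seed hashP Hl Hs) => p /Hd[].
have Hsz (p : G1) y : dom p -> size (H p.1.2 y) = ell p.1.1.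
  by move=> /Hd[Hv _ _ _]; apply: (valid_ell ellP).
have Hn := ptn_n n_len Hl; have He := ptn_ell genP hashP ellP clockG Hl.
have Hc : @ptime G1 (fun p => adv_cw p.1.1 (M p) p.1.2 (r1 p)).
  exact: (ptime_encw Hn He HM (Hch 0) Hh Hsz).
have Hi2 := ptimes_cons Hl (ptimes_cons Hs' (ptimes_cons (Hch 1) (ptimes_cons Hc (ptimes_nil G1)))).
have Hw : @ptime G1 (fun p => adv_word p.1.1 (M p) p.1.2 (r1 p) (r2 p)).
  apply: (ptime_alg 0 co_poly Hi2 Hr2 HT BT) => p /Hd[Hv sM s1 s2].
  exact: coP.
have Hu := ptn_find_col Hn He Hc Hw Hh.
have Hk1 := ptime_kids Hn He Hc Hu; have Hk2 := ptime_kids Hn He Hw Hu.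
pose mask (p : G1) : bits := [::].
have [|a [pa ca aP]] := @build_alg G N mask _ _ (fun p => p.1) _ isT HN (ptime_nil _)
   (qcx_weak mask Hk1) (qcx_weak mask Hk2) (bound_pm cG 0).
  move=> [l s] /= Hv; rewrite !tsz_cons tsz_nil addn0 size_nseq.
  by have := valid_size genP clockG Hv; rewrite /glen; lia.
exists a; split=> // l s Hv.
have [le {}aP] := aP (l, s) Hv; split=> // r ler.
have [sg [E E0 E1]] := aP [::] r ler.
have EM : take (mlen n l) (take (N (l, s)) r) = take (mlen n l) r.
  by rewrite take_takel // leq_addr.
have Er1 : r1 (l, s, take (N (l, s)) r) = take (l ^ c1 + c1) (drop (mlen n l) r).
  rewrite /r1 /= /N /adv_coins /= [mlen n l + _]addnC -take_drop take_takel //.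
  exact: leq_addr.
have Er2 : r2 (l, s, take (N (l, s)) r)
   = take (l ^ c2 + c2) (drop (mlen n l + (l ^ c1 + c1)) r).
  have -> : N (l, s) = l ^ c2 + c2 + (mlen n l + (l ^ c1 + c1)) by rewrite /N /adv_coins /=; lia.
  by rewrite take_drop.
rewrite /M /= Er1 Er2 EM in E0 E1.
by rewrite /halts /output E.
Qed.

End Adversary.

(** * Probability *)

Import Order.TTheory GRing.Theory Num.Theory.

Section Probability.
Variable R : realType.
Implicit Types T : finType.

Lemma prob_ge0 T (E : pred T) : (0 <= prob R T E)%R.
Proof. by rewrite /prob divr_ge0. Qed.

Lemma prob_le1 T (E : pred T) : (prob R T E <= 1)%R.
Proof.
rewrite /prob; case: (posnP #|T|) => [->|T0]; first by rewrite invr0 mulr0 ler01.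
by rewrite ler_pdivrMr ?ltr0n // mul1r ler_nat max_card.
Qed.


Lemma prob_sub T (E E' : pred T) : subpred E E' -> (prob R T E <= prob R T E')%R.
Proof.
move=> H; rewrite /prob ler_wpM2r ?invr_ge0 // ler_nat.
by apply: subset_leq_card; apply/subsetP=> x; apply: H.
Qed.

Lemma eq_prob T (E E' : pred T) : E =1 E' -> prob R T E = prob R T E'.
Proof. by move=> H; rewrite /prob (eq_card H). Qed.

Lemma prob_or T (E E' : pred T) :
  (prob R T (fun x => E x || E' x) <= prob R T E + prob R T E')%R.
Proof.
rewrite /prob -mulrDl -natrD ler_wpM2r ?invr_ge0 // ler_nat.
by rewrite -cardUI leq_addr.
Qed.

(** All fibres have the same size, so the uniform distribution is mapped to the uniform one. This
    compares experiments that use different coin spaces. *)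
Definition balanced T1 T2 (f : T1 -> T2) : Prop :=
  forall y, #|[pred x | f x == y]| * #|T2| = #|T1|.

Lemma balanced_card T1 T2 (f : T1 -> T2) (E : pred T2) : balanced f ->
  #|[pred x | E (f x)]| * #|T2| = #|E| * #|T1|.
Proof.
move=> Hf.
have -> : #|[pred x | E (f x)]| = \sum_(y | E y) #|[pred x | f x == y]|.
  rewrite -[LHS]sum1_card (partition_big f E) //=; apply: eq_bigr => y Ey.
  rewrite -sum1_card; apply: eq_bigl => x.
  by rewrite !inE; case: eqP => [->|]; rewrite ?Ey ?andbF.
rewrite big_distrl /= (eq_bigr (fun _ => #|T1|)); last by move=> y _; apply: Hf.
by rewrite sum_nat_cond_const; congr (_ * _); apply: eq_card => y; rewrite inE.
Qed.

Lemma balanced_prob T1 T2 (f : T1 -> T2) (E : pred T2) : 0 < #|T1| -> balanced f ->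
  prob R T1 (fun x => E (f x)) = prob R T2 E.
Proof.
move=> T0 Hf; have H := balanced_card E Hf.
have T20 : 0 < #|T2|.
  by case/card_gt0P: T0 => x _; apply/card_gt0P; exists (f x).
rewrite /prob; apply/eqP; rewrite eqr_div ?pnatr_eq0 -?lt0n //.
by rewrite -!natrM; apply/eqP; congr (_%:R)%R; exact: H.
Qed.

Lemma balanced_comp T1 T2 T3 (f : T1 -> T2) (g : T2 -> T3) : 0 < #|T2| ->
  balanced f -> balanced g -> balanced (fun x => g (f x)).
Proof.
move=> T20 Hf Hg z.
have E : #|[pred x | g (f x) == z]| * #|T2| = #|[pred y | g y == z]| * #|T1|.
  exact: balanced_card [pred y | g y == z] Hf.
apply/eqP; rewrite -(eqn_pmul2r T20) mulnAC E mulnAC (Hg z) mulnC.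
by [].
Qed.

Lemma balanced_bij T1 T2 (f : T1 -> T2) : bijective f -> balanced f.
Proof.
move=> [g fK gK] y; rewrite -(bij_eq_card (Bijective gK fK)).
have -> : #|[pred x | f x == y]| = #|pred1 (g y)|.
  apply: eq_card => x; rewrite !inE; apply/eqP/eqP => [<-|->].
    by rewrite fK.
  by rewrite gK.
by rewrite card1 mul1n.
Qed.

Lemma balanced_prod T1 T2 T3 T4 (f : T1 -> T2) (g : T3 -> T4) :
  balanced f -> balanced g -> balanced (fun p => (f p.1, g p.2)).
Proof.
move=> Hf Hg [y z]; rewrite !card_prod -(Hf y) -(Hg z).
have -> : #|[pred x : T1 * T3 | (f x.1, g x.2) == (y, z)]|
   = #|[pred x | f x == y]| * #|[pred x | g x == z]|.
  rewrite -[RHS]cardX; apply: eq_card => -[a b].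
  by rewrite !inE xpair_eqE.
by rewrite mulnACA.
Qed.

Lemma card_bits k : #|{: k.-tuple bool}| = 2 ^ k.
Proof. by rewrite card_tuple card_bool. Qed.

Lemma card_bits_gt0 k : 0 < #|{: k.-tuple bool}|.
Proof. by rewrite card_bits expn_gt0. Qed.

(** Two disjoint blocks of a uniform string are uniform and independent; the surplus bits from [a]
    to [o] are skipped. *)
Lemma balanced_cut N a o : a <= o -> o <= N ->
  @balanced (N.-tuple bool) (a.-tuple bool * (N - o).-tuple bool)%type
    (fun r => (pre a r, pre (N - o) (drop o r))).
Proof.
move=> ao oN [u v].
rewrite card_prod !card_bits.
(* Parametrises the fibre over [(u, v)] by the skipped bits. *)
pose f (t : (o - a).-tuple bool) : N.-tuple bool := pre N (u ++ t ++ v).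
have sz (t : (o - a).-tuple bool) : size (u ++ t ++ v) = N.
  by rewrite !size_cat !size_tuple; lia.
have fE (t : (o - a).-tuple bool) : f t = u ++ t ++ v :> bits by rewrite preE ?sz // take_oversize ?sz.
have If : injective f.
  move=> t t' /(congr1 (fun r : N.-tuple bool => (r : bits))); rewrite !fE.
  move/(congr1 (drop a)); rewrite !drop_size_cat ?size_tuple //.
  move/(congr1 (take (o - a))); rewrite !take_size_cat ?size_tuple //.
  exact: val_inj.
have -> : #|[pred r : N.-tuple bool | (pre a r, pre (N - o) (drop o r)) == (u, v)]|
    = #|codom f|.
  apply: eq_card => r; rewrite !inE; apply/eqP/codomP => [[Eu Ev]|[t ->]].
    exists (pre (o - a) (drop a r)); apply: val_inj.
    rewrite -[RHS]/(tval (f (pre (o - a) (drop a r)))) fE -Eu -Ev.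
    rewrite !preE ?size_drop ?size_tuple //; try lia.
    rewrite [take (N - o) _]take_oversize ?size_drop ?size_tuple //.
    have -> : drop o r = drop (o - a) (drop a r) by rewrite drop_drop subnK.
    by rewrite cat_take_drop cat_take_drop.
  have Ed : drop o (f t) = v.
    rewrite fE catA drop_size_cat // size_cat !size_tuple; lia.
  congr (_, _); first by rewrite fE pre_val.
  by rewrite Ed -[X in pre _ X]cats0 pre_val.
rewrite card_codom // card_bits -!expnD; congr (_ ^ _); lia.
Qed.

Lemma balanced_pre N k : k <= N -> @balanced (N.-tuple bool) (k.-tuple bool) (fun r => pre k r).
Proof.
move=> le v; rewrite !card_bits.
have := @balanced_cut N k N le (leqnn N) (v, pre (N - N) [::]).
have e1 : 2 ^ (N - N) = 1 by rewrite subnn.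
rewrite card_prod !card_bits e1 muln1 => <-; congr (_ * _).
apply: eq_card => r; rewrite !inE xpair_eqE.
have -> : pre (N - N) (drop N r) = pre (N - N) [::].
  by apply: val_inj; apply: (etrans (size0nil _) (esym (size0nil _))); rewrite size_tuple subnn.
by rewrite eqxx andbT.
Qed.

Lemma prob_prod T1 T2 (E1 : pred T1) (E2 : pred T2) :
  prob R (T1 * T2)%type (fun p => E1 p.1 && E2 p.2) = (prob R T1 E1 * prob R T2 E2)%R.
Proof.
rewrite /prob card_prod !natrM invfM mulrACA -natrM -cardX.
by congr (_%:R * _)%R; apply: eq_card => -[a b]; rewrite !inE.
Qed.

Lemma nat_of_bits_inj (u v : bits) : size u = size v ->
  nat_of_bits u = nat_of_bits v -> u = v.
Proof.
elim: u v => [|a u IH] [|b v] //= [E] H.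
have Eab : a = b by have := congr1 odd H; rewrite !oddD !odd_double !addbF !oddb.
rewrite Eab in H *; congr (_ :: _); apply: IH => //.
by move/addnI: H; apply: double_inj.
Qed.

Lemma nat_of_bits_lt (u : bits) : nat_of_bits u < 2 ^ size u.
Proof.
elim: u => //= b u IH; rewrite expnS -mul2n.
by case: b => /=; lia.
Qed.

Lemma prob_avoid b (B : pred nat) :
  2 ^ b <= 32 * \sum_(p < 2 ^ b) B p ->
  (prob R (b.-tuple bool) (fun u => ~~ B (nat_of_bits u)) <= 31%:R / 32%:R)%R.
Proof.
move=> le.
have lt (u : b.-tuple bool) : nat_of_bits u < 2 ^ b by have := nat_of_bits_lt u; rewrite size_tuple.
pose f (u : b.-tuple bool) : 'I_(2 ^ b) := Ordinal (lt u).
have If : injective f.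
  move=> u v /(congr1 val) /= /nat_of_bits_inj; rewrite !size_tuple => /(_ erefl).
  exact: val_inj.
have Bf : bijective f by apply: inj_card_bij; rewrite ?card_ord ?card_bits.
have -> : prob R (b.-tuple bool) (fun u => ~~ B (nat_of_bits u))
    = prob R 'I_(2 ^ b) (fun p => ~~ B p).
  exact: (balanced_prob (fun p : 'I_(2 ^ b) => ~~ B p) (card_bits_gt0 b) (balanced_bij Bf)).
rewrite /prob card_ord ler_pdivrMr; last by rewrite ltr0n expn_gt0.
rewrite mulrAC ler_pdivlMr ?ltr0n // -!natrM ler_nat.
have E : #|[pred p : 'I_(2 ^ b) | ~~ B p]| + \sum_(p < 2 ^ b) B p = 2 ^ b.
  rewrite -[RHS]card_ord -(cardC [pred p : 'I_(2 ^ b) | B p]) addnC; congr (_ + _).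
    by rewrite -[RHS]sum1_card [RHS]big_mkcond /=; apply: eq_bigr => p _; rewrite !inE; case: (B p).
have -> : #|(fun p : 'I_(2 ^ b) => ~~ B p)| = #|[pred p : 'I_(2 ^ b) | ~~ B p]|.
  exact: eq_card.
move: E le; set c := #|_|; lia.
Qed.

(** Samples use disjoint blocks of coins; splitting off the first block turns the probability into a
    product. *)
Lemma prob_all_avoid b (B : pred nat) t N :
  2 ^ b <= 32 * \sum_(p < 2 ^ b) B p -> t * b <= N ->
  (prob R (N.-tuple bool)
    (fun r => all (fun j => ~~ B (nat_of_bits (pre b (drop (j * b) r)))) (iota 0 t))
   <= (31%:R / 32%:R) ^+ t)%R.
Proof.
move=> HB; elim: t N => [|t IH] N le; first by rewrite expr0 prob_le1.
have bN : b <= N by move: le; rewrite mulSn; lia.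
have le2 : t * b <= N - b by move: le; rewrite mulSn; lia.
pose E1 (u : b.-tuple bool) := ~~ B (nat_of_bits u).
pose E2 (r : (N - b).-tuple bool) :=
  all (fun j => ~~ B (nat_of_bits (pre b (drop (j * b) r)))) (iota 0 t).
have -> : prob R (N.-tuple bool)
    (fun r => all (fun j => ~~ B (nat_of_bits (pre b (drop (j * b) r)))) (iota 0 t.+1))
   = prob R (b.-tuple bool * (N - b).-tuple bool)%type (fun p => E1 p.1 && E2 p.2).
  rewrite -(balanced_prob (fun p => E1 p.1 && E2 p.2) (card_bits_gt0 N)
     (balanced_cut (leqnn b) bN)).
  apply: eq_prob => r /=.
  rewrite mul0n drop0; congr (_ && _).
  have Ed : pre (N - b) (drop b r) = drop b r :> bits.
    by rewrite preE ?take_oversize ?size_drop ?size_tuple.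
  rewrite /E2 Ed -[1]addn0 iotaDl all_map; apply: eq_all => j /=.
  by rewrite drop_drop mulSn addnC.
rewrite prob_prod exprS; apply: ler_pM; rewrite ?prob_ge0 //; last exact: IH.
exact: prob_avoid.
Qed.

End Probability.

(** * The random linear code *)

Lemma balanced_homogeneous (T1 T2 : finType) (f : T1 -> T2) :
  (forall y y', #|[pred x | f x == y]| <= #|[pred x | f x == y']|) -> balanced f.
Proof.
move=> H y.
have -> : #|T1| = \sum_(y' : T2) #|[pred x | f x == y']|.
  rewrite -sum1_card (partition_big f xpredT) //=; apply: eq_bigr => y' _.
  by rewrite -sum1_card; apply: eq_bigl => x; rewrite !inE.
rewrite (eq_bigr (fun _ => #|[pred x | f x == y]|)) ?sum_nat_const 1?mulnC //.
by move=> y' _; apply/eqP; rewrite eqn_leq !H.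
Qed.

Section RandomMatrix.
Variables n e : nat.
Local Notation L := (chunk_len n e).
Local Notation F := (fp_len n).

(** Adds the vector [d] to column [k0] of the matrix. Past the last row [nth false d] is [false], so
    surplus bits stay fixed. *)
Definition flip T (k0 : nat) (d : F.-tuple bool) (M : T.-tuple bool) : T.-tuple bool :=
  [tuple nth false M q (+) ((q %% L == k0) && nth false d (q %/ L)) | q < T].

Lemma nth_flip T k0 d (M : T.-tuple bool) q : q < T ->
  nth false (flip k0 d M) q = nth false M q (+) ((q %% L == k0) && nth false d (q %/ L)).
Proof. by move=> lt; rewrite -(tnth_nth _ _ (Ordinal lt)) tnth_mktuple. Qed.

Lemma flip_inj T k0 d : injective (@flip T k0 d).
Proof.
have inv (M : T.-tuple bool) : flip k0 d (flip k0 d M) = M.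
  apply: eq_from_tnth => q; rewrite !(tnth_nth false) nth_flip // nth_flip //.
  by rewrite -addbA addbb addbF.
exact: can_inj inv.
Qed.

Lemma fp_flip T k0 d (M : T.-tuple bool) r j : k0 < L -> nth false r k0 ->
  F * L <= T -> j < F ->
  fp n e (flip k0 d M) r j = fp n e M r j (+) nth false d j.
Proof.
move=> ltk rk le ltj; rewrite /fp.
have lt (k : 'I_L) : j * L + k < T.
  apply: leq_trans le; apply: leq_trans (_ : j.+1 * L <= _).
    by rewrite mulSn addnC ltn_add2r.
  by rewrite leq_mul2r ltj orbT.
rewrite (eq_bigr (fun k : 'I_L => (nth false r k && nth false M (j * L + k)) (+)
     ((k == Ordinal ltk) && nth false d j))); last first.
  move=> k _; rewrite nth_flip // modnMDl modn_small // divnMDl; last exact: leq_trans ltk.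
  rewrite divn_small // addn0 -(inj_eq val_inj) /=.
  case: eqP => [->|_]; last by rewrite /= !addbF.
  by rewrite rk.
rewrite big_split /=; congr (_ (+) _).
by rewrite (bigD1 (Ordinal ltk)) //= eqxx /= big1 ?addbF // => k /negPf ->.
Qed.

Definition fp_word T (r : bits) (M : T.-tuple bool) : F.-tuple bool :=
  [tuple fp n e M r p | p < F].

(** If bit [k0] of [r] is 1, adding [d] to column [k0] translates the encoding of [r] by [d], which
    maps any fibre injectively into any other. So a nonzero root has a uniform encoding. *)
Lemma fp_word_balanced T r k0 : k0 < L -> nth false r k0 -> F * L <= T ->
  balanced (@fp_word T r).
Proof.
move=> ltk rk le; apply: balanced_homogeneous => y y'.
pose d : F.-tuple bool := [tuple tnth y p (+) tnth y' p | p < F].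
rewrite -(card_image (@flip_inj T k0 d)); apply: subset_leq_card.
apply/subsetP=> M' /imageP[M]; rewrite !inE => /eqP EM ->.
apply/eqP/eq_from_tnth => p; rewrite tnth_mktuple fp_flip //.
have := congr1 (fun t => tnth t p) EM; rewrite tnth_mktuple => ->.
by rewrite -tnth_nth tnth_mktuple addbA addbb addFb.
Qed.

Definition wt k (y : k.-tuple bool) : nat := \sum_(p < k) tnth y p.
Definition light k : nat := #|[pred y : k.-tuple bool | 16 * wt y < k]|.

(** Expansion of [(1 + 8) ^ k], a one contributing 1 and a zero 8. *)
Lemma weight_enumerator k : \sum_(y : k.-tuple bool) 8 ^ (k - wt y) = 9 ^ k.
Proof.
have E : \prod_(i : 'I_k) \sum_(b : bool) (if b then 1 else 8) = 9 ^ k.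
  by rewrite (eq_bigr (fun _ => 9)) ?prod_nat_const ?card_ord // => i _; rewrite big_bool.
rewrite -E bigA_distr_bigA /=.
pose g (f : {ffun 'I_k -> bool}) : k.-tuple bool := [tuple f i | i < k].
pose g' (y : k.-tuple bool) : {ffun 'I_k -> bool} := [ffun i => tnth y i].
rewrite (reindex g); last first.
  exists g' => [f _|y _].
    by apply/ffunP=> i; rewrite ffunE tnth_mktuple.
  by apply: eq_from_tnth => i; rewrite tnth_mktuple ffunE.
apply: eq_bigr => f _.
have -> : k - wt (g f) = \sum_(i < k) ~~ f i.
  have E2 : \sum_(i < k) ~~ f i + wt (g f) = k.
    rewrite /wt -big_split /= (eq_bigr (fun _ => 1)) ?sum1_card ?card_ord // => i _.
    by rewrite tnth_mktuple; case: (f i).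
  by apply/eqP; rewrite eq_sym -(eqn_add2r (wt (g f))) E2 subnK // -[leqRHS]E2 leq_addl.
rewrite expn_sum; apply: eq_bigr => i _.
by case: (f i).
Qed.

(** A Chernoff-type estimate: every light word contributes at least [8 ^ (k - k %/ 16)] to the
    enumerator. The base 8 suffices because [2 * 9 ^ 4 <= 4 * 8 ^ 4]. *)
Lemma light_bound k : light k ^ 2 <= 2 ^ k.
Proof.
set V := light k; set a := k %/ 16.
have H1 : V * 8 ^ (k - a) <= 9 ^ k.
  rewrite -weight_enumerator /V /light -sum1_card big_distrl /=.
  rewrite [leqRHS](bigID [pred y : k.-tuple bool | 16 * wt y < k]) /=.
  apply: leq_trans (leq_addr _ _); apply: leq_sum => y; rewrite inE => lt.
  rewrite mul1n leq_exp2l //; apply: leq_sub2l; rewrite leq_divRL //; lia.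
have ak : a <= k by apply: leq_div.
(* The fourth power clears the fraction: [8 ^ (4 * a) = 2 ^ (12 * a)], and [16 * a <= k]. *)
have H2 : V ^ 4 * (8 ^ 4) ^ k <= (9 ^ 4 * 2) ^ k.
  have : (V * 8 ^ (k - a)) ^ 4 * 8 ^ (4 * a) <= (9 ^ k) ^ 4 * 2 ^ k.
    apply: leq_mul; first by rewrite leq_exp2r.
    rewrite (_ : 8 = 2 ^ 3) // -expnM leq_exp2l //.
    by have := leq_trunc_div k 16; rewrite -/a; lia.
  rewrite expnMn -!expnM -mulnA -expnD expnMn -!expnM.
  by rewrite (_ : (k - a) * 4 + 4 * a = 4 * k) ?[k * 4]mulnC //; lia.
have H3 : (9 ^ 4 * 2) ^ k <= (4 * 8 ^ 4) ^ k.
  have : 9 ^ 4 * 2 <= 4 * 8 ^ 4 by vm_compute.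
  by move: (9 ^ 4 * 2) (4 * 8 ^ 4) => A B AB; case: (k) => // k'; rewrite leq_exp2r.
have : V ^ 4 * (8 ^ 4) ^ k <= 4 ^ k * (8 ^ 4) ^ k.
  by apply: leq_trans H2 _; rewrite -expnMn.
rewrite leq_pmul2r; last by rewrite !expn_gt0.
rewrite (_ : 4 = 2 ^ 2) // -expnM (mulnC 2 k) expnM.
rewrite (_ : V ^ (2 ^ 2) = (V ^ 2) ^ 2); last by rewrite -expnM.
by rewrite leq_sqr.
Qed.

Definition goodb T (M : T.-tuple bool) : bool :=
  [forall r : L.-tuple bool, (tval r != nseq L false) ==> (F <= 16 * fp_wt n e M r)].

Lemma goodbP T (M : T.-tuple bool) : goodb M -> good_matrix n e M.
Proof.
move=> /forallP Hg r sr nz.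
have := Hg (@Tuple L bool r (introT eqP sr)); by rewrite /= nz.
Qed.

Variable R : realType.

Lemma prob_exists (T I : finType) (P : I -> pred T) :
  (prob R T (fun x => [exists i, P i x]) <= \sum_(i : I) prob R T (P i))%R.
Proof.
rewrite /prob -mulr_suml ler_wpM2r ?invr_ge0 // -natr_sum ler_nat.
rewrite -sum1_card big_mkcond /=.
rewrite (eq_bigr (fun i => \sum_(x : T) (P i x : nat))); last first.
  by move=> i _; rewrite -sum1_card big_mkcond; apply: eq_bigr => x _; rewrite unfold_in; case: (P i x).
rewrite exchange_big /=; apply: leq_sum => x _; rewrite unfold_in.
case: existsP => // -[i Pi]; by rewrite (bigD1 i) //= Pi.
Qed.

Lemma light_bits_prob T (r : L.-tuple bool) : F * L <= T -> tval r != nseq L false ->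
  (prob R (T.-tuple bool) (fun M => ~~ (F <= 16 * fp_wt n e M r)%N)
   <= (light F)%:R / (2 ^ F)%N%:R)%R.
Proof.
move=> le nz.
have [k0 ltk rk] : exists2 k0, k0 < L & nth false r k0.
  case: (pselect (exists2 k0, k0 < L & nth false r k0)) => // N.
  case/eqP: nz; apply: (@eq_from_nth _ false); rewrite ?size_nseq ?size_tuple // => k lt.
  by rewrite nth_nseq lt; apply/negP => rk; apply: N; exists k.
have B := fp_word_balanced ltk rk le.
rewrite -(card_bits F).
have := balanced_prob R [pred y : F.-tuple bool | 16 * wt y < F] (card_bits_gt0 T) B.
rewrite {2}/prob -/(light F) => <-.
rewrite le_eqVlt; apply/orP; left; apply/eqP/eq_prob => M.
rewrite -ltnNge /= /fp_wt /wt; congr (_ * _ < _); apply: eq_bigr => p _.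
by rewrite tnth_mktuple.
Qed.

(** Union bound over at most [2 ^ L] roots, each failing with probability at most 2^-(F/2). As L <=
    n/32 and F/2 > n/8, a factor 2^-(n/16) remains. *)
Lemma bad_matrix_prob : 3 < n ->
  (prob R ((n * n).-tuple bool) (fun M => ~~ goodb M) <= 2^-1 ^+ (n %/ 16))%R.
Proof.
move=> n3.
have n0 : 0 < n by lia.
have [leF ltF _] := fp_lenP n0.
have leL : L <= n %/ 32 by apply: geq_minr.
have le : F * L <= n * n by apply: leq_mul => //; lia.
(* [n > 3] gives [lg n > 1], so that F is even and [F'] is its half. *)
pose F' := 2 ^ (lg n).-2.
have EF : F = 2 * F'.
  have : 1 < lg n by apply: trunc_log_max.
  by rewrite /fp_len /addr_len /F'; case: (lg n) => [|[|k]] // _; rewrite expnS.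
have lV : light F <= 2 ^ F'.
  by rewrite -leq_sqr -expnM mulnC -EF light_bound.
apply: (@le_trans _ _ (\sum_(r : L.-tuple bool) (2 ^ F')%N%:R / (2 ^ F)%N%:R)%R).
  pose P (r : L.-tuple bool) (M : (n * n).-tuple bool) :=
    (tval r != nseq L false) && ~~ (F <= 16 * fp_wt n e M r).
  rewrite (@eq_prob R _ _ (fun M => [exists r, P r M])); last first.
    by move=> M; rewrite negb_forall; apply: eq_existsb => r; rewrite negb_imply.
  apply: le_trans (prob_exists P) _; apply: ler_sum => r _.
  case: (boolP (tval r == nseq L false)) => [z|nz].
    rewrite (@eq_prob R _ _ pred0); last by move=> M; rewrite /P z.
    by rewrite /prob card0 mul0r divr_ge0.
  rewrite (@eq_prob R _ _ (fun M : (n * n).-tuple bool => ~~ (F <= 16 * fp_wt n e M r))); last first.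
    by move=> M; rewrite /P nz.
  apply: le_trans (light_bits_prob le nz) _.
  by rewrite ler_wpM2r ?invr_ge0 // ler_nat.
rewrite sumr_const card_bits -[X in (X <= _)%R]mulr_natl mulrA -natrM -expnD.
rewrite exprVn -natrX ler_pdivrMr ?ltr0n ?expn_gt0 // mulrC.
rewrite ler_pdivlMr ?ltr0n ?expn_gt0 // -natrM ler_nat -expnD leq_exp2l //.
by rewrite EF in ltF *; lia.
Qed.

End RandomMatrix.

(** * Negligible functions *)

Lemma eventually_and (P Q : nat -> Prop) :
  eventually P -> eventually Q -> eventually (fun l => P l /\ Q l).
Proof.
move=> [N HN] [N' HN']; exists (maxn N N') => l; rewrite geq_max => /andP[a b].
by split; [apply: HN | apply: HN'].
Qed.

Lemma eventually_imp (P Q : nat -> Prop) :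
  (forall l, P l -> Q l) -> eventually P -> eventually Q.
Proof. by move=> H [N HN]; exists N => l /HN /H. Qed.

Lemma eventually_leq K : eventually (fun l => K <= l).
Proof. by exists K. Qed.

Lemma leq_lg K l : 2 ^ K <= l -> K <= trunc_log 2 l.
Proof. by move=> le; apply: trunc_log_max. Qed.

Lemma lg_lt l : l < 2 ^ (trunc_log 2 l).+1.
Proof. exact: trunc_log_ltn. Qed.

Lemma lg_leq l K : l < 2 ^ K.+1 -> trunc_log 2 l <= K.
Proof.
move=> lt; case: (posnP l) => [->|l0]; first by rewrite trunc_log0.
rewrite -ltnS -(ltn_exp2l _ _ (ltnSn 1)); apply: leq_ltn_trans lt.
exact: trunc_logP.
Qed.

Lemma lg_poly n c l : l <= n ^ c + c -> trunc_log 2 l <= c * (trunc_log 2 n + 2).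
Proof.
move=> le; apply: lg_leq; apply: leq_ltn_trans le _.
have lt := lg_lt n; set k := trunc_log 2 n in lt *.
have le1 : n ^ c <= 2 ^ (c * (k + 1)).
  rewrite mulnC expnM addn1; case: (c) => // c'; rewrite leq_exp2r //; exact: ltnW.
have lt2 : c < 2 ^ c by apply: ltn_expl.
have p1 : 0 < 2 ^ (c * (k + 1)) by rewrite expn_gt0.
have -> : 2 ^ (c * (k + 2)).+1 = 2 * (2 ^ (c * (k + 1)) * 2 ^ c).
  by rewrite expnS -expnD; congr (_ * 2 ^ _); lia.
nia.
Qed.

Section PolynomiallyRelated.
Variables (n : nat -> nat) (c : nat).
Hypothesis le_n : forall l, l <= n l ^ c + c.

Lemma lg_unbounded K : eventually (fun l => K <= trunc_log 2 (n l)).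
Proof.
exists (2 ^ (c * (K + 2)).+1) => l /leq_lg H; have := lg_poly (le_n l).
rewrite leqNgt => h; rewrite leqNgt; apply: contra h => lt.
apply: leq_trans H; rewrite ltnS; apply: leq_mul => //; lia.
Qed.

Lemma n_unbounded K : eventually (fun l => K <= n l).
Proof.
apply: eventually_imp (lg_unbounded K) => l le.
case: (posnP (n l)) => [n0|n0]; first by move: le; rewrite n0 trunc_log0; lia.
apply: leq_trans le _; apply: leq_trans (ltnW (ltn_expl _ (ltnSn 1))) _.
exact: trunc_logP.
Qed.

(** This is why [samples] is a cube: log l is at most a constant times log n, and the third factor
    log n outgrows the constants. *)
Lemma lg_sq_samples : eventually (fun l => 32 * trunc_log 2 l ^ 2 <= trunc_log 2 (n l) ^ 3).
Proof.
apply: eventually_imp (lg_unbounded (32 * (9 * c ^ 2) + 1)) => l le.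
have := lg_poly (le_n l); set k := trunc_log 2 (n l) in le *; set j := trunc_log 2 l => lej.
(* From [c * (k + 2)] with [k >= 1]; the square gives the [9 * c ^ 2] in the threshold. *)
have {}lej : j <= 3 * c * k by apply: leq_trans lej _; nia.
have : j ^ 2 <= (3 * c * k) ^ 2 by rewrite leq_sqr.
rewrite !expnMn => H.
apply: leq_trans (_ : 32 * (9 * c ^ 2) * k ^ 2 <= _); first by move: H; rewrite (_ : 3 ^ 2 = 9) //; lia.
by rewrite [k ^ 3]expnS leq_mul2r; apply/orP; right; lia.
Qed.

Lemma cube_exp2 k : 10 <= k -> k ^ 3 <= 2 ^ k.
Proof.
elim: k => // k IH; rewrite leq_eqVlt => /orP[/eqP <-|lt]; first by vm_compute.
have {}IH := IH lt; rewrite [2 ^ k.+1]expnS; apply: leq_trans (leq_mul (leqnn 2) IH).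
by rewrite !expnS !expn0 !muln1; nia.
Qed.

Lemma lg_sq_length : eventually (fun l => trunc_log 2 l ^ 2 <= n l %/ 16).
Proof.
apply: eventually_imp (lg_unbounded (16 * (9 * c ^ 2) + 10)) => l le.
have := lg_poly (le_n l); set k := trunc_log 2 (n l) in le *; set j := trunc_log 2 l => lej.
have {}lej : j <= 3 * c * k by apply: leq_trans lej _; nia.
have n0 : 0 < n l by case: (posnP (n l)) => // n0; move: le; rewrite /k n0 trunc_log0; lia.
rewrite leq_divRL // mulnC; apply: leq_trans (trunc_logP (ltnSn 1) n0); rewrite -/k.
apply: leq_trans (_ : k ^ 3 <= _); last by apply: cube_exp2; lia.
have : j ^ 2 <= (3 * c * k) ^ 2 by rewrite leq_sqr.
rewrite !expnMn => H.
apply: leq_trans (_ : 16 * (9 * c ^ 2) * k ^ 2 <= _); first by move: H; rewrite (_ : 3 ^ 2 = 9) //; lia.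
by rewrite [k ^ 3]expnS leq_mul2r; apply/orP; right; lia.
Qed.

End PolynomiallyRelated.

(** * Countability of programs with polynomial clocks *)

Fixpoint cmd_tree (c : cmd) : GenTree.tree nat :=
  match c with
  | Skip => GenTree.Node 0 [::]
  | Push b x => GenTree.Node 1 [:: GenTree.Leaf (nat_of_bool b); GenTree.Leaf x]
  | Pop x => GenTree.Node 2 [:: GenTree.Leaf x]
  | Toss x => GenTree.Node 3 [:: GenTree.Leaf x]
  | Query x y => GenTree.Node 4 [:: GenTree.Leaf x; GenTree.Leaf y]
  | Seq c1 c2 => GenTree.Node 5 [:: cmd_tree c1; cmd_tree c2]
  | Case x c c0 c1 =>
      GenTree.Node 6 [:: GenTree.Leaf x; cmd_tree c; cmd_tree c0; cmd_tree c1]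
  | While x c => GenTree.Node 7 [:: GenTree.Leaf x; cmd_tree c]
  end.

Lemma cmd_tree_inj : injective cmd_tree.
Proof.
elim=> [|b x|x|x|x y|c1 IH1 c2 IH2|x c IH c0 IH0 c1 IH1|x c IH]
  [|b' x'|x'|x'|x' y'|c1' c2'|x' c' c0' c1'|x' c'] //= [].
- by move=> Eb ->; congr Push; case: b b' Eb => -[].
- by move=> ->.
- by move=> ->.
- by move=> -> ->.
- by move=> /IH1 -> /IH2 ->.
- by move=> -> /IH -> /IH0 -> /IH1 ->.
- by move=> -> /IH ->.
Qed.

Definition poly_alg (p : cmd * nat) : alg := Alg p.1 (fun m => m ^ p.2 + p.2).

Definition code (p : cmd * nat) : nat := pickle (cmd_tree p.1, p.2).

Lemma code_inj : injective code.
Proof.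
by move=> [c k] [c' k'] /(pcan_inj pickleK)[/cmd_tree_inj -> ->].
Qed.

Section Negligible.
Variable R : realType.
Local Open Scope ring_scope.

(** For every admissible block length this eventually dominates both the sampling error and the
    probability of a bad matrix, though it depends on [l] alone. *)
Definition tiny (l : nat) : R := 2^-1 ^+ (trunc_log 2 l ^ 2)%N.

Lemma tiny_gt0 l : 0 < tiny l.
Proof. by rewrite exprn_gt0 // invr_gt0. Qed.

Lemma negligible_tiny : negligible tiny.
Proof.
move=> c; exists (2 ^ (2 * c).+1)%N => l /leq_lg le.
rewrite ger0_norm ?(ltW (tiny_gt0 _)) // /tiny exprVn -natrX.
have l0 : (0 < l)%N by case: (l) le => //; rewrite trunc_log0.
rewrite -natrX lef_pV2 ?posrE ?ltr0n ?expn_gt0 ?l0 // ler_nat.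
set k := trunc_log 2 l in le *.
apply: leq_trans (_ : 2 ^ (k.+1 * c) <= _)%N.
  by rewrite expnM; case: (c) => // c'; rewrite leq_exp2r // ltnW // lg_lt.
rewrite leq_exp2l //; nia.
Qed.

Lemma negligible_add (f g : nat -> R) :
  negligible f -> negligible g -> negligible (fun l => f l + g l).
Proof.
move=> Hf Hg c; apply: eventually_imp (eventually_and (eventually_leq 2)
   (eventually_and (Hf c.+1) (Hg c.+1))) => l [l2 [H1 H2]].
apply: le_trans (ler_normD _ _) _; apply: le_trans (lerD H1 H2) _.
rewrite exprS invfM -mulrDl ler_piMl ?invr_ge0 ?exprn_ge0 //.
have l0 : (0 : R) < l%:R by rewrite ltr0n; lia.
by rewrite -mulr2n -[_ *+ 2]mulr_natl ler_pdivrMr // mul1r ler_nat.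
Qed.

(** Diagonal argument: [nu i] enters the maximum [mu l] only from the point [th i] on, where it is
    below [l ^- i]. For a given exponent [c] this handles all [i >= c], and the finitely many
    [i < c] are negligible one by one. *)
Lemma negligible_diagonal (nu : nat -> nat -> R) :
  (forall i, negligible (nu i)) ->
  exists2 mu : nat -> R, negligible mu & forall i, eventually (fun l => nu i l <= mu l).
Proof.
move=> Hnu.
pose th i := sval (cid (Hnu i i)).
have thP i l : (th i <= l)%N -> `|nu i l| <= l%:R ^- i by apply: (svalP (cid (Hnu i i))).
pose mu l := \big[Order.max/0%R]_(i < l.+1 | (th i <= l)%N) nu i l.
exists mu; last first.
  move=> i; exists (maxn (th i) i) => l; rewrite geq_max => /andP[le1 le2].
  exact: (bigmax_sup (Ordinal (le2 : (i < l.+1)%N))).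
move=> c.
have [N HN] : exists N, forall l, (N <= l)%N -> forall i, (i < c)%N -> `|nu i l| <= l%:R ^- c.
  elim: {1}c => [|k [N HN]]; first by exists 0.
  have [N' HN'] := Hnu k c; exists (maxn N N') => l; rewrite geq_max => /andP[a b] i.
  by rewrite ltnS leq_eqVlt => /orP[/eqP ->|lt]; [apply: HN' | apply: HN].
exists (maxn N 1) => l; rewrite geq_max => /andP[leN l1].
have mu0 : 0 <= mu l by apply: bigmax_ge_id.
rewrite ger0_norm //; apply: bigmax_le => [|i le]; first by rewrite invr_ge0 exprn_ge0.
apply: le_trans (ler_norm _) _.
case: (ltnP i c) => ic; first exact: HN.
apply: le_trans (thP _ _ le) _.
rewrite -!natrX lef_pV2 ?posrE ?ltr0n ?expn_gt0 ?l1 // ler_nat leq_pexp2l //.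
Qed.

Lemma universal_bound (GenH : alg) (H : bits -> bits -> bits) :
  (forall A : alg, polytime A ->
     (forall l (rG : coins GenH l) (r : coins A l), halts A l [::] [:: unary l; seed rG] r) ->
     negligible (collision_prob R GenH H A)) ->
  exists2 mu : nat -> R, negligible mu &
  forall p, (forall l (rG : coins GenH l) (r : coins (poly_alg p) l),
     halts (poly_alg p) l [::] [:: unary l; seed rG] r) ->
  eventually (fun l => collision_prob R GenH H (poly_alg p) l <= mu l).
Proof.
move=> sec.
pose ok p := forall l (rG : coins GenH l) (r : coins (poly_alg p) l),
     halts (poly_alg p) l [::] [:: unary l; seed rG] r.
(* Indices that do not code a halting adversary get the zero function; by injectivity of [code] the
   chosen program is otherwise the intended one. *)
pose nu i := if pselect (exists2 p, code p = i & ok p) is left E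
  then collision_prob R GenH H (poly_alg (s2val (cid2 E))) else fun _ => 0.
have Hnu i : negligible (nu i).
  rewrite /nu; case: pselect => [E|_].
    apply: sec; first by exists (s2val (cid2 E)).2.
    exact: (s2valP' (cid2 E)).
  by move=> c; exists 0 => l _; rewrite normr0 invr_ge0 exprn_ge0.
have [mu negl_mu Hmu] := negligible_diagonal Hnu.
exists mu => // p Hp.
have := Hmu (code p); rewrite /nu; case: pselect => [E|N]; last by case: N; exists p.
by have -> : s2val (cid2 E) = p by apply: code_inj; rewrite (s2valP (cid2 E)).
Qed.

Lemma sampling_tiny t l : (32 * trunc_log 2 l ^ 2 <= t)%N ->
  (31%:R / 32%:R : R) ^+ t <= tiny l.
Proof.
move=> le; rewrite /tiny.
(* Through (31/32)^4 <= 9/10 and (9/10)^8 <= 1/2, which keeps the numerals small. *)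
have h : (31%:R / 32%:R : R) ^+ 32 <= 2^-1.
  have : (31%:R / 32%:R : R) ^+ 4 <= 9%:R / 10%:R by rewrite !exprS expr0; lra.
  have h0 : (0 : R) <= 31%:R / 32%:R by lra.
  move: (31%:R / 32%:R : R) h0 => x x0 h1.
  have -> : x ^+ 32 = (x ^+ 4) ^+ 8 by rewrite -exprM.
  have y0 : 0 <= x ^+ 4 by apply: exprn_ge0.
  move: (x ^+ 4) y0 h1 => y y0 h1.
  apply: le_trans (_ : (9%:R / 10%:R : R) ^+ 8 <= _); first by rewrite lerXn2r ?nnegrE //; lra.
  by rewrite !exprS expr0; lra.
apply: le_trans (_ : (31%:R / 32%:R : R) ^+ (32 * trunc_log 2 l ^ 2) <= _).
  by apply: ler_wiXn2l => //; lra.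
by rewrite exprM lerXn2r ?nnegrE ?exprn_ge0 ?invr_ge0 //; lra.
Qed.

End Negligible.

(** * Security *)

Lemma nth_pre k r i : i < k -> nth false (pre k r) i = nth false r i.
Proof. by move=> lt; rewrite -(tnth_nth _ _ (Ordinal lt)) tnth_mktuple. Qed.

Lemma pre_pre k N r : k <= N -> pre k (pre N r) = pre k r.
Proof.
by move=> le; apply: eq_from_tnth => i; rewrite !tnth_mktuple nth_pre // (leq_trans _ le).
Qed.

Lemma smp_pre n r j : 0 < n -> j < samples n ->
  smp n (take (samples n * addr_len n) r) j
  = nat_of_bits (pre (addr_len n) (drop (j * addr_len n) r)).
Proof.
move=> n0 ltj; rewrite nat_of_bitsE size_tuple; apply: eq_bigr => k _.
rewrite nth_pre // nth_drop nth_take; last first.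
  apply: leq_trans (_ : j.+1 * addr_len n <= _); last by rewrite leq_mul2r ltj orbT.
  by rewrite mulSn addnC ltn_add2r.
congr (_ * _); apply/minn_idPl; have [le _ _] := fp_lenP n0.
by apply: leq_trans le; rewrite leq_exp2l // ltnW.
Qed.

(** In the tree case there are at least 8 leaves, so rounding in [n %/ (4 * e)] loses less than a
    factor 2; otherwise the message is one chunk of [n %/ 32] bits. *)
Lemma rate_bound n e : 64 <= n -> 0 < e -> n <= 64 * (leaves n e * chunk_len n e).
Proof.
move=> n64 e0; rewrite /leaves /chunk_len; case: ifP => le.
  rewrite (minn_idPl le).
  have := ltn_ceil n (_ : 0 < 4 * e); rewrite muln_gt0 e0 => /(_ isT).
  set m := n %/ _; rewrite mulSn; nia.
by rewrite (minn_idPr _); lia.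
Qed.

(** [times_polylog] takes the same number as coefficient and exponent; the terms add up to the
    coefficient 1 + 1 + 1 + 3 + 3 = 9. *)
Lemma nqueries_bound n e : 0 < e -> 0 < lg n -> nqueries n e <= e * (9 * lg n ^ 9).
Proof.
move=> e0 k0; rewrite /nqueries /samples.
have : chunk_len n e <= e by apply: geq_minl.
have : lg n ^ 3 <= lg n ^ 9 by rewrite leq_pexp2l.
have : lg n <= lg n ^ 9 by rewrite -{1}[lg n]expn1 leq_pexp2l.
move: (chunk_len n e) (lg n) (lg n ^ 9) (lg n ^ 3) k0 => L k p c k0 h1 h2 h3.
have : c <= e * p by nia.
have : L <= e * p by nia.
have : k * L <= e * p by rewrite mulnC; apply: leq_mul.
have : 1 <= e * p by nia.
nia.
Qed.

Lemma balanced_ext (T1 T2 : finType) (f g : T1 -> T2) : f =1 g -> balanced f -> balanced g.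
Proof.
by move=> E Hf y; rewrite -(Hf y); congr (_ * _); apply: eq_card => x; rewrite !inE E.
Qed.

Section Main.
Variables (R : realType) (ell : nat -> nat) (GenH : alg) (H : bits -> bits -> bits).
Hypothesis crhf : CRHF R ell GenH H.

Let genP : seed_generator GenH. Proof. by case: crhf. Qed.
Let hashP : hash_computable GenH H. Proof. by case: crhf. Qed.
Let ellP l (rG : coins GenH l) x : size (H (seed rG) x) = ell l.
Proof. by case: crhf. Qed.

Lemma prob_true (T : finType) (E : pred T) : 0 < #|T| -> (forall x, E x) -> prob R T E = 1%R.
Proof.
move=> T0 HE; rewrite /prob.
have -> : #|E| = #|T| by apply: eq_card => x; rewrite unfold_in HE.
by rewrite divff // pnatr_eq0 -lt0n.
Qed.

(** With hash values of length 0 any two strings collide, and the adversary that outputs the empty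
    string and a single bit would always succeed. *)
Lemma ell_gt0 : eventually (fun l => 0 < ell l).
Proof.
have [_ _ _ sec] := crhf.
pose G := @Ctx (nat * bits)%type (fun p => valid GenH p.1 p.2) 2
  (fun p => [:: unary p.1; p.2]) (fun _ => erefl).
pose N (x : G) := 0; pose mask (p : tcx N) : bits := [::].
have [cG clockG] := genP.1.
have [|a [pa _ aP]] := @build_alg G N mask (fun _ => [::]) (fun _ => [:: true]) (fun p => p.1)
    _ isT (ptn_const _ 0) (ptime_nil _) (ptime_nil _) (ptn_const _ 1) (bound_pm cG 0).
  move=> [l s] /= Hv; rewrite !tsz_cons tsz_nil addn0 size_nseq.
  by have := valid_size genP clockG Hv; rewrite /glen; lia.
have aP' l (rG : coins GenH l) r : [/\ halts a l [::] [:: unary l; seed rG] r,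
    output a l [::] [:: unary l; seed rG] r 0 = [::]
  & output a l [::] [:: unary l; seed rG] r 1 = [:: true]].
  have [_ /(_ [::] r (leq0n _))[sg [E E0 E1]]] := aP (l, seed rG) (ex_intro _ rG erefl).
  by rewrite /halts /output E.
have := sec a pa (fun l rG r => let: And3 h _ _ := aP' l rG r in h).
move=> /(_ 1) H1; apply: eventually_imp (eventually_and (eventually_leq 2) H1) => l [l2 {}H1].
rewrite lt0n; apply/eqP=> e0; move: H1; rewrite /collision_prob prob_true.
- by rewrite normr1 expr1 -[X in (_ <= X)%R]mul1r ler_pdivlMr ?ltr0n ?mul1r ?lern1; lia.
- by rewrite card_prod muln_gt0 !card_bits_gt0.
move=> [rG r] /=; have [_ -> ->] := aP' l rG r.
rewrite /=; apply/eqP; apply: etrans (size0nil _) (esym (size0nil _)); by rewrite ellP.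
Qed.

Section Length.
Variables (n : nat -> nat) (cn cG : nat).
Hypotheses (n_gt0 : forall l, 0 < n l) (n_len : polytime_length n).
Hypotheses (n_poly : forall l, n l <= l ^ cn + cn) (le_n : forall l, l <= n l ^ cn + cn).
Hypothesis clockG : forall l, clock GenH l <= l ^ cG + cG.

Local Notation mlen := (mlen n).
Local Notation glen := (glen cG).
Local Notation msg := (msg ell n).

Variables aG aE aD : alg.
Hypotheses (polyG : polytime aG) (coinsG : forall l, mlen l + glen l <= clock aG l).
Hypothesis specG : forall l r, mlen l + glen l <= size r ->
    halts aG l [::] [:: unary l] r /\
    output aG l [::] [:: unary l] r 0
      = take (mlen l) r ++ seed (pre (clock GenH l) (drop (mlen l) r)).
Hypothesis polyE : polytime aE.
Hypothesis specE : forall l M s x,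
  valid GenH l s -> size M = mlen l -> size x = msg l ->
  halts aE l [::] [:: unary l; M ++ s; x] [::] /\
  output aE l [::] [:: unary l; M ++ s; x] [::] 0 = encw (n l) (ell l) (H s) M x.
Hypotheses (polyD : polytime aD) (coinsD : forall l, ncoins n l <= clock aD l).
Hypothesis specD : forall l M s i w r,
  valid GenH l s -> size M = mlen l -> i < n l -> size w = n l -> ncoins n l <= size r ->
  exists sg q, [/\ final aD l w [:: unary l; M ++ s; bin i] r
        = Conf [::] sg (drop (ncoins n l) r) q,
      q <= nqueries (n l) (ell l)
    & sg 0 = decw (n l) (ell l) (H s) M w (take (ncoins n l) r) i].

Definition crlcc : local_code := LocalCode aG aE aD msg n.

Definition mat l (rG : coins aG l) : (mlen l).-tuple bool := pre (mlen l) rG.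
Definition hcoins l (rG : coins aG l) : coins GenH l := pre (clock GenH l) (drop (mlen l) rG).

Lemma seedE l (rG : coins aG l) : seed rG = mat rG ++ seed (hcoins rG).
Proof.
have sz : size rG = clock aG l by rewrite size_tuple.
have [|_ E] := @specG l rG; first by rewrite sz.
rewrite {1}/seed E preE // sz; apply: leq_trans (coinsG l); exact: leq_addr.
Qed.

(** The channel is known to halt only on seeds that the generator produces. The pairs formed by the
    reduction are such seeds. *)
Lemma seed_onto l (M : bits) s : size M = mlen l -> valid GenH l s ->
  exists rG : coins aG l, seed rG = M ++ s.
Proof.
move=> sM [g ->].
exists (pre (clock aG l) (M ++ g ++ nseq (clock aG l) false)); rewrite seedE /mat /hcoins.
have cl : mlen l + clock GenH l <= clock aG l.
  by apply: leq_trans (coinsG l); rewrite leq_add2l clockG.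
have le0 : clock aG l <= size (M ++ g ++ nseq (clock aG l) false).
  by rewrite !size_cat size_nseq; lia.
congr (_ ++ _).
  rewrite pre_pre ?(leq_trans _ cl) ?leq_addr // preE ?take_size_cat //.
  by rewrite size_cat sM leq_addr.
congr seed; apply: eq_from_tnth => k; rewrite tnth_mktuple nth_drop nth_pre; last first.
  by have := ltn_ord k; lia.
by rewrite nth_cat sM ltnNge leq_addr /= addKn nth_cat size_tuple ltn_ord -tnth_nth.
Qed.

Lemma valid_hcoins l (rG : coins aG l) : valid GenH l (seed (hcoins rG)).
Proof. by exists (hcoins rG). Qed.

Lemma encodeE l (rG : coins aG l) x : size x = msg l ->
  halts aE l [::] [:: unary l; seed rG; x] [::] /\
  encode crlcc l (seed rG) x
    = encw (n l) (ell l) (H (seed (hcoins rG))) (mat rG) x.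
Proof.
move=> sx; rewrite /encode seedE.
by apply: specE => //; [exact: valid_hcoins | rewrite size_tuple].
Qed.

Lemma decodeE l (rG : coins aG l) w i (r : coins aD l) : size w = n l -> i < n l ->
  [/\ halts aD l w [:: unary l; seed rG; bin i] r,
      nquery (dec_final crlcc l w (seed rG) i r) <= nqueries (n l) (ell l)
    & decode crlcc l w (seed rG) i r
      = ohead (decw (n l) (ell l) (H (seed (hcoins rG))) (mat rG) w (take (ncoins n l) r) i)].
Proof.
move=> sw lti; rewrite /halts /decode /dec_final seedE.
have [|||||sg [q [E leq E0]]] := @specD l (mat rG) (seed (hcoins rG)) i w r.
- exact: valid_hcoins.
- by rewrite size_tuple.
- exact: lti.
- exact: sw.
- by rewrite size_tuple.
by rewrite E /= E0.
Qed.

Lemma hash_size l (rG : coins aG l) y : size (H (seed (hcoins rG)) y) = ell l.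
Proof. exact: ellP. Qed.

Lemma is_local_code_crlcc : is_local_code crlcc.
Proof.
split.
- split=> // l rG; have [] := @specG l rG => //; by rewrite size_tuple.
- split=> //; exact: (msg_polytime genP hashP ellP n_len clockG).
- move=> l rG x sx; have [Hh ->] := encodeE rG sx; split=> //; exact: size_encw.
- move=> l rG x y sx sy; have [_ ->] := encodeE rG sx; have [_ ->] := encodeE rG sy.
  exact: (encw_inj (n_gt0 l) (hash_size rG)).
- by move=> l rG w i r sw lti; have [] := decodeE rG r sw lti.
Qed.

Section Channel.
Variables (A : channel) (tau : R).
Hypothesis tauP : (tau <= 128%:R^-1)%R.
Hypothesis chan : is_channel crlcc tau A.
Let ch := Defs.choose A.
Let co := corrupt A.

Local Notation cw l M s r1 := (adv_cw ell H n ch l M s r1).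
Local Notation word l M s r1 r2 := (adv_word ell H n ch co l M s r1 r2).

Lemma channelE l (rG : coins aG l) (r1 : coins ch l) :
  [/\ size (adv_msg ch l (mat rG) (seed (hcoins rG)) r1 0) = msg l,
      @codeword crlcc A l rG r1 = cw l (mat rG) (seed (hcoins rG)) r1,
      @corrupt_input crlcc A l rG r1 = adv_ins ell H n ch l (mat rG) (seed (hcoins rG)) r1
    & forall r2 : coins co l,
        @received crlcc A l rG r1 r2 = word l (mat rG) (seed (hcoins rG)) r1 r2].
Proof.
have [_ _ Hc _] := chan; have [_ sm] := Hc l rG r1.
have Em : @message crlcc A l rG r1 = adv_msg ch l (mat rG) (seed (hcoins rG)) r1 0.
  by rewrite /message /choose_input /adv_msg -seedE.
have Ec : @codeword crlcc A l rG r1 = cw l (mat rG) (seed (hcoins rG)) r1.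
  by rewrite /codeword; have [_ ->] := encodeE rG sm; rewrite Em.
have Ei : @corrupt_input crlcc A l rG r1
    = adv_ins ell H n ch l (mat rG) (seed (hcoins rG)) r1.
  by rewrite /corrupt_input Ec /chan_state /choose_input /adv_ins /adv_msg -seedE.
split=> //; first by rewrite -Em.
by move=> r2; rewrite /received Ei.
Qed.

(** Expressed in the matrix, the hash coins and the channel coins, the data shared by the round and
    the collision experiment. *)
Definition caught l (M g r1 r2 : bits) : bool :=
  let s := output GenH l [::] [:: unary l] g 0 in
  let c := cw l M s r1 in let w := word l M s r1 r2 in
  colliding (n l) (ell l) (H s) c w (find_col (n l) (ell l) (H s) c w).

(** Compares the claimed root with the true one. A wrong root survives sampling with probability at
    most [tiny], too little for fooling; with the right root, a single wrong answer exhibits a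
    collision. *)
Lemma fool_caught l (rG : coins aG l) (r1 : coins ch l) (r2 : coins co l) :
  32 * trunc_log 2 l ^ 2 <= samples (n l) ->
  (tiny R l < @wrong_prob crlcc A l rG r1 r2 R)%R ->
  ~~ goodb (n l) (ell l) (mat rG) || caught l (mat rG) (hcoins rG) r1 r2.
Proof.
move=> big fool; case: (boolP (goodb _ _ _)) => //= /goodbP good.
have [sx Ec _ /(_ r2) Ew] := channelE rG r1.
have [_ _ _ /(_ l rG r1 r2)[_ sw hamm lti]] := chan.
rewrite Ew in sw hamm; rewrite Ec in hamm.
set s := seed (hcoins rG) in sx Ec Ew sw hamm *.
rewrite /caught -/(seed (hcoins rG)) -/s.
set c := cw _ _ _ _ in Ec hamm *; set w := word _ _ _ _ _ in Ew sw hamm *.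
set i := chan_index _ _ _ in lti *; rewrite /= in lti sw hamm.
set x := adv_msg _ _ _ _ _ _ in sx.
have cE : c = encw (n l) (ell l) (H s) (mat rG) x by [].
have hs : forall y, size (H s y) = ell l by move=> y; apply: ellP.
have h128 : 128 * hamming c w <= n l.
  have : ((hamming c w)%:R <= 128%:R^-1 * (n l)%:R :> R)%R.
    by apply: le_trans hamm _; rewrite ler_wpM2r.
  by rewrite mulrC ler_pdivlMr ?ltr0n // -natrM ler_nat mulnC.
pose wrong (r : coins aD l) := decode crlcc l w (seed rG) i r \notin
  [:: None; Some (nth false c i)].
have foolE : @wrong_prob crlcc A l rG r1 r2 R = prob R (coins aD l) wrong.
  by rewrite /wrong_prob Ew Ec.
rewrite foolE in fool.
have wrongP r : wrong r -> exists2 b,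
    decw (n l) (ell l) (H s) (mat rG) w (take (ncoins n l) r) i = [:: b] & b != nth false c i.
  rewrite /wrong; have [_ _ ->] := decodeE rG r sw lti; rewrite -/s.
  rewrite /decw; case: ifP => _ //=; rewrite !inE /= => ne; eexists; first by [].
  by apply: contra ne => /eqP ->.
have [E1|ne1] := eqVneq (chunk (n l) (ell l) w 1) (chunk (n l) (ell l) c 1).
  (* The fooling probability exceeds [tiny], hence is positive, so some coins give a wrong
     answer. *)
  have [r Wr] : exists r, wrong r.
    case: (pselect (exists r, wrong r)) => // NW.
    have p0 : prob R (coins aD l) wrong = 0%R.
      rewrite /prob (_ : #|wrong| = 0) ?mul0r //; apply: eq_card0 => r.
      by rewrite unfold_in; case Wr: (wrong r) => //; case: NW; exists r.
    by move: fool; rewrite p0 ltNge (ltW (tiny_gt0 _ _)).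
  have [b Db neb] := wrongP r Wr.
  have [u Iu Cu] := decw_wrong_collides (n_gt0 l) hs sx lti E1 Db neb.
  exact: find_colP Iu Cu.
exfalso.
have many := many_bad_positions (n_gt0 l) hs good sx sw h128 ne1.
pose B p := nth false w p != fp (n l) (ell l) (mat rG) (chunk (n l) (ell l) w 1) p.
have le := @prob_all_avoid R _ B _ _ many (coinsD l : samples (n l) * addr_len (n l) <= clock aD l).
(* A wrong answer is given only if every sample avoids the bad positions. *)
have : (prob R (coins aD l) wrong <= tiny R l)%R.
  apply: le_trans (sampling_tiny R big); apply: le_trans le; apply: prob_sub => r /wrongP[b].
  rewrite /decw; case: ifP => // /andP[/allP Hf _] _ _.
  apply/allP=> j Hj; have := Hf j Hj; rewrite smp_pre //; first by rewrite negbK.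
  by move: Hj; rewrite mem_iota.
by rewrite leNgt fool.
Qed.

Variables c1 c2 : nat.
Hypotheses (clock1 : forall l, clock ch l <= l ^ c1 + c1)
  (clock2 : forall l, clock co l <= l ^ c2 + c2).

(** The channel simulated with surplus coins behaves as the actual one does on the prefix allotted
    by its clock. *)
Lemma adv_msg_pre l M s r j : valid GenH l s -> size M = mlen l -> clock ch l <= size r ->
  halts ch l [::] [:: unary l; M ++ s] r /\
  adv_msg ch l M s r j = adv_msg ch l M s (pre (clock ch l) r) j.
Proof.
move=> Hv sM le; have [rG Es] := seed_onto sM Hv.
have [_ _ Hc _] := chan; have [Hh _] := Hc l rG (pre (clock ch l) r).
rewrite /choose_input Es in Hh.
have := halts_output_cat (drop (clock ch l) r) Hh.
by rewrite /adv_msg preE // cat_take_drop => -[h E].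
Qed.

Lemma adv_ins_pre l M s r : valid GenH l s -> size M = mlen l -> clock ch l <= size r ->
  adv_ins ell H n ch l M s r = adv_ins ell H n ch l M s (pre (clock ch l) r).
Proof.
move=> Hv sM le; rewrite /adv_ins /adv_cw.
by have [_ ->] := adv_msg_pre 0 Hv sM le; have [_ ->] := adv_msg_pre 1 Hv sM le.
Qed.

Lemma adv_word_pre l M s r r' : valid GenH l s -> size M = mlen l ->
  clock ch l <= size r -> clock co l <= size r' ->
  halts co l [::] (adv_ins ell H n ch l M s r) r' /\
  word l M s r r' = word l M s (pre (clock ch l) r) (pre (clock co l) r').
Proof.
move=> Hv sM le le'; rewrite /adv_word (adv_ins_pre Hv sM le).
have [rG Es] := seed_onto sM Hv.
have [_ _ _ /(_ l rG (pre (clock ch l) r) (pre (clock co l) r'))[Hh _ _ _]] := chan.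
have [_ _ Ei _] := channelE rG (pre (clock ch l) r).
(* The matrix has fixed length, so a seed splits in only one way. *)
have E2 : M = mat rG /\ s = seed (hcoins rG).
  move/eqP: Es; rewrite seedE eqseq_cat ?size_tuple ?sM // => /andP[/eqP -> /eqP ->].
  by [].
rewrite Ei -E2.1 -E2.2 in Hh.
have := halts_output_cat (drop (clock co l) r') Hh.
by rewrite (preE le') cat_take_drop => -[h E].
Qed.

(** Both experiments map onto a common space of matrix, hash coins and channel coins by balanced
    maps; there [fool_caught] bounds fooling by the union of a bad matrix and a collision. *)
Lemma fool_reduction : exists p : cmd * nat,
  (forall l (rG : coins GenH l) (r : coins (poly_alg p) l),
     halts (poly_alg p) l [::] [:: unary l; seed rG] r) /\
  eventually (fun l => fool_prob crlcc A (tiny R l) l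
    <= collision_prob R GenH H (poly_alg p) l + tiny R l)%R.
Proof.
have [_ _ Hc Hd] := chan.
have chP l M s r1 : valid GenH l s -> size M = mlen l -> l ^ c1 + c1 <= size r1 ->
    halts ch l [::] [:: unary l; M ++ s] r1.
  by move=> Hv sM le; have [] := adv_msg_pre 0 Hv sM (leq_trans (clock1 l) le).
have coP l M s r1 r2 : valid GenH l s -> size M = mlen l -> l ^ c1 + c1 <= size r1 ->
    l ^ c2 + c2 <= size r2 -> halts co l [::] (adv_ins ell H n ch l M s r1) r2.
  move=> Hv sM le1 le2.
  by have [] := adv_word_pre Hv sM (leq_trans (clock1 l) le1) (leq_trans (clock2 l) le2).
have [pch pco] : polytime ch /\ polytime co by case: chan.
have [a [pa [ca Ea] aP]] :=
  adv_alg genP hashP ellP n_len clockG pch pco chP coP.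
have Ep : a = poly_alg (prog a, ca) by [].
exists (prog a, ca); rewrite -Ep; split.
  move=> l rG r; have [le /(_ r)] := aP l (seed rG) (ex_intro _ rG erefl).
  by rewrite size_tuple => /(_ le)[].
apply: eventually_imp (eventually_and (lg_sq_samples le_n)
  (eventually_and (lg_sq_length le_n) (n_unbounded le_n 4))) => l [big [len n4]].
pose T2 := ((mlen l).-tuple bool * coins GenH l * (coins ch l * coins co l))%type.
pose f1 (rr : coins aG l * (coins ch l * coins co l)) : T2 :=
  (mat rr.1, hcoins rr.1, rr.2).
pose p1 := l ^ c1 + c1.
(* In the collision experiment the hash coins belong to the challenger, and the matrix and channel
   coins are cut out of the adversary's tape, with gaps up to the polynomial bounds. *)
pose f2 (rr : coins GenH l * coins a l) : T2 :=
  (pre (mlen l) rr.2, rr.1,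
   (pre (clock ch l) (drop (mlen l) rr.2), pre (clock co l) (drop (mlen l + p1) rr.2))).
pose EM (t : T2) := ~~ goodb (n l) (ell l) t.1.1.
pose EC (t : T2) := caught l t.1.1 t.1.2 t.2.1 t.2.2.
have bal1 : balanced f1.
  apply: (@balanced_prod _ _ _ _ (fun rG : coins aG l => (mat rG, hcoins rG)) id);
    last by apply: balanced_bij; exists id.
  have leM : mlen l <= clock aG l by apply: leq_trans (coinsG l); apply: leq_addr.
  have leH : clock GenH l <= clock aG l - mlen l.
    by have := coinsG l; have := clockG l; rewrite /glen; lia.
  have B := balanced_comp _ (balanced_cut (leqnn _) leM)
    (balanced_prod (balanced_bij (_ : bijective id)) (balanced_pre leH)).
  apply: balanced_ext (B _ _); first last.
  - by exists id.
  - by rewrite card_prod muln_gt0 !card_bits_gt0.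
  by move=> r; rewrite /= pre_pre.
have le_a : adv_coins n c1 c2 l <= clock a l.
  by have [] := aP l (seed (pre (clock GenH l) [::])) (ex_intro _ _ erefl).
have bal2 : balanced f2.
  have leM : mlen l <= clock a l by apply: leq_trans le_a; apply: leq_addr.
  have le1 : p1 <= clock a l - mlen l by move: le_a; rewrite /adv_coins /p1; lia.
  have le2 : clock co l <= clock a l - mlen l - p1.
    by move: le_a; have := clock2 l; rewrite /adv_coins /p1; lia.
  pose g0 (r : coins a l) := (pre (mlen l) r, pre (clock a l - mlen l) (drop (mlen l) r)).
  pose g1 (r : (clock a l - mlen l).-tuple bool) :=
    (pre (clock ch l) r, pre (clock co l) (drop p1 r)).
  have b1 : balanced g1.
    have B := balanced_comp _ (balanced_cut (clock1 l) le1)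
      (balanced_prod (balanced_bij (_ : bijective id)) (balanced_pre le2)).
    apply: balanced_ext (B _ _); first last.
    - by exists id.
    - by rewrite card_prod muln_gt0 !card_bits_gt0.
    by move=> r; rewrite /= pre_pre.
  have b0 : balanced (fun r => ((g0 r).1, g1 (g0 r).2)).
    apply: (@balanced_comp _ _ _ g0 (fun p => (id p.1, g1 p.2))).
    - by rewrite card_prod muln_gt0 !card_bits_gt0.
    - exact: balanced_cut.
    apply: (@balanced_prod _ _ _ _ id g1) => //; by apply: balanced_bij; exists id.
  (* Reorders the components so that the matrix precedes the hash coins, as in [f1]. *)
  pose sw (t : coins GenH l * ((mlen l).-tuple bool * (coins ch l * coins co l))) : T2 :=
    (t.2.1, t.1, t.2.2).
  have bsw : bijective sw.
    by exists (fun t => (t.1.2, (t.1.1, t.2))) => [[g [M r]]|[[M g] r]].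
  have bid : bijective (@id (coins GenH l)) by exists id.
  have c0 : 0 < #|{: coins GenH l * ((mlen l).-tuple bool * (coins ch l * coins co l))}|.
    by rewrite !card_prod !muln_gt0 !card_bits_gt0.
  have B := balanced_comp c0 (balanced_prod (balanced_bij bid) b0) (balanced_bij bsw).
  apply: balanced_ext B.
  move=> [g r]; rewrite /sw /f2 /g1 /=; congr (_, _, (_, _)).
    rewrite pre_pre //; apply: leq_trans (clock1 l) le1.
  apply: eq_from_tnth => k; rewrite !tnth_mktuple !nth_drop nth_pre ?nth_drop ?addnA //.
  by have := ltn_ord k; lia.
have T10 : 0 < #|{: coins aG l * (coins ch l * coins co l)}|.
  by rewrite !card_prod !muln_gt0 !card_bits_gt0.
have T30 : 0 < #|{: coins GenH l * coins a l}|.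
  by rewrite !card_prod !muln_gt0 !card_bits_gt0.
have T20 : 0 < #|{: T2}| by rewrite !card_prod !muln_gt0 !card_bits_gt0.
apply: (@le_trans _ _ (prob R T2 EC + prob R T2 EM)%R).
  rewrite -(balanced_prob R EC T10 bal1) -(balanced_prob R EM T10 bal1) addrC.
  apply: le_trans (prob_or _ _ _); apply: prob_sub => -[rG [r1 r2]] /=.
  exact: fool_caught.
apply: lerD.
  rewrite -(balanced_prob R EC T30 bal2); apply: prob_sub => -[g r].
  suff imp : caught l (pre (mlen l) r) g (pre (clock ch l) (drop (mlen l) r))
        (pre (clock co l) (drop (mlen l + p1) r)) ->
      (output a l [::] [:: unary l; seed g] r 0 != output a l [::] [:: unary l; seed g] r 1)
      && (H (seed g) (output a l [::] [:: unary l; seed g] r 0)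
          == H (seed g) (output a l [::] [:: unary l; seed g] r 1)) by exact: imp.
  rewrite /caught -/(seed g).
  have Hv : valid GenH l (seed g) by exists g.
  have [_ /(_ r)] := aP l (seed g) Hv; rewrite size_tuple => /(_ le_a)[_ -> ->].
  have s0 : size (take (mlen l) r) = mlen l.
    by rewrite size_takel // size_tuple; apply: leq_trans le_a; apply: leq_addr.
  have s1 : size (take p1 (drop (mlen l) r)) = p1.
    by rewrite size_takel // size_drop size_tuple; move: le_a; rewrite /adv_coins /p1; lia.
  have s2 : size (take (l ^ c2 + c2) (drop (mlen l + p1) r)) = l ^ c2 + c2.
    by rewrite size_takel // size_drop size_tuple; move: le_a; rewrite /adv_coins /p1; lia.
  rewrite (preE (_ : mlen l <= size r)); last first.
    by rewrite size_tuple; apply: leq_trans le_a; apply: leq_addr.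
  have E1 : pre (clock ch l) (drop (mlen l) r) = pre (clock ch l) (take p1 (drop (mlen l) r)).
    apply: eq_from_tnth => k; rewrite !tnth_mktuple nth_take //.
    exact: leq_trans (ltn_ord k) (clock1 l).
  have E2 : pre (clock co l) (drop (mlen l + p1) r)
      = pre (clock co l) (take (l ^ c2 + c2) (drop (mlen l + p1) r)).
    apply: eq_from_tnth => k; rewrite !tnth_mktuple nth_take //.
    exact: leq_trans (ltn_ord k) (clock2 l).
  have le1 : clock ch l <= size (take p1 (drop (mlen l) r)) by rewrite s1 clock1.
  have le2 : clock co l <= size (take (l ^ c2 + c2) (drop (mlen l + p1) r)) by rewrite s2 clock2.
  have [_ Ew] := adv_word_pre Hv s0 le1 le2.
  have Ec : cw l (take (mlen l) r) (seed g) (take p1 (drop (mlen l) r))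
     = cw l (take (mlen l) r) (seed g) (pre (clock ch l) (take p1 (drop (mlen l) r))).
    by rewrite /adv_cw; have [_ ->] := adv_msg_pre 0 Hv s0 le1.
  by rewrite E1 E2 -Ew -Ec.
have bM : balanced (fun t : T2 => t.1.1).
  have bf (X Y : finType) : 0 < #|Y| -> balanced (fun t : X * Y => t.1).
    move=> Y0 y; rewrite card_prod mulnC; congr (_ * _).
    rewrite -[RHS]mul1n -(card1 y) -cardsT -cardX; apply: eq_card => -[u v].
    by rewrite !inE andbT.
  apply: (@balanced_comp _ _ _ (fun t : T2 => t.1) (fun t => t.1)).
  - by rewrite card_prod muln_gt0 !card_bits_gt0.
  - by apply: bf; rewrite card_prod muln_gt0 !card_bits_gt0.
  - by apply: bf; rewrite card_bits_gt0.
rewrite (balanced_prob R (fun M => ~~ goodb (n l) (ell l) M) T20 bM).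
apply: le_trans (bad_matrix_prob _ _ n4) _.
by apply: ler_wiXn2l => //; [rewrite invr_ge0 | rewrite invf_le1 ?ler1n].
Qed.

End Channel.

End Length.

End Main.

Lemma lg_mul c m : trunc_log 2 (c * m) <= c + trunc_log 2 m.
Proof.
apply: lg_leq; rewrite -addnS expnD.
apply: leq_ltn_trans (_ : 2 ^ c * m < _); last by rewrite ltn_pmul2l ?expn_gt0 // lg_lt.
by rewrite leq_mul2r ltnW ?orbT // ltn_expl.
Qed.

Lemma polylog_queries (q ell n : nat -> nat) :
  (forall l, 0 < ell l -> 0 < trunc_log 2 (n l) ->
     q l <= ell l * (9 * trunc_log 2 (n l) ^ 9)) ->
  eventually (fun l => 0 < ell l) -> eventually (fun l => 0 < trunc_log 2 (n l)) ->
  polylog ell id -> big_theta id n -> polylog q n.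
Proof.
move=> Hq He Hn [c1 H1] [c2 H2].
(* Coefficient plus exponent, since [polylog] uses one number in both roles. *)
exists (9 * c1 * c2.+1 ^ c1 + (c1 + 9)).
apply: eventually_imp (eventually_and (eventually_and He Hn) (eventually_and H1 H2)).
move=> l [[e0 k0] [el [ln _]]].
apply: leq_trans (Hq l e0 k0) _.
set k := trunc_log 2 (n l) in k0 *.
have lk : trunc_log 2 l <= c2.+1 * k.
  apply: leq_trans (leq_trunc_log 2 ln) _; apply: leq_trans (lg_mul _ _) _.
  by rewrite -/k mulSn addnC leq_add2l leq_pmulr.
have {}el : ell l <= c1 * (c2.+1 ^ c1 * k ^ c1).
  apply: leq_trans el _; rewrite leq_mul2l -expnMn.
  by apply/orP; right; case: (c1) => // c; rewrite leq_exp2r.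
apply: leq_trans (leq_mul el (leqnn _)) _.
have -> : c1 * (c2.+1 ^ c1 * k ^ c1) * (9 * k ^ 9) = 9 * c1 * c2.+1 ^ c1 * k ^ (c1 + 9).
  by rewrite expnD; lia.
apply: leq_mul; first exact: leq_addr.
by rewrite leq_pexp2l // leq_addl.
Qed.

Local Open Scope ring_scope.

Theorem mainTheorem1 (R : realType) (ell : nat -> nat)
    (crhf_exists : exists (GenH : alg) (H : bits -> bits -> bits),
       CRHF R ell GenH H) :
  exists tau' : R, 0 < tau' < 1 /\
  exists mu gamma : nat -> R, negligible mu /\ negligible gamma /\
  forall tau : R, tau <= tau' ->
  exists rho kappa : R, 0 < rho < 1 /\ 0 < kappa < 1 /\
  forall n : nat -> nat, admissible_length n ->
  exists (C : local_code) (q : nat -> nat),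
    [/\ forall l : nat, block_len C l = n l,
        constant_rate C kappa,
        weak_CRLCC C q tau rho gamma mu,
        times_polylog q ell n
      & polylog ell id -> big_theta id n -> polylog q n].
Proof.
have [GenH [H crhf]] := crhf_exists.
have [genP hashP ellP sec] := crhf.
have [mu negl_mu mu_dom] := universal_bound sec.
have [cG clockG] := genP.1.
exists 128%:R^-1; split; first by rewrite invr_gt0 invf_lt1 ?ltr0n // ltr1n.
(* The first summand bounds the collision probability of every reduction, the second the probability
   of a bad matrix. *)
exists (fun l => mu l + tiny R l), (tiny R).
split; first exact: negligible_add negl_mu (negligible_tiny R).
split; first exact: negligible_tiny.
(* The rate 1/64 comes from [rate_bound]. *)
move=> tau tauP; exists 2%:R^-1, 64%:R^-1.
split; first by rewrite invr_gt0 invf_lt1 ?ltr0n // ltr1n.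
split; first by rewrite invr_gt0 invf_lt1 ?ltr0n // ltr1n.
move=> n [n_gt0 [cn n_rel] n_len].
have n_poly l : (n l <= l ^ cn + cn)%N by case: (n_rel l).
have le_n l : (l <= n l ^ cn + cn)%N by case: (n_rel l).
have [aG [polyG coinsG specG]] := gen_alg genP n_len clockG.
have [aE [polyE specE]] := enc_alg genP hashP ellP n_gt0 n_len clockG n_poly.
have [aD [polyD coinsD specD]] := dec_alg genP hashP ellP n_gt0 n_len clockG n_poly.
pose C := crlcc ell n aG aE aD.
exists C, (fun l => nqueries (n l) (ell l)).
have ell0 := ell_gt0 crhf.
have lg0 := lg_unbounded le_n 1.
split=> //.
- apply: eventually_imp (eventually_and ell0 (n_unbounded le_n 64)) => l [e0 n64].
  rewrite mulrC ler_pdivrMr ?ltr0n // -natrM ler_nat mulnC.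
  exact: rate_bound.
- split.
  + exact: (is_local_code_crlcc crhf n_gt0 n_len clockG polyG coinsG specG polyE specE
      polyD coinsD specD).
  + by move=> l rG w i r sw lti;
      have [] := decodeE aE coinsG specG coinsD specD rG r sw lti.
  + move=> l rG x i r sx lti /=.
    have [_ ->] := encodeE aD coinsG specG specE rG sx.
    set c := encw _ _ _ _ _; have sc : size c = n l by apply: size_encw.
    have [_ _ ->] := decodeE aE coinsG specG coinsD specD rG r sc lti.
    by rewrite (decw_encw _ (n_gt0 l) (hash_size crhf n rG)).
  + move=> A chan.
    have [[c1 clock1] [c2 clock2] _ _] := chan.
    have [p [Hp Hf]] := fool_reduction crhf n_gt0 n_len le_n clockG coinsG specG specE
      coinsD specD tauP chan clock1 clock2.
    apply: eventually_imp (eventually_and Hf (mu_dom p Hp)) => l [Hl Hm].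
    by apply: le_trans Hl _; rewrite lerD2r.
- exists 9; apply: eventually_imp (eventually_and ell0 lg0) => l [e0 k0].
  exact: nqueries_bound.
- apply: polylog_queries ell0 lg0 => l e0 k0; exact: nqueries_bound.
Qed.
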